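(* Let $n\ge 1$ be an integer and let $M$ be a $(2n+2)$-dimensional oriented closed $C^{\infty}$-manifold with an exact presymplectic form $\omega$, that is, there exists a $1$-form $\alpha\in\Omega^1(M)$ such that the $2$-form $\omega=d\alpha$ has rank $2n$ everywhere. Let $\mathcal{F}_{\omega}$ be the $2$-dimensional $C^\infty$-foliation of $M$ defined by the involutive distribution $\ker\omega$. Assume that $M$ admits a locally free (smooth) $T^2$-action, with infinitesimal generators $Z_1,Z_2$, satisfying the following conditions: (i) the $T^2$-action preserves $\omega$; (ii) the function $\alpha(Z_2)$ is constant on $M$. Then: (1) the foliation $\mathcal{F}_{\omega}$ has at least two leaves which are homeomorphic to a $2$-dimensional torus. (2) Moreover, if the function $\alpha(Z_1)$ is also constant on $M$, then $\mathcal{F}_{\omega}$ coincides with the foliation of $M$ by the orbits of the $T^2$-action and hence all leaves of $\mathcal{F}_{\omega}$ are homeomorphic to a $2$-dimensional torus.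
   Context: A closed manifold is a compact manifold without boundary. A presymplectic form on a manifold of dimension $2n+r$ is a closed $2$-form $\omega$ of constant rank $2n$, i.e. $\ker\omega(x)=\{v\in T_xM \mid \omega(x)(v,\cdot)=0\}$ has dimension $r$ for all $x\in M$. The distribution $\ker\omega$ is involutive, so by Frobenius' theorem it defines an $r$-dimensional foliation $\mathcal{F}_\omega$, whose leaves are the maximal connected integral manifolds of $\ker\omega$. $T^2=S^1\times S^1$ is the $2$-dimensional torus group. An action is locally free if all stabilizers are discrete. The infinitesimal generators $Z_1,Z_2$ of the $T^2$-action are the vector fields on $M$ generating the flows of the actions of the first and second circle factors: $Z_i(x)=\frac{d}{dt}\big|_{t=0}\,\rho(x,\exp(te_i))$, where $\rho:M\times T^2\to M$ is the action and $e_1,e_2$ is the standard basis of the Lie algebra of $T^2$. *)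

(* Defs.v *)
From HB Require Import structures.
From mathcomp Require Export all_boot all_order all_algebra.
From mathcomp Require Export all_classical all_reals all_analysis.
From mathcomp Require Import ring.

Export Order.TTheory GRing.Theory Num.Theory.
Export numFieldNormedType.Exports.

#[export] Set Implicit Arguments.
#[export] Unset Strict Implicit.
#[export] Unset Printing Implicit Defensive.

Local Open Scope classical_set_scope.
Local Open Scope ring_scope.

(* In finite dimension the derivative x |-> 'd f x is of class C^k if and only
   if every x |-> 'D_v f x is. The set U is always open where this is used. *)
Fixpoint Ck_on (R : realType) (V W : normedModType R) (k : nat)
    (U : set V) (f : V -> W) : Prop :=
  match k with
  | 0 => forall x, U x -> {for x, continuous f}
  | k'.+1 => (forall x, U x -> differentiable f x) /\
             (forall v, Ck_on k' U (fun x => 'D_v f x))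
  end.

Definition smooth_on (R : realType) (V W : normedModType R)
    (U : set V) (f : V -> W) : Prop := forall k, Ck_on k U f.

(* A chart is a total function of which only the restriction to [dom i]
   matters; [param i] is its inverse, of which only the restriction to the
   open set [chart i @` dom i] matters. *)
Record manifold (R : realType) (m : nat) := Manifold {
  points :> topologicalType;
  hausdorff : hausdorff_space points;
  countable_base : @second_countable points;
  index : Type;
  dom : index -> set points;
  chart : index -> points -> 'rV[R]_m;
  param : index -> 'rV[R]_m -> points;
  dom_open : forall i, open (dom i);
  dom_cover : forall x, exists i, dom i x;
  chartK : forall i x, dom i x -> param i (chart i x) = x;
  cod_open : forall i, open (chart i @` dom i);
  chart_continuous : forall i x, dom i x -> {for x, continuous (chart i)};
  param_continuous : forall i y, (chart i @` dom i) y ->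
    {for y, continuous (param i)};
  transition_smooth : forall i j,
    smooth_on (chart i @` (dom i `&` dom j)) (chart j \o param i)
}.

Arguments dom {R m} _ _ _.
Arguments chart {R m} _ _ _.
Arguments param {R m} _ _ _.

Definition cod (R : realType) (m : nat) (M : manifold R m) (i : index M) :
  set 'rV[R]_m := chart M i @` dom M i.

(* The charts of a manifold take values in open subsets of R^m, so that it has
   no boundary. *)
Definition closed_manifold (R : realType) (m : nat) (M : manifold R m) : Prop :=
  compact [set: M].

Definition smooth_map (R : realType) (m p : nat)
    (M : manifold R m) (N : manifold R p) (f : M -> N) : Prop :=
  continuous f /\
  forall (i : index M) (j : index N),
    smooth_on (chart M i @` (dom M i `&` f @^-1` dom N j))
              (chart N j \o f \o param M i).

(* The matrix of the tangent map of f at x, in the chart i around x and the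
   chart j around f x. Tangent vectors are row vectors, on which it acts on the
   right. *)
Definition tangent_mx (R : realType) (m p : nat)
    (M : manifold R m) (N : manifold R p) (f : M -> N)
    (i : index M) (j : index N) (x : M) : 'M[R]_(m, p) :=
  jacobian (chart N j \o f \o param M i) (chart M i x).

Definition change_mx (R : realType) (m : nat) (M : manifold R m)
    (i j : index M) (x : M) : 'M[R]_m := tangent_mx id i j x.

(* [positive o i x] says whether the basis of the tangent space at x given by
   the chart i is positively oriented. *)
Record orientation (R : realType) (m : nat) (M : manifold R m) := Orientation {
  positive : index M -> M -> bool;
  positive_locally_constant : forall i x, dom M i x ->
    \forall y \near x, positive i y = positive i x;
  positive_compatible : forall i j x, dom M i x -> dom M j x ->
    (positive i x == positive j x) = (0 < \det (change_mx i j x))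
}.

(* The value of the form at x on the tangent vector with coordinates u in the
   chart i is [(u *m form1_mx a i x) 0 0]. *)
Record form1 (R : realType) (m : nat) (M : manifold R m) := Form1 {
  form1_mx : index M -> M -> 'cV[R]_m;
  form1_smooth : forall i, smooth_on (cod i) (form1_mx i \o param M i);
  form1_change : forall i j x, dom M i x -> dom M j x ->
    form1_mx i x = change_mx i j x *m form1_mx j x
}.

(* The value of the form at x on the tangent vectors with coordinates u and v in
   the chart i is [(u *m form2_mx w i x *m v^T) 0 0]. *)
Record form2 (R : realType) (m : nat) (M : manifold R m) := Form2 {
  form2_mx : index M -> M -> 'M[R]_m;
  form2_smooth : forall i, smooth_on (cod i) (form2_mx i \o param M i);
  form2_skew : forall i x, dom M i x -> (form2_mx i x)^T = - form2_mx i x;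
  form2_change : forall i j x, dom M i x -> dom M j x ->
    form2_mx i x = change_mx i j x *m form2_mx j x *m (change_mx i j x)^T
}.

Definition partial (R : realType) (m : nat) (a : 'I_m) (f : 'rV[R]_m -> R)
    (y : 'rV[R]_m) : R := 'D_(delta_mx 0 a) f y.

Definition is_exterior_derivative (R : realType) (m : nat) (M : manifold R m)
    (alpha : form1 M) (w : form2 M) : Prop :=
  forall i x, dom M i x -> forall a b : 'I_m,
    form2_mx w i x a b =
      partial a (fun y => form1_mx alpha i (param M i y) b 0) (chart M i x) -
      partial b (fun y => form1_mx alpha i (param M i y) a 0) (chart M i x).

Definition closed_form2 (R : realType) (m : nat) (M : manifold R m)
    (w : form2 M) : Prop :=
  forall i x, dom M i x -> forall a b c : 'I_m,
    partial a (fun y => form2_mx w i (param M i y) b c) (chart M i x) +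
    partial b (fun y => form2_mx w i (param M i y) c a) (chart M i x) +
    partial c (fun y => form2_mx w i (param M i y) a b) (chart M i x) = 0.

Definition presymplectic (R : realType) (m : nat) (M : manifold R m)
    (k : nat) (w : form2 M) : Prop :=
  closed_form2 w /\ forall i x, dom M i x -> \rank (form2_mx w i x) = k.

Definition preserves_form2 (R : realType) (m : nat) (M : manifold R m)
    (f : M -> M) (w : form2 M) : Prop :=
  forall i j x, dom M i x -> dom M j (f x) ->
    tangent_mx f i j x *m form2_mx w j (f x) *m (tangent_mx f i j x)^T =
    form2_mx w i x.

(* Nonempty connected integral manifolds of dimension k of ker w, as injectively
   immersed submanifolds: their topology need not be induced by M. Note that
   [kermx] is the left kernel, which is ker w in the convention above. *)
Record integral_manifold (R : realType) (m : nat) (M : manifold R m)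
    (w : form2 M) (k : nat) := IntegralManifold {
  im_manifold :> manifold R k;
  im_map : im_manifold -> M;
  im_nonempty : [set: im_manifold] !=set0;
  im_connected : connected [set: im_manifold];
  im_smooth : smooth_map im_map;
  im_injective : injective im_map;
  im_immersion : forall i j p, dom im_manifold i p -> dom M j (im_map p) ->
    \rank (tangent_mx im_map i j p) = k;
  im_tangent : forall i j p, dom im_manifold i p -> dom M j (im_map p) ->
    (tangent_mx im_map i j p == kermx (form2_mx w j (im_map p)))%MS
}.

Definition im_set (R : realType) (m : nat) (M : manifold R m)
    (w : form2 M) (k : nat) (L : integral_manifold w k) : set M :=
  range (@im_map _ _ _ _ _ L).

Definition is_leaf (R : realType) (m : nat) (M : manifold R m)
    (w : form2 M) (k : nat) (L : integral_manifold w k) : Prop :=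
  forall L' : integral_manifold w k,
    im_set L `<=` im_set L' -> im_set L' = im_set L.

Definition unit_circle (R : realType) : set (R * R) :=
  [set z | z.1 ^+ 2 + z.2 ^+ 2 = 1].

(* The topologies on the circle and on the torus are the ones of the library:
   the subset topology and the product topology. *)
Definition circle (R : realType) := set_type (@unit_circle R).

Lemma circle_one_proof (R : realType) : @unit_circle R (1, 0).
Proof. by rewrite /unit_circle /= expr1n expr0n addr0. Qed.

Lemma circle_mul_proof (R : realType) (z w : R * R) :
  unit_circle z -> unit_circle w ->
  unit_circle (z.1 * w.1 - z.2 * w.2, z.1 * w.2 + z.2 * w.1).
Proof.
rewrite /unit_circle /= => hz hw.
have -> : (z.1 * w.1 - z.2 * w.2) ^+ 2 + (z.1 * w.2 + z.2 * w.1) ^+ 2 =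
  (z.1 ^+ 2 + z.2 ^+ 2) * (w.1 ^+ 2 + w.2 ^+ 2) by ring.
by rewrite hz hw mulr1.
Qed.

Lemma circle_exp_proof (R : realType) (t : R) : unit_circle (cos t, sin t).
Proof. by rewrite /unit_circle /= cos2Dsin2. Qed.

Definition circle_one (R : realType) : circle R :=
  SigSub (mem_set (circle_one_proof R)).

(* Multiplication of complex numbers of modulus one. *)
Definition circle_mul (R : realType) (z w : circle R) : circle R :=
  SigSub (mem_set (circle_mul_proof (set_valP z) (set_valP w))).

Definition circle_exp (R : realType) (t : R) : circle R :=
  SigSub (mem_set (circle_exp_proof t)).

Definition torus (R : realType) := (circle R * circle R)%type.

Definition torus_one (R : realType) : torus R := (circle_one R, circle_one R).

Definition torus_mul (R : realType) (g h : torus R) : torus R :=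
  (circle_mul g.1 h.1, circle_mul g.2 h.2).

(* The exponential map of the Lie group T^2, with Lie algebra R^2. *)
Definition torus_exp (R : realType) (t : 'rV[R]_2) : torus R :=
  (circle_exp (t 0 0), circle_exp (t 0 1)).

(* The smooth structure of T^2 is the one for which the covering [torus_exp] is
   a local diffeomorphism, so that a map on M x T^2 is smooth if and only if its
   composite with id x torus_exp is. *)
Record torus_action (R : realType) (m : nat) (M : manifold R m) :=
    TorusAction {
  act :> M -> torus R -> M;
  act_one : forall x, act x (torus_one R) = x;
  act_mul : forall x g h, act x (torus_mul g h) = act (act x g) h;
  act_continuous : continuous (fun z : M * torus R => act z.1 z.2);
  act_smooth : forall i j : index M,
    smooth_on
      [set z : 'rV[R]_m * 'rV[R]_2 |
         cod i z.1 /\ dom M j (act (param M i z.1) (torus_exp z.2))]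
      (fun z : 'rV[R]_m * 'rV[R]_2 =>
         chart M j (act (param M i z.1) (torus_exp z.2)))
}.

Definition orbit (R : realType) (m : nat) (M : manifold R m)
    (rho : torus_action M) (x : M) : set M := range (rho x).

Definition stabilizer (R : realType) (m : nat) (M : manifold R m)
    (rho : torus_action M) (x : M) : set (torus R) := [set g | rho x g = x].

Definition locally_free (R : realType) (m : nat) (M : manifold R m)
    (rho : torus_action M) : Prop :=
  forall x, stabilizer rho x `<=` isolated (stabilizer rho x).

(* Coordinates in the chart i of the a-th infinitesimal generator at x. *)
Definition generator (R : realType) (m : nat) (M : manifold R m)
    (rho : torus_action M) (a : 'I_2) (i : index M) (x : M) : 'rV[R]_m :=
  derive1 (fun t : R => chart M i (rho x (torus_exp (t *: delta_mx 0 a)))) 0.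

Definition constant_on_generator (R : realType) (m : nat) (M : manifold R m)
    (alpha : form1 M) (rho : torus_action M) (a : 'I_2) : Prop :=
  exists c : R, forall i x, dom M i x ->
    (generator rho a i x *m form1_mx alpha i x) 0 0 = c.

Definition homeomorphic (X Y : topologicalType) : Prop :=
  exists (f : X -> Y) (g : Y -> X),
    [/\ continuous f, continuous g, cancel f g & cancel g f].

(* Main.v *)
(*
Let Z be the generator of a circle in the torus, with flow phi. The function
b(t) = (phi_t^* alpha)_x(v) is periodic, and by Cartan's formula its derivative
is d(alpha(Z) o phi_t)(v) - omega(v, Z), where omega(v, Z) does not depend on t
because the action preserves omega. Hence, if alpha(Z) is constant, then Z lies
in ker omega: this gives Z_2, and under the hypothesis of (2) also Z_1. In
general, integrating over a period shows that the loop integral F(x) of alpha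
over the Z_1-orbit of x satisfies dF(v) = 2 pi omega(v, Z_1). Thus the torus orbits
through a maximum and a minimum of F are tangent to ker omega; if F is constant
then all orbits are, and there are at least two because dim M > 2.

An orbit tangent to ker omega is a leaf, by a uniqueness argument which avoids
the theory of ordinary differential equations: for a curve tangent to ker omega
which starts in the orbit, or in a compact piece of an integral manifold, the
distance to that set satisfies a Gronwall inequality, so the curve stays in it.
Such an orbit is a torus, through a basis of the lattice of its periods.
*)
From HB Require Import structures.
Require Import Defs.
From mathcomp Require Import ring lra zify.

Local Open Scope classical_set_scope.
Local Open Scope ring_scope.

(** * Calculus *)

(** A leaf is a maximal integral manifold with a topology of its own, so equality of point sets does
    not yet give a homeomorphism. The invariance argument is therefore used in two directions. An
    integral manifold that meets a tangent orbit stays in it, which gives maximality. Conversely, a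
    small piece of the orbit lies in the image of any prescribed neighbourhood in the integral
    manifold, which makes the bijection from the torus continuous. Forms exist only through their
    coefficients in charts. Cartan's formula is obtained there from the equality of the mixed second
    derivatives of the action; both generators are directions of a single flow with time in R^2.
    Time is rescaled so that a loop has period 1, which absorbs the factor 2 pi. A maximum and a
    minimum of F with different values lie on different orbits because F is constant on torus
    orbits. Along Z_1 this is periodicity; along Z_2, the derivative of alpha(Z_1) is omega(Z_2,
    Z_1) = 0, since alpha(Z_2) is constant and Z_2 lies in the kernel. *)

Section calculus.
Context {R : realType}.
Implicit Types U V W : normedModType R.

Lemma derive_comp U V W (f : V -> W) (c : U -> V) (x u : U) :
  differentiable f (c x) -> differentiable c x ->
  'D_u (f \o c) x = 'D_('D_u c x) f (c x).
Proof.
move=> df dc; have dfc : differentiable (f \o c) x by exact: differentiable_comp.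
by rewrite !deriveE // diff_comp.
Qed.

Lemma is_derive_comp_diff U V W (f : V -> W) (c : U -> V) (x u : U) :
  differentiable f (c x) -> differentiable c x ->
  is_derive x u (f \o c) ('D_('D_u c x) f (c x)).
Proof.
move=> df dc; have dfc : differentiable (f \o c) x by exact: differentiable_comp.
by split; [exact: diff_derivable|exact: derive_comp].
Qed.

Lemma is_derive_comp_curve V W (f : V -> W) (c : R -> V) (t : R) (v : V) :
  differentiable f (c t) -> is_derive t 1 c v ->
  is_derive t 1 (f \o c) ('D_v f (c t)).
Proof.
move=> df [dc cv]; rewrite -cv; apply: is_derive_comp_diff => //.
exact/derivable1_diffP.
Qed.

Lemma is_derive_line V (x v : V) (t : R) :
  is_derive t 1 (fun h : R => x + h *: v) v.
Proof.
have -> : (fun h : R => x + h *: v) = cst x + ( *:%R^~ v) by [].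
split; first exact: diff_derivable.
by rewrite deriveE // diffD // diff_cst diff_val /= [LHS]add0r scale1r.
Qed.

Lemma is_derive_along_line V W (f : V -> W) (x v : V) (t : R) :
  differentiable f (x + t *: v) ->
  is_derive t 1 (fun h : R => f (x + h *: v)) ('D_v f (x + t *: v)).
Proof.
by move=> df; exact: (is_derive_comp_curve (f := f) df (is_derive_line x v t)).
Qed.

Lemma is_derive_coord V m p (c : V -> 'M[R]_(m, p)) (x v : V) w i j :
  is_derive x v c w -> is_derive x v (fun t => c t i j) (w i j).
Proof.
move=> [dc <-]; split; first by move/derivable_mxP: dc.
by rewrite derive_mx // mxE.
Qed.

Lemma is_derive_within_continuous (f df : R -> R) (a b : R) :
  (forall x, x \in `[a, b] -> is_derive x 1 f (df x)) ->
  {within `[a, b], continuous f}.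
Proof.
by move=> h; apply: derivable_within_continuous => x /h [].
Qed.

Lemma MVT_derive (f df : R -> R) (a b : R) : a <= b ->
  (forall x, x \in `[a, b] -> is_derive x 1 f (df x)) ->
  exists2 c, c \in `[a, b] & f b - f a = df c * (b - a).
Proof.
move=> ab h.
have h1 : forall x, x \in `]a, b[%R -> is_derive x 1 f (df x).
  move=> x xab.
  apply: h.
  apply: subset_itv_oo_cc.
  exact: xab.
have h2 : {within `[a, b], continuous f}.
  exact: (@is_derive_within_continuous f df).
exact: (@MVT_segment R f df a b ab h1 h2).
Qed.

Lemma derive0_cst (f : R -> R) (a b : R) : a <= b ->
  (forall x, x \in `[a, b] -> is_derive x 1 f 0) -> f a = f b.
Proof.
move=> ab h; have [c _] := MVT_derive ab h.
by rewrite mul0r => /subr0_eq.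
Qed.

Lemma derive0_cst_mx m p (f : R -> 'M[R]_(m, p)) (a b : R) : a <= b ->
  (forall x, x \in `[a, b] -> is_derive x 1 f 0) -> f a = f b.
Proof.
move=> ab h; apply/matrixP => i j; apply: (derive0_cst (f := fun t => f t i j) ab).
by move=> x /h /is_derive_coord - /(_ i j); rewrite mxE.
Qed.

Lemma dist_le_derive (f df : R -> R) (a b e : R) : a <= b ->
  (forall x, x \in `[a, b] -> is_derive x 1 f (df x)) ->
  (forall x, x \in `[a, b] -> `|df x| <= e) ->
  `|f b - f a| <= e * (b - a).
Proof.
move=> ab h he; have [c cab ->] := MVT_derive ab h.
by rewrite normrM (ger0_norm (x := b - a)) ?subr_ge0 // ler_wpM2r ?subr_ge0 ?he.
Qed.

Lemma nbhs_line V (x v : V) (P : set V) :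
  nbhs x P -> \forall t \near (0 : R), P (x + t *: v).
Proof.
move=> Px; have : {for (0 : R), continuous (fun h : R => x + h *: v)}.
  apply: differentiable_continuous; apply/derivable1_diffP.
  by have [] := is_derive_line x v 0.
by apply; rewrite scale0r addr0.
Qed.

(* The derivatives are passed as variables because the kernel would otherwise
   unfold limits when it compares the two mixed derivatives. *)
Lemma schwarz_real V (f fu fw fuw fwu : V -> R) (U : set V) (z u w : V) :
  open U -> U z ->
  (forall y, U y -> differentiable f y) ->
  (forall y, U y -> 'D_u f y = fu y) -> (forall y, U y -> 'D_w f y = fw y) ->
  (forall y, U y -> differentiable fu y) ->
  (forall y, U y -> differentiable fw y) ->
  (forall y, U y -> 'D_u fw y = fuw y) -> (forall y, U y -> 'D_w fu y = fwu y) ->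
  {for z, continuous fuw} -> {for z, continuous fwu} ->
  fuw z = fwu z.
Proof.
move=> oU Uz df fuE fwE dfu dfw fuwE fwuE cuw cwu.
have [//|ne] := eqVneq (fuw z) (fwu z).
exfalso.
(* Half of the gap: on a small square at [z] each mixed derivative stays within [e] of its value at
   [z], so the two cannot take a common value there. *)
set e := `|fuw z - fwu z| / 2.
have e0 : 0 < e by rewrite divr_gt0 // normr_gt0 subr_eq0.
move: cuw cwu => /cvgrPdist_lt /(_ e e0) c1 /cvgrPdist_lt /(_ e e0) c2.
have oUz : \forall y \near z, U y by exact: open_nbhs_nbhs.
pose good := [set y | [/\ U y, `|fuw z - fuw y| < e & `|fwu z - fwu y| < e]].
have near1 : nbhs z good by near=> y; split; near: y.
have near2 : \forall p \near ((0, 0) : R * R), good (z + p.1 *: u + p.2 *: w).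
  have cont : (z + p.1 *: u + p.2 *: w) @[p --> ((0, 0) : R * R)] --> z.
    rewrite -[X in _ --> X](_ : z + (0 : R) *: u + (0 : R) *: w = z); last first.
      by rewrite !scale0r !addr0.
    apply: cvgD; last by apply: cvgZr_tmp; exact: cvg_snd.
    by apply: cvgD; [exact: cvg_cst|apply: cvgZr_tmp; exact: cvg_fst].
  exact: (cont _ near1).
have [d /= d0 hd] := (@nbhs_ballP _ _ _ _).1 near2.
pose h := d / 2.
have h0 : 0 < h by rewrite divr_gt0.
pose p s t := z + s *: u + t *: w.
have hb s t : s \in `[0, h] -> t \in `[0, h] -> good (p s t).
  rewrite !in_itv /= => /andP[s1 s2] /andP[t1 t2].
  suff: ball (0, 0) d (s, t) by move=> /hd.
  have hd2 : h < d by rewrite /h; lra.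
  by split; rewrite /= /ball /= sub0r normrN ger0_norm //;
    [exact: le_lt_trans s2 hd2|exact: le_lt_trans t2 hd2].
have line_u s t (g : V -> R) : differentiable g (p s t) ->
    is_derive s 1 (fun s => g (p s t)) ('D_u g (p s t)).
  rewrite /p addrAC => dg; under eq_fun do rewrite addrAC.
  exact: is_derive_along_line.
have line_w s t (g : V -> R) : differentiable g (p s t) ->
    is_derive t 1 (fun t => g (p s t)) ('D_w g (p s t)).
  by move=> dg; exact: is_derive_along_line.
have h00 : 0 \in `[0, h] by rewrite in_itv /= lexx ltW.
have hhh : h \in `[0, h] by rewrite in_itv /= lexx ltW.
(* The second difference over the square. Two mean values in either order write it as [h ^ 2] times
   a value of [fwu] and as [h ^ 2] times a value of [fuw]. *)
pose D := f (p h h) - f (p h 0) - (f (p 0 h) - f (p 0 0)).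
have [s1 s1h D1] : exists2 s, s \in `[0, h] & D = (fu (p s h) - fu (p s 0)) * h.
  have := @MVT_derive (fun s => f (p s h) - f (p s 0))
    (fun s => fu (p s h) - fu (p s 0)) 0 h (ltW h0).
  case=> [s sh|s sh e1].
    have [U1 _ _] := hb _ _ sh hhh; have [U2 _ _] := hb _ _ sh h00.
    by apply: is_deriveB; rewrite -fuE //; apply: line_u; exact: df.
  by exists s => //; rewrite -[X in _ * X]subr0 -e1.
have [t1 t1h D2] : exists2 t, t \in `[0, h] & D = (fw (p h t) - fw (p 0 t)) * h.
  have := @MVT_derive (fun t => f (p h t) - f (p 0 t))
    (fun t => fw (p h t) - fw (p 0 t)) 0 h (ltW h0).
  case=> [t th|t th e1].
    have [U1 _ _] := hb _ _ hhh th; have [U2 _ _] := hb _ _ h00 th.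
    by apply: is_deriveB; rewrite -fwE //; apply: line_w; exact: df.
  by exists t => //; rewrite -[X in _ * X]subr0 -e1 /D; ring.
have [t2 t2h E1] : exists2 t, t \in `[0, h] & D = fwu (p s1 t) * h * h.
  have := @MVT_derive (fun t => fu (p s1 t)) (fun t => fwu (p s1 t)) 0 h (ltW h0).
  case=> [t th|t th e1]; last by exists t => //; rewrite D1 e1 subr0.
  by have [U1 _ _] := hb _ _ s1h th; rewrite -fwuE //; apply: line_w; exact: dfu.
have [s2 s2h E2] : exists2 s, s \in `[0, h] & D = fuw (p s t1) * h * h.
  have := @MVT_derive (fun s => fw (p s t1)) (fun s => fuw (p s t1)) 0 h (ltW h0).
  case=> [s sh|s sh e1]; last by exists s => //; rewrite D2 e1 subr0.
  by have [U1 _ _] := hb _ _ sh t1h; rewrite -fuwE //; apply: line_u; exact: dfw.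
have eq12 : fwu (p s1 t2) = fuw (p s2 t1).
  by apply: (mulIf (lt0r_neq0 h0)); apply: (mulIf (lt0r_neq0 h0)); rewrite -E1.
have [_ _ b1] := hb _ _ s1h t2h.
have [_ b2 _] := hb _ _ s2h t1h.
rewrite eq12 distrC in b1.
have := ler_distD (fuw (p s2 t1)) (fuw z) (fwu z).
rewrite leNgt => /negP; apply.
rewrite [X in _ < X](_ : _ = e + e); last by rewrite /e; lra.
exact: ltrD.
Unshelve. all: by end_near. Qed.

End calculus.

(** * Maps of class C^k and pullbacks of exact forms *)

Section Ck.
Context {R : realType}.
Implicit Types U V W : normedModType R.

Lemma near_eq_differentiable V W (f g : V -> W) (x : V) :
  (\near x, f x = g x) -> differentiable f x -> differentiable g x.
Proof.
move=> fg df; have fgx : f x = g x by exact: nbhs_singleton fg.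
have [cdf e] := (diff_locallyP x f).1 df.
have eg : g \o shift x = cst (g x) + 'd f x +o_ 0 id.
  have fg0 : \forall h \near (0 : V), f (h + x) = g (h + x).
    have : {for (0 : V), continuous (fun h : V => h + x)}.
      by apply: cvgD; [exact: cvg_id|exact: cvg_cst].
    by move=> /(_ [set y | f y = g y]) /=; apply; rewrite add0r.
  apply/eqaddoP => eps eps0; move/eqaddoP : e => /(_ eps eps0).
  apply: filterS2 fg0 => h fgh; rewrite -![(_ + _ : _ -> _) _]/(_ + _).
  by rewrite -![(- _ : _ -> _) _]/(- _) /= /cst fgh fgx.
by apply/diff_locallyP; rewrite (diff_unique cdf eg).
Qed.

Lemma Ck_on_eq V W k (U : set V) (f g : V -> W) : open U ->
  (forall x, U x -> f x = g x) -> Ck_on k U f -> Ck_on k U g.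
Proof.
move=> oU; elim: k f g => [|k IH] f g fg /=.
  move=> h x Ux; have fgx : \near x, f x = g x.
    by apply: filterS fg _; exact: open_nbhs_nbhs.
  rewrite /prop_for /continuous_at -(fg x Ux).
  by apply: cvg_trans (h x Ux); apply: near_eq_cvg.
have fgx x : U x -> \near x, f x = g x.
  by move=> Ux; apply: filterS fg _; exact: open_nbhs_nbhs.
move=> [df cf]; split => [x Ux|v].
  exact: near_eq_differentiable (fgx x Ux) (df x Ux).
by apply: IH (cf v) => x Ux; apply: near_eq_derive; exact: fgx.
Qed.

Lemma Ck_on_sub V W k (U U' : set V) (f : V -> W) : U' `<=` U ->
  Ck_on k U f -> Ck_on k U' f.
Proof.
move=> sU; elim: k f => [|k IH] f /=; first by move=> h x /sU /h.
by move=> [df cf]; split=> [x /sU /df //|v]; exact: IH.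
Qed.

Lemma Ck_on_continuous V W k (U : set V) (f : V -> W) : Ck_on k U f ->
  forall x, U x -> {for x, continuous f}.
Proof.
by case: k => [//|k] [df _] x Ux; exact/differentiable_continuous/df.
Qed.

(** Since the derivative of [L] does not depend on the point, the derivative of [f \o L] along [v]
    is that of [f] along the fixed vector [D v], composed with [L]; the induction therefore never
    meets a product. *)
Lemma Ck_on_affine V V' W k (U : set V) (f : V -> W) (L : V' -> V) (D : V' -> V) :
  open U -> (forall x, differentiable L x) -> (forall x v, 'D_v L x = D v) ->
  Ck_on k U f -> Ck_on k (L @^-1` U) (f \o L).
Proof.
move=> oU dL DL; have oLU : open (L @^-1` U).
  by apply: open_comp => // x _; exact: differentiable_continuous.
elim: k f => [|k IH] f /=.
  move=> cf x Ux; apply: continuous_comp; last exact: cf.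
  exact/differentiable_continuous/dL.
move=> [df cf]; split=> [x Ux|v]; first exact: differentiable_comp (dL x) (df _ Ux).
apply: Ck_on_eq (IH _ (cf (D v))) => // x Ux.
by rewrite derive_comp ?DL //; exact: df.
Qed.

Lemma Ck_on_coord V m p k (U : set V) (f : V -> 'M[R]_(m, p)) i j : open U ->
  Ck_on k U f -> Ck_on k U (fun x => f x i j).
Proof.
move=> oU; elim: k f => [|k IH] f /=.
  move=> cf x Ux; apply: (@continuous_comp _ _ _ f (fun N : 'M[R]_(m, p) => N i j)).
    exact: cf.
  exact: coord_continuous.
move=> [df cf]; split=> [x Ux|v].
  apply: (@differentiable_comp _ _ _ _ f (fun N : 'M[R]_(m, p) => N i j)).
    exact: df.
  exact: differentiable_coord.
apply: Ck_on_eq (IH _ (cf v)) => // x Ux.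
by rewrite derive_mx ?mxE //; exact/diff_derivable/df.
Qed.

Lemma is_derive_row_col V m (g : V -> 'rV[R]_m) (h : V -> 'cV[R]_m) (z u : V) g' h' :
  is_derive z u g g' -> is_derive z u h h' ->
  is_derive z u (fun y => (g y *m h y) 0 0) ((g' *m h z + g z *m h') 0 0).
Proof.
move=> dg dh.
have -> : (fun y => (g y *m h y) 0 0) = \sum_k (fun y => g y 0 k * h y k 0).
  by apply/funext => y; rewrite mxE fct_sumE.
have -> : (g' *m h z + g z *m h') 0 0 =
    \sum_k (g z 0 k *: h' k 0 + h z k 0 *: g' 0 k).
  rewrite !mxE -big_split /=; apply: eq_bigr => k _.
  by rewrite addrC /GRing.scale /= [h z k 0 * _]mulrC.
apply: is_derive_sum => k.
exact: is_deriveM (is_derive_coord 0 k dg) (is_derive_coord k 0 dh).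
Qed.

Definition exterior_mx m (a : 'rV[R]_m -> 'cV[R]_m) (y : 'rV[R]_m) : 'M[R]_m :=
  \matrix_(k, l) (partial k (fun y => a y l 0) y - partial l (fun y => a y k 0) y).

Lemma derive_rV m W (f : 'rV[R]_m -> W) (y v : 'rV[R]_m) : differentiable f y ->
  'D_v f y = \sum_k v 0 k *: 'D_(delta_mx 0 k) f y.
Proof.
move=> df; rewrite deriveE // {1}(row_sum_delta v) linear_sum.
by apply: eq_bigr => k _; rewrite linearZ /= deriveE.
Qed.

(* Closedness of exact forms, pulled back by G: the second derivatives of G
   cancel. *)
Lemma pullback_exterior V m (G : V -> 'rV[R]_m) (a : 'rV[R]_m -> 'cV[R]_m)
    (U : set V) (z u w : V) : open U -> U z -> Ck_on 2 U G ->
  differentiable a (G z) ->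
  exists p q : R,
  [/\ is_derive z u (fun y => ('D_w G y *m a (G y)) 0 0) p,
      is_derive z w (fun y => ('D_u G y *m a (G y)) 0 0) q &
      p - q = ('D_u G z *m exterior_mx a (G z) *m ('D_w G z)^T) 0 0].
Proof.
move=> oU Uz [dG cG] da.
have [dGu cGu] := cG u; have [dGw cGw] := cG w.
set A := \matrix_(k, l) partial k (fun y => a y l 0) (G z).
have Da v : 'D_v a (G z) = (v *m A)^T.
  apply/matrixP => l j; rewrite ord1 derive_rV // !mxE summxE.
  apply: eq_bigr => k _; rewrite !mxE; congr (_ * _).
  by rewrite derive_mx ?mxE //; exact: diff_derivable.
have daG v : is_derive z v (a \o G) ('D_v G z *m A)^T.
  by rewrite -Da; apply: is_derive_comp_diff => //; exact: dG.
have sym : 'D_u ('D_w G) z = 'D_w ('D_u G) z.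
  apply/rowP => k.
  have dmx (H : V -> 'rV[R]_m) v y : differentiable H y ->
      'D_v H y 0 k = 'D_v (fun y => H y 0 k) y.
    by move=> dH; rewrite derive_mx ?mxE //; exact: diff_derivable.
  have dco (H : V -> 'rV[R]_m) y : differentiable H y ->
      differentiable (fun y => H y 0 k) y.
    move=> dH; apply: (@differentiable_comp _ _ _ _ H (fun N : 'rV[R]_m => N 0 k)) => //.
    exact: differentiable_coord.
  have cco (H : V -> 'rV[R]_m) y : {for y, continuous H} ->
      {for y, continuous (fun y => H y 0 k)}.
    move=> cH; apply: (@continuous_comp _ _ _ H (fun N : 'rV[R]_m => N 0 k)) => //.
    exact: coord_continuous.
  pose fu y := 'D_u G y 0 k; pose fw y := 'D_w G y 0 k.
  pose fuw y := 'D_u ('D_w G) y 0 k; pose fwu y := 'D_w ('D_u G) y 0 k.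
  change (fuw z = fwu z).
  apply: (@schwarz_real _ _ (fun y => G y 0 k) fu fw fuw fwu U z u w oU Uz).
  - by move=> y Uy; apply: dco; exact: dG.
  - by move=> y Uy; rewrite -(dmx G u y (dG y Uy)).
  - by move=> y Uy; rewrite -(dmx G w y (dG y Uy)).
  - by move=> y Uy; apply: dco; exact: dGu.
  - by move=> y Uy; apply: dco; exact: dGw.
  - by move=> y Uy; rewrite -(dmx _ u y (dGw y Uy)).
  - by move=> y Uy; rewrite -(dmx _ w y (dGu y Uy)).
  - by apply: cco; exact: cGw.
  - by apply: cco; exact: cGu.
have dP : is_derive z u ('D_w G) ('D_u ('D_w G) z).
  by apply: derivableP; apply: diff_derivable; exact: dGw.
have dQ : is_derive z w ('D_u G) ('D_u ('D_w G) z).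
  by rewrite sym; apply: derivableP; apply: diff_derivable; exact: dGu.
(* The common second derivative [s] contributes the same term to [p] and to [q]. It cancels in
   [p - q], which leaves the skew part [A - A^T]. *)
move: ('D_u ('D_w G) z) dP dQ {sym} => s dP dQ.
exists ((s *m a (G z) + 'D_w G z *m ('D_u G z *m A)^T) 0 0).
exists ((s *m a (G z) + 'D_u G z *m ('D_w G z *m A)^T) 0 0).
split; [exact: is_derive_row_col dP (daG u)|exact: is_derive_row_col dQ (daG w)|].
have -> : exterior_mx a (G z) = A - A^T by apply/matrixP => k l; rewrite !mxE.
have alg (x y : 'rV[R]_m) (c : 'M[R]_1) :
    (c + y *m (x *m A)^T) 0 0 - (c + x *m (y *m A)^T) 0 0 =
    (x *m (A - A^T) *m y^T) 0 0.
  have tr11 (B : 'M[R]_1) : B 0 0 = B^T 0 0 by rewrite mxE.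
  have addE (B C : 'M[R]_1) : (B + C) 0 0 = B 0 0 + C 0 0 by rewrite mxE.
  have oppE (B : 'M[R]_1) : (- B) 0 0 = - B 0 0 by rewrite mxE.
  rewrite mulmxBr mulmxBl !addE oppE opprD addrACA subrr add0r; congr (_ - _); last by rewrite trmx_mul mulmxA.
  by rewrite tr11 trmx_mul trmxK.
exact: alg.
Qed.

End Ck.

(** * Curves tangent to a kernel distribution *)

Section invariance.
Context {R : realType}.

Lemma mx_norm_le m p (A : 'M[R]_(m, p)) (c : R) :
  0 <= c -> (forall i j, `|A i j| <= c) -> `|A| <= c.
Proof.
move=> c0 h; rewrite [leLHS]/Num.Def.normr/= mx_normrE.
by apply: bigmax_le => // -[i j] _; exact: h.
Qed.

Lemma le_mx_norm m p (A : 'M[R]_(m, p)) i j : `|A i j| <= `|A|.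
Proof.
rewrite [leRHS]/Num.Def.normr/= mx_normrE.
exact: (le_bigmax _ (fun ij : 'I_m * 'I_p => `|A ij.1 ij.2|) (i, j)).
Qed.

Lemma mx_norm_mul m n p (A : 'M[R]_(m, n)) (B : 'M[R]_(n, p)) :
  `|A *m B| <= n%:R * (`|A| * `|B|).
Proof.
apply: mx_norm_le => [|i j]; first by rewrite !mulr_ge0.
rewrite mxE (le_trans (ler_norm_sum _ _ _)) //.
rewrite (le_trans (y := \sum_(k < n) (`|A| * `|B|))) //.
  by apply: ler_sum => k _; rewrite normrM ler_pM // le_mx_norm.
by rewrite sumr_const card_ord mulr_natl.
Qed.

(** The entrywise sup norm is submultiplicative only up to the inner dimension, hence the factor
    [r%:R]. The estimate [|u| <= 2 * |u *m A|] gives both the trivial kernel and the bound on the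
    inverse. *)
Lemma near1_unitmx r (A : 'M[R]_r) : r%:R * `|A - 1%:M| <= 1 / 2 ->
  A \in unitmx /\ forall z : 'rV[R]_r, `|z *m invmx A| <= 2 * `|z|.
Proof.
move=> hA; have est (u : 'rV[R]_r) : `|u| <= 2 * `|u *m A|.
  have e : u = u *m A - u *m (A - 1%:M) by rewrite mulmxBr mulmx1 opprB addrC subrK.
  have h1 : `|u *m (A - 1%:M)| <= `|u| / 2.
    rewrite (le_trans (mx_norm_mul _ _)) // mulrCA ler_wpM2l //.
    by rewrite -[leRHS]mul1r.
  have := ler_normB (u *m A) (u *m (A - 1%:M)); rewrite -e; lra.
have uA : A \in unitmx.
  rewrite -row_free_unit -kermx_eq0; apply/eqP/row_matrixP => i; rewrite row0.
  apply/eqP; rewrite -normr_le0 (le_trans (est _)) //.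
  by rewrite -row_mul mulmx_ker row0 normr0 mulr0.
split => // z; have := est (z *m invmx A).
by rewrite mulmxKV.
Qed.

Lemma local_lipschitz m (f : 'rV[R]_m -> R) (U : set 'rV[R]_m) (y0 : 'rV[R]_m) :
  open U -> U y0 -> Ck_on 1 U f ->
  exists2 d : R, 0 < d & exists2 C : R, 0 <= C &
    forall y q, `|y - y0| <= d -> `|q - y0| <= d -> `|f y - f q| <= C * `|y - q|.
Proof.
move=> oU Uy0 [df cf].
have near1 : \forall y \near y0, U y /\
    forall k : 'I_m, `|'D_(delta_mx 0 k) f y| < `|'D_(delta_mx 0 k) f y0| + 1.
  near=> y; split; first by near: y; exact: open_nbhs_nbhs.
  near: y; apply: filter_forall => k.
  have cc : {for y0, continuous (fun y => `|'D_(delta_mx 0 k) f y|)}.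
    have hh := cf (delta_mx 0 k) y0 Uy0.
    exact: (@cvg_norm _ _ _ (nbhs y0) (nbhs_filter y0) _ _ hh).
  by apply: (cvgr_lt _ cc); rewrite ltrDl.
have [d /= d0 hd] := (@nbhs_ballP _ _ _ _).1 near1.
exists (d / 2); first by rewrite divr_gt0.
(* On the ball each partial derivative is at most its size at [y0] plus 1, and a derivative along
   [y - q] is a combination of partial derivatives with coefficients bounded by [|y - q|]. *)
pose C := \sum_(k < m) (`|'D_(delta_mx 0 k) f y0| + 1).
exists C => [|y q hy hq]; first by apply: sumr_ge0 => k _; rewrite addr_ge0.
have inb t : t \in `[0, 1] -> ball y0 d (q + t *: (y - q)).
  rewrite in_itv /= => /andP[t0 t1]; rewrite -ball_normE /= distrC.
  rewrite [X in `|X|](_ : _ = t *: (y - y0) + (1 - t) *: (q - y0)); last first.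
    by apply/rowP => i; rewrite !mxE; ring.
  rewrite (le_lt_trans (ler_normD _ _)) // !normrZ !ger0_norm ?subr_ge0 //.
  have h1 : t * `|y - y0| <= t * (d / 2) by rewrite ler_wpM2l.
  have h2 : (1 - t) * `|q - y0| <= (1 - t) * (d / 2) by rewrite ler_wpM2l ?subr_ge0.
  lra.
have := @dist_le_derive R (fun t => f (q + t *: (y - q)))
  (fun t => 'D_(y - q) f (q + t *: (y - q))) 0 1 (C * `|y - q|) ler01.
rewrite subr0 mulr1 scale1r scale0r addr0 [q + (y - q)]addrC subrK; apply.
  by move=> t /inb /hd [Ut _]; apply: is_derive_along_line; exact: df.
move=> t /inb /hd [Ut ht]; rewrite derive_rV; last exact: df.
rewrite (le_trans (ler_norm_sum _ _ _)) // /C mulr_suml; apply: ler_sum => k _.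
rewrite normrZ mulrC ler_pM //; first exact/ltW/ht.
exact: le_mx_norm.
Unshelve. all: by end_near. Qed.

Lemma local_lipschitz_mx m p r (W : 'rV[R]_m -> 'M[R]_(p, r)) (U : set 'rV[R]_m)
    (y0 : 'rV[R]_m) :
  open U -> U y0 -> Ck_on 1 U W ->
  exists2 d : R, 0 < d & exists2 C : R, 0 <= C &
    forall y q, `|y - y0| <= d -> `|q - y0| <= d -> `|W y - W q| <= C * `|y - q|.
Proof.
move=> oU Uy0 cW.
have h (ij : 'I_p * 'I_r) : {dC : R * R | [/\ 0 < dC.1, 0 <= dC.2 &
    forall y q, `|y - y0| <= dC.1 -> `|q - y0| <= dC.1 ->
      `|W y ij.1 ij.2 - W q ij.1 ij.2| <= dC.2 * `|y - q|]}.
  apply: cid; have [d d0 [C C0 hC]] :=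
    local_lipschitz oU Uy0 (Ck_on_coord ij.1 ij.2 oU cW).
  by exists (d, C).
pose d : R := \big[Num.min/1]_ij (sval (h ij)).1.
pose C : R := \sum_ij (sval (h ij)).2.
have C0 : 0 <= C by apply: sumr_ge0 => ij _; have [] := svalP (h ij).
exists d.
  by apply: lt_bigmin => // ij _; have [] := svalP (h ij).
exists C => // y q hy hq.
apply: mx_norm_le => [|i j]; first by rewrite mulr_ge0.
have [d0 C0' hh] := svalP (h (i, j)).
have dle : d <= (sval (h (i, j))).1 by exact: bigmin_le.
rewrite !mxE (le_trans (hh y q _ _)) ?(le_trans hy) ?(le_trans hq) //.
rewrite ler_wpM2r // /C (bigD1 (i, j)) //= lerDl.
by apply: sumr_ge0 => ij _; have [] := svalP (h ij).
Qed.

(** Constant rank makes the kernel vary in a Lipschitz way. With [L *m W y0 *m Q = 1], the matrix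
    [A = L *m W q *m Q] stays invertible for [q] near [y0]. As [W q] has rank [r] too, the rows of
    [L *m W q] span its row space, so [W q = X *m (L *m W q)] and [w = v - v *m X *m L] lies in the
    kernel at [q]. Multiplying by [Q] gives [v *m X = z *m invmx A] with
    [z = v *m (W q - W y) *m Q], which is of order [|v| * |y - q|]. *)
Lemma kernel_lipschitz m p s (r : nat) (W : 'rV[R]_m -> 'M[R]_(p, s)) (U : set 'rV[R]_m)
    (y0 : 'rV[R]_m) :
  open U -> U y0 -> Ck_on 1 U W -> (forall y, U y -> \rank (W y) = r) ->
  exists2 d : R, 0 < d & exists2 K : R, 0 <= K &
    forall y q, `|y - y0| <= d -> `|q - y0| <= d ->
    forall v : 'rV[R]_p, v *m W y = 0 ->
    exists2 w : 'rV[R]_p, w *m W q = 0 & `|v - w| <= K * `|v| * `|y - q|.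
Proof.
move=> oU Uy0 cW rW.
have [d1 d10 [C C0 hC]] := local_lipschitz_mx oU Uy0 cW.
have [d2 /= d20 hd2] : exists2 d2 : R, 0 < d2 & forall y, `|y - y0| < d2 -> U y.
  have [d2 d20 hd2] := (@nbhs_ballP _ _ _ _).1 (open_nbhs_nbhs (conj oU Uy0)).
  by exists d2 => // y hy; apply: hd2; rewrite -ball_normE /= distrC.
have r0 := rW _ Uy0.
(* The rank factorization at [y0] provides an invertible block of size [r]. *)
pose L := (pid_mx r : 'M[R]_(r, p)) *m invmx (col_ebase (W y0)).
pose Q := invmx (row_ebase (W y0)) *m (pid_mx r : 'M[R]_(s, r)).
have LWQ : L *m W y0 *m Q = 1%:M.
  have rp : (r <= p)%N by rewrite -r0 rank_leq_row.
  have rm : (r <= s)%N by rewrite -r0 rank_leq_col.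
  rewrite -[in LHS](mulmx_ebase (W y0)) r0 /L /Q !mulmxA mulmxKV ?col_ebase_unit //.
  rewrite mulmxK ?row_ebase_unit // !mul_pid_mx.
  by rewrite !minnn (minn_idPr rp) minnn (minn_idPr rm) pid_mx_1.
(* [B * d] bounds [r%:R * |A - 1|] on the ball of radius [d], each matrix product costing its inner
   dimension; the last term in the choice of [d] brings it below 1/2. *)
pose B := r%:R * (s%:R * ((p%:R * (`|L| * C)) * `|Q|)).
have B0 : 0 <= B by rewrite !mulr_ge0.
pose d := Num.min d1 (Num.min (d2 / 2) (1 / (2 * (B + 1)))).
have d0 : 0 < d.
  by rewrite !lt_min d10 divr_gt0 //= divr_gt0 // mulr_gt0 // ltr_wpDl.
have dd1 : d <= d1 by rewrite /d ge_min lexx.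
have dd2 : d < d2 by rewrite /d 2!gt_min; apply/orP; right; apply/orP; left; lra.
have Bd : B * d <= 1 / 2.
  have B1 : 0 < B + 1 by rewrite ltr_wpDl.
  have dB : d <= 1 / (2 * (B + 1)) by rewrite /d 2!ge_min lexx !orbT.
  rewrite (le_trans (y := (B + 1) * (1 / (2 * (B + 1))))) //.
    by apply: ler_pM => //; [exact: ltW|rewrite lerDl].
  by rewrite (_ : (B + 1) * _ = 1 / 2) //; field; rewrite gt_eqF.
exists d => //.
exists (s%:R * (p%:R * C * `|Q|) * 2 * (r%:R * `|L|)).
  by rewrite !mulr_ge0.
move=> y q hy hq v vW0.
have yd1 := le_trans hy dd1; have qd1 := le_trans hq dd1.
pose A := L *m W q *m Q.
have [uA hA] : A \in unitmx /\ forall z : 'rV[R]_r, `|z *m invmx A| <= 2 * `|z|.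
  apply: near1_unitmx; rewrite -LWQ -mulmxBl -mulmxBr (le_trans _ Bd) //.
  rewrite /B -[leRHS]mulrA ler_wpM2l // (le_trans (mx_norm_mul _ _)) //.
  rewrite -[leRHS]mulrA ler_wpM2l // [leRHS]mulrAC ler_wpM2r //.
  rewrite (le_trans (mx_norm_mul _ _)) // -[leRHS]mulrA ler_wpM2l // -[leRHS]mulrA.
  rewrite ler_wpM2l //; apply: le_trans (hC q y0 qd1 _) _; last by rewrite ler_wpM2l.
  by rewrite subrr normr0 ltW.
have rkq : \rank (W q) = r by apply/rW/hd2/(le_lt_trans hq dd2).
have [X XE] : exists X, W q = X *m (L *m W q).
  apply/submxP; have sub : (L *m W q <= W q)%MS by exact: submxMl.
  rewrite -(geq_leqif (mxrank_leqif_sup sub)) rkq.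
  have rkA : \rank A = r by exact: mxrank_unit.
  by rewrite -{1}rkA mxrankM_maxl.
pose z := v *m (W q - W y) *m Q.
have zE : z = v *m W q *m Q by rewrite /z mulmxBr vW0 subr0.
exists (v - z *m invmx A *m L).
  have zA : z *m invmx A = v *m X.
    rewrite zE (_ : v *m W q *m Q = v *m X *m A) ?mulmxK //.
    by rewrite {1}XE /A !mulmxA.
  by rewrite zA mulmxBl {1}XE !mulmxA subrr.
rewrite opprB addrC subrK (le_trans (mx_norm_mul _ _)) //.
have zle : `|z| <= s%:R * (p%:R * C * `|Q|) * `|v| * `|y - q|.
  rewrite (le_trans (mx_norm_mul _ _)) // -!mulrA ler_wpM2l //.
  rewrite (le_trans (y := p%:R * (`|v| * (C * `|y - q|)) * `|Q|)) //.
    rewrite ler_wpM2r // (le_trans (mx_norm_mul _ _)) // ler_wpM2l // ler_wpM2l //.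
    by rewrite distrC hC.
  by rewrite le_eqVlt; apply/orP; left; apply/eqP; ring.
rewrite (le_trans (y := r%:R * (2 * (s%:R * (p%:R * C * `|Q|) * `|v| * `|y - q|) * `|L|))) //.
  rewrite ler_wpM2l // ler_wpM2r // (le_trans (hA z)) // ler_wpM2l //.
by rewrite le_eqVlt; apply/orP; left; apply/eqP; ring.
Qed.

(** The distance to a closed set need not be differentiable, so only lower semicontinuity and an
    upper bound on the right-hand growth are assumed. The function is compared with an exponential
    barrier at the first time when it would exceed it. *)
Lemma gronwall_dini (r : R -> R) (K : R) : 0 <= K -> r 0 <= 0 ->
  (forall t e, t \in `[0, 1] -> 0 < e ->
     exists2 d, 0 < d & forall s, s \in `[0, 1] -> `|s - t| < d -> r t <= r s + e) ->
  (forall t e, t \in `[0, 1[ -> 0 < e ->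
     \forall h \near 0^'+, r (t + h) <= r t + h * (K * r t + e)) ->
  forall t, t \in `[0, 1] -> r t <= 0.
Proof.
move=> K0 r0 rc rD t t01.
suff main e : 0 < e -> r t <= e * expR ((K + 1) * t).
  apply/ler_addgt0Pr => e e0; rewrite add0r.
  have E0 : 0 < expR ((K + 1) * t) :> R by exact: expR_gt0.
  by have := main (e / expR ((K + 1) * t)) (divr_gt0 e0 E0); rewrite divfK ?gt_eqF.
(* The barrier is at least [e] on [0, 1], so the extra 1 in the exponent absorbs the error [e] of
   the growth bound. *)
move=> e0; pose b s : R := e * expR ((K + 1) * s).
rewrite leNgt; apply/negP => bad.
pose A := [set s | s \in `[0, 1] /\ b s < r s].
have A0 : A !=set0 by exists t.
have lA : has_lbound A by exists 0 => s [] /=; rewrite in_itv /= => /andP[].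
pose T := inf A.
have Tt : T <= t by apply: ge_inf => //; split.
have T01 : T \in `[0, 1].
  move: t01; rewrite !in_itv /= => /andP[_ t1]; rewrite (le_trans Tt t1) andbT.
  by apply: lb_le_inf => // s [] /=; rewrite in_itv /= => /andP[].
have bmono x y : x <= y -> b x <= b y.
  by move=> xy; rewrite /b ler_pM2l // ler_expR ler_wpM2l // addr_ge0.
have T0 : 0 <= T by move: T01; rewrite in_itv => /andP[].
have eb : e <= b T.
  by rewrite /b ler_peMr ?(ltW e0) // -expR0 ler_expR mulr_ge0 // addr_ge0.
(* If the barrier were already exceeded at [T], lower semicontinuity would produce an earlier time
   in [A]. *)
have rT : r T <= b T.
  rewrite leNgt; apply/negP => badT.
  have [T00|T0'] := eqVneq T 0.
    by move: badT; rewrite ltNge T00 (le_trans r0) // ltW // (lt_le_trans e0) -?T00.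
  have Tpos : 0 < T by rewrite lt_neqAle eq_sym T0'.
  have [d d0 hd] := rc T ((r T - b T) / 2) T01 ltac:(by rewrite divr_gt0 // subr_gt0).
  pose s := Num.max 0 (T - d / 2).
  have sT : s < T by rewrite gt_max Tpos /=; lra.
  have s0 : 0 <= s by rewrite le_max lexx.
  have s01 : s \in `[0, 1].
    rewrite in_itv /= s0 /= (le_trans (ltW sT)) //.
    by move: T01; rewrite in_itv => /andP[].
  have sd : `|s - T| < d.
    rewrite distrC ger0_norm ?subr_ge0 ?(ltW sT) //.
    have : T - d / 2 <= s by rewrite le_max lexx orbT.
    lra.
  have := hd s s01 sd; have := bmono _ _ (ltW sT) => bb rs.
  have sA : A s by split => //; lra.
  have : T <= s by exact: ge_inf.
  by rewrite leNgt sT.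
have Tlt : T < t.
  rewrite lt_neqAle Tt andbT; apply/eqP => Tt'.
  by move: bad; rewrite -/(b t) -Tt' ltNge rT.
have T01' : T \in `[0, 1[.
  by move: t01; rewrite !in_itv /= T0 => /andP[_ t1]; exact: lt_le_trans Tlt t1.
have [d /= d0 hd] := (rD T e T01' e0).
have [s [s01 sb] sd] : exists2 s, A s & s < T + d.
  by apply: inf_adherent.
have Ts : T <= s by exact: ge_inf.
have Tns : T != s.
  by apply/eqP => Tse; move: sb; rewrite -Tse ltNge rT.
have := hd (s - T); rewrite [T + (s - T)]addrC subrK => h1.
have {h1} : r s <= r T + (s - T) * (K * r T + e).
  apply: h1; last by rewrite subr_gt0 lt_neqAle Tns.
  by rewrite /= sub0r normrN ger0_norm ?subr_ge0 // ltrBlDl.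
apply/negP; rewrite -ltNge (le_lt_trans _ sb) //.
have h2 : r T + (s - T) * (K * r T + e) <= b T * (1 + (K + 1) * (s - T)).
  have : (s - T) * (K * r T + e) <= (s - T) * (K * b T + b T).
    by rewrite ler_wpM2l ?subr_ge0 // lerD // ler_wpM2l.
  lra.
apply: le_trans h2 _.
have -> : b s = b T * expR ((K + 1) * (s - T)).
  by rewrite /b -mulrA -expRD -mulrDr [T + _]addrCA subrr addr0.
by rewrite ler_wpM2l ?expR_ge1Dx // (le_trans (ltW e0)).
Qed.

Lemma is_derive_expand (V : normedModType R) (c : R -> V) (t : R) (v : V) (e : R) :
  is_derive t 1 c v -> 0 < e ->
  \forall h \near 0, `|c (t + h) - c t - h *: v| <= e * `|h|.
Proof.
move=> [dc cv] e0; have /derivable_nbhs := dc.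
move/eqaddoP => /(_ e e0); apply: filterS => h.
rewrite -![(_ + _ : _ -> _) _]/(_ + _) -![(- _ : _ -> _) _]/(- _) /= cv.
by rewrite /cst [h%:A]mulr1 opprD addrA [h + t]addrC.
Qed.

(* [S] only needs one-sided tangent curves at its points: the distance to [S]
   satisfies a Gronwall inequality, which replaces the uniqueness of solutions
   of differential equations. *)
Lemma curve_invariant m s (r : nat) (W : 'rV[R]_m -> 'M[R]_(m, s)) (U S : set 'rV[R]_m)
    (y0 : 'rV[R]_m) (d0 : R) :
  open U -> U y0 -> Ck_on 1 U W -> (forall y, U y -> \rank (W y) = r) -> S y0 ->
  0 < d0 ->
  (forall d, 0 < d -> d <= d0 -> compact (S `&` [set y | `|y - y0| <= d])) ->
  (forall q, `|q - y0| <= d0 -> S q -> forall w : 'rV[R]_m, w *m W q = 0 ->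
    exists gam : R -> 'rV[R]_m, [/\ gam 0 = q, is_derive (0 : R) 1 gam w &
      \forall h \near 0^'+, S (gam h)]) ->
  exists2 d : R, 0 < d & forall (c c' : R -> 'rV[R]_m) (B : R), c 0 = y0 ->
    (forall t : R, t \in `[0, 1] -> [/\ is_derive t 1 c (c' t), `|c t - y0| <= d,
       c' t *m W (c t) = 0 & `|c' t| <= B]) ->
    forall t : R, t \in `[0, 1] -> S (c t).
Proof.
move=> oU Uy0 cW rW Sy0 d00 cS tanS.
have [dk dk0 [K K0 hK]] := kernel_lipschitz oU Uy0 cW rW.
(* The curve stays within [d] of [y0], hence its nearest point in [S'] within [2 * d], and a short
   tangent step from that point within [3 * d]. *)
pose d := Num.min d0 dk / 3.
have dpos : 0 < d by rewrite divr_gt0 // lt_min d00.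
have dd0 : 3 * d <= d0.
  have : Num.min d0 dk <= d0 by rewrite ge_min lexx.
  by rewrite /d; lra.
have ddk : 3 * d <= dk.
  have : Num.min d0 dk <= dk by rewrite ge_min lexx orbT.
  by rewrite /d; lra.
exists d => // c c' B c0 hc.
have B0 : 0 <= B.
  have [_ _ _] := hc 0 ltac:(by rewrite in_itv /= lexx ler01).
  exact: le_trans.
pose S' := S `&` [set y | `|y - y0| <= 3 * d].
have cS' : compact S' by apply: cS => //; lra.
have S'y0 : S' y0 by split => //=; rewrite subrr normr0; lra.
have nearest (x : 'rV[R]_m) : exists q : 'rV[R]_m, S' q /\ forall q', S' q' -> `|x - q| <= `|x - q'|.
  have S'n0 : S' !=set0 by exists y0.
  have cn : {within S', continuous (fun q : 'rV[R]_m => `|x - q|)}.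
    apply: continuous_subspaceT => q.
    apply: (@continuous_comp _ _ _ (fun q : 'rV[R]_m => x - q) (Num.norm : 'rV[R]_m -> R)).
      by apply: (@continuousB _ _ _ (cst x) id q); [exact: cst_continuous|exact: cvg_id].
    exact: norm_continuous.
  have [q] := compact_EVT_min S'n0 cS' cn.
  move=> /set_mem S'q hq; exists q; split => // q' S'q'.
  by apply: hq; rewrite inE.
pose N x := sval (cid (nearest x)).
have NS x : S' (N x) by have [] := svalP (cid (nearest x)).
have Nle x q : S' q -> `|x - N x| <= `|x - q|.
  by have [_] := svalP (cid (nearest x)); apply.
pose f t := `|c t - N (c t)|.
have f0 t : t \in `[0, 1] -> f t <= 0.
  apply: (@gronwall_dini f (K * B)); first by rewrite mulr_ge0.
  - by rewrite /f c0 (le_trans (Nle _ _ S'y0)) // subrr normr0.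
  - move=> {}t e t01 e0; have [dct _ _ _] := hc t t01.
    have cct : {for t, continuous c}.
      by apply: differentiable_continuous; apply/derivable1_diffP; case: dct.
    have [d1 /= d10 hd1] := (@nbhs_ballP _ _ _ _).1 ((cvgrPdist_lt _ _).1 cct e e0).
    exists d1 => // u u01 ut; rewrite /f (le_trans (Nle _ _ (NS (c u)))) //.
    rewrite -(subrKA (c u)) (le_trans (ler_normD _ _)) // addrC lerD2l ltW //.
    by apply: hd1; rewrite /ball /= distrC.
  move=> {}t e t01 e0; have t01' : t \in `[0, 1] by apply: subset_itv_co_cc t01.
  have [dct ctd cW0 cB] := hc t t01'.
  set q := N (c t); have [Sq qd] : S' q by exact: NS.
  have qd' : `|q - y0| <= 2 * d.
    have h1 := Nle (c t) y0 S'y0; rewrite -/q in h1.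
    have := ler_normB (c t - y0) (c t - q).
    rewrite [X in `|X|](_ : _ = q - y0); last by rewrite opprB addrC addrA subrK.
    lra.
  (* The velocity of the curve is moved to a kernel vector [w] at the nearest point [q], at the cost
     of an error [K * B * f t]. Following [S] from [q] with velocity [w] then bounds the growth of
     the distance. *)
  have [w wW hw] := hK (c t) q ltac:(lra) ltac:(lra) (c' t) cW0.
  have [gam [g0 dg Sg]] := tanS q ltac:(lra) Sq w wW.
  have e2 : 0 < e / 2 by rewrite divr_gt0.
  have E1 := is_derive_expand dct e2.
  have E2 := is_derive_expand dg e2.
  have w1 : 0 < `|w| + e / 2 + 1 by rewrite ltr_wpDl // addr_ge0 // ltW.
  near=> h.
  have h0 : 0 < h by near: h; exact: nbhs_right_gt.
  have e1 : `|c (t + h) - c t - h *: c' t| <= e / 2 * h.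
    rewrite -[h in leRHS](ger0_norm (ltW h0)); near: h; exact: cvg_within E1.
  have e3 : `|gam h - q - h *: w| <= e / 2 * h.
    rewrite -[h in leRHS](ger0_norm (ltW h0)) -[gam h](congr1 gam (add0r h)) -g0.
    near: h; exact: cvg_within E2.
  have Sgh : S (gam h) by near: h; exact: Sg.
  have hsmall : h * (`|w| + e / 2 + 1) <= d.
    rewrite -ler_pdivlMr //; near: h; apply: nbhs_right_le.
    by rewrite divr_gt0.
  have gd : `|gam h - q| <= d.
    have -> : gam h - q = (gam h - q - h *: w) + h *: w by rewrite subrK.
    rewrite (le_trans (ler_normD _ _)) // normrZ (ger0_norm (ltW h0)).
    by move: hsmall; rewrite !mulrDr mulr1; lra.
  have S'gh : S' (gam h).
    split => //=; have := ler_normD (gam h - q) (q - y0).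
    by rewrite addrA subrK; lra.
  rewrite /f (le_trans (Nle _ _ S'gh)) // -/q.
  have -> : c (t + h) - gam h = (c t - q) + ((c (t + h) - c t - h *: c' t) -
      (gam h - q - h *: w) + h *: (c' t - w)).
    by apply/rowP => i; rewrite !mxE; ring.
  rewrite (le_trans (ler_normD _ _)) // lerD2l (le_trans (ler_normD _ _)) //.
  rewrite normrZ (ger0_norm (ltW h0)).
  have h4 := ler_normB (c (t + h) - c t - h *: c' t) (gam h - q - h *: w).
  have h5 : h * `|c' t - w| <= h * (K * B * `|c t - q|).
    by rewrite (ler_wpM2l (ltW h0)) // (le_trans hw) // ler_wpM2r // ler_wpM2l.
  by rewrite mulrDr; lra.
move=> t t01; have /eqP : `|c t - N (c t)| = 0.
  by apply/eqP; rewrite eq_le normr_ge0 andbT; exact: f0.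
by rewrite normr_eq0 subr_eq0 => /eqP ->; have [] := NS (c t).
Unshelve. all: by end_near. Qed.
End invariance.

(** * The circle and the torus *)

Section torus_theory.
Context {R : realType}.
Implicit Types (z w : circle R) (g h : torus R) (s t a : 'rV[R]_2).

Lemma circle_eq z w : (val z).1 = (val w).1 -> (val z).2 = (val w).2 -> z = w.
Proof.
move=> e1 e2; apply: val_inj.
by rewrite [LHS]surjective_pairing e1 e2 -surjective_pairing.
Qed.

Lemma circleP z : (val z).1 ^+ 2 + (val z).2 ^+ 2 = 1.
Proof. exact: (set_valP z). Qed.

Lemma circle_expD (x y : R) : circle_exp (x + y) = circle_mul (circle_exp x) (circle_exp y).
Proof.
by apply: circle_eq; rewrite /= ?cosD // sinD addrC.
Qed.

Lemma circle_exp0 : circle_exp 0 = circle_one R.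
Proof. by apply: circle_eq; rewrite /= ?cos0 ?sin0. Qed.

Lemma circle_exp_period (x : R) : circle_exp (x + pi *+ 2) = circle_exp x.
Proof. by apply: circle_eq; rewrite /= ?cosD2pi ?sinD2pi. Qed.

Lemma circle_exp_periodz (x : R) (k : int) : circle_exp (x + k%:~R * (pi *+ 2)) = circle_exp x.
Proof.
have nat_case (n : nat) (y : R) : circle_exp (y + n%:R * (pi *+ 2)) = circle_exp y.
  elim: n => [|n IH]; first by rewrite mul0r addr0.
  by rewrite -natr1 mulrDl mul1r addrA circle_exp_period.
case: k => n; first exact: nat_case.
by rewrite -[LHS](nat_case n.+1) NegzE mulrNz mulNr -addrA addNr addr0.
Qed.

(** Reduction modulo a full turn gives [u] in [0, 2 pi) with [cos u = 1]. As the cosine is injective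
    only on [0, pi], a larger [u] is replaced by [2 pi - u]. *)
Lemma circle_exp_eq (x y : R) : circle_exp x = circle_exp y ->
  exists k : int, x = y + k%:~R * (pi *+ 2).
Proof.
move=> exy.
have c1 : cos x = cos y by have := congr1 (fun z => (val z).1) exy.
have s1 : sin x = sin y by have := congr1 (fun z => (val z).2) exy.
have cu : cos (x - y) = 1 by rewrite cosB c1 s1 -!expr2 cos2Dsin2.
have pi2 : 0 < pi *+ 2 :> R by rewrite pmulrn_lgt0 // pi_gt0.
pose k := Num.floor ((x - y) / (pi *+ 2)).
pose u := x - y - k%:~R * (pi *+ 2).
exists k; suff : u = 0 by rewrite /u => /eqP; rewrite subr_eq0 subr_eq addrC => /eqP.
have u0 : 0 <= u.
  by rewrite subr_ge0 -ler_pdivlMr // floor_le.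
have u2 : u < pi *+ 2.
  rewrite ltrBlDl [ltRHS](_ : _ = (k%:~R + 1) * (pi *+ 2)); last by ring.
  rewrite -ltr_pdivrMr //.
  by have := floorD1_gt ((x - y) / (pi *+ 2)); rewrite intrD.
have cu' : cos u = 1.
  have := circle_exp_periodz u k.
  rewrite /u subrK => e; transitivity (cos (x - y)); last exact: cu.
  by have /= := congr1 (fun z => (val z).1) e.
have [up|up] := leP u pi.
  apply: cos_inj; rewrite ?in_itv /= ?u0 ?up ?lexx ?pi_ge0 //.
  by rewrite cu' cos0.
exfalso; have cu2 : cos (pi *+ 2 - u) = 1.
  by rewrite cosB cos2pi sin2pi cu' mul0r mulr1 addr0.
have : pi *+ 2 - u = 0.
  apply: cos_inj; rewrite ?in_itv /= ?lexx ?pi_ge0 //.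
    by rewrite subr_ge0 (ltW u2) /= lerBlDr mulr2n lerD2l ltW.
  by rewrite cu2 cos0.
by move/eqP; rewrite subr_eq0 => /eqP e; move: u2; rewrite e ltxx.
Qed.

Lemma circle_exp_surj z : exists2 x : R, `|x| <= pi & circle_exp x = z.
Proof.
have hz := circleP z.
have z1 : -1 <= (val z).1 <= 1.
  rewrite -ler_norml -(@ler_pXn2r _ 2) ?nnegrE // expr1n real_normK ?num_real //.
  by rewrite -hz lerDl sqr_ge0.
have z2 : sin (acos (val z).1) = `|(val z).2|.
  by rewrite sin_acos // -sqrtr_sqr -hz addrAC subrr add0r.
have c1 : cos (acos (val z).1) = (val z).1 by rewrite acosK // in_itv.
have n1 : `|acos (val z).1| <= pi by rewrite ger0_norm ?acos_lepi // acos_ge0.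
have [z20|z20] := leP 0 (val z).2.
  by exists (acos (val z).1) => //; apply: circle_eq; rewrite //= z2 ger0_norm.
exists (- acos (val z).1); first by rewrite normrN.
apply: circle_eq; rewrite /= ?cosN //.
by rewrite sinN z2 ltr0_norm // opprK.
Qed.

Lemma continuous_circle_exp : continuous (@circle_exp R).
Proof.
apply: continuous_comp_initial => x.
have cs : (cos t, sin t) @[t --> x] --> (cos x, sin x).
  exact: cvg_pair (@continuous_cos R x) (@continuous_sin R x).
exact: cs.
Qed.

(* The arc of the circle within pi/2 of angle [x], and its angle function. *)
Definition arc (x : R) : set (circle R) :=
  [set z | 0 < (val z).1 * cos x + (val z).2 * sin x].

Definition angle (x : R) z : R := x + asin ((val z).2 * cos x - (val z).1 * sin x).

Lemma arc_exp (x y : R) : `|y - x| < pi / 2 -> arc x (circle_exp y).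
Proof.
rewrite /arc /= => h; have -> : cos y * cos x + sin y * sin x = cos (y - x).
  by rewrite cosB.
by apply: cos_gt0_pihalf; rewrite -ltr_norml.
Qed.

Lemma angle_exp (x y : R) : `|y - x| < pi / 2 -> angle x (circle_exp y) = y.
Proof.
rewrite /angle /= => h; have -> : sin y * cos x - cos y * sin x = sin (y - x).
  by rewrite sinB.
rewrite sinK; first by rewrite addrC subrK.
by rewrite in_itv /= -ler_norml; exact: ltW.
Qed.

Lemma arc_sqr (x : R) z :
  ((val z).1 * cos x + (val z).2 * sin x) ^+ 2 +
  ((val z).2 * cos x - (val z).1 * sin x) ^+ 2 = 1.
Proof.
transitivity (((val z).1 ^+ 2 + (val z).2 ^+ 2) * (cos x ^+ 2 + sin x ^+ 2)); first by ring.
by rewrite circleP cos2Dsin2 mulr1.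
Qed.

Lemma arc_lt1 (x : R) z : arc x z -> -1 < (val z).2 * cos x - (val z).1 * sin x < 1.
Proof.
rewrite /arc /= => h; have := arc_sqr x z.
rewrite -ltr_norml -(@ltr_pXn2r _ 2) ?nnegrE // expr1n real_normK ?num_real // => <-.
by rewrite ltrDr exprn_gt0.
Qed.

Lemma exp_angle (x : R) z : arc x z -> circle_exp (angle x z) = z.
Proof.
move=> hz; have h1 := arc_lt1 hz; have hs := arc_sqr x z.
rewrite /arc /= in hz.
set p := (val z).1 * cos x + (val z).2 * sin x in hz hs.
set q := (val z).2 * cos x - (val z).1 * sin x in h1 hs.
have q1 : -1 <= q <= 1 by case/andP: h1 => ? ?; rewrite !ltW.
have sq : sin (asin q) = q by rewrite asinK // in_itv.
have cq : cos (asin q) = p.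
  by rewrite cos_asin // -hs addrK sqrtr_sqr gtr0_norm.
rewrite /angle -/q; have e1 := cos2Dsin2 x.
apply: circle_eq; rewrite /= ?cosD ?sinD sq cq /p /q.
  by transitivity ((val z).1 * (cos x ^+ 2 + sin x ^+ 2)); [ring|rewrite e1 mulr1].
by transitivity ((val z).2 * (cos x ^+ 2 + sin x ^+ 2)); [ring|rewrite e1 mulr1].
Qed.

Lemma angle_bound (x : R) z : arc x z -> `|angle x z - x| < pi / 2.
Proof.
move=> /arc_lt1 /andP[h1 h2]; rewrite /angle addrC addKr ltr_norml.
by rewrite asin_gtNpi2 ?asin_ltpi2 ?h1 ?h2 ?ltW.
Qed.

Lemma continuous_circle_val : continuous (fun z => val z : R * R).
Proof. exact: initial_continuous. Qed.

Lemma continuous_circle1 : continuous (fun z => (val z).1).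
Proof.
move=> z; apply: (@continuous_comp _ _ _ (fun z : circle R => val z : R * R) fst).
  exact: continuous_circle_val.
exact: cvg_fst.
Qed.

Lemma continuous_circle2 : continuous (fun z => (val z).2).
Proof.
move=> z; apply: (@continuous_comp _ _ _ (fun z : circle R => val z : R * R) snd).
  exact: continuous_circle_val.
exact: cvg_snd.
Qed.

Lemma continuous_lin2 (T : topologicalType) (f g : T -> R) (p q : R) (y : T) :
  {for y, continuous f} -> {for y, continuous g} ->
  {for y, continuous (fun x => f x * p + g x * q)}.
Proof.
move=> cf cg; apply: (@continuousD _ _ _ (fun x => f x * p) (fun x => g x * q)).
  by apply: (@continuousM _ _ f (cst p)) => //; exact: cst_continuous.
by apply: (@continuousM _ _ g (cst q)) => //; exact: cst_continuous.
Qed.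

Lemma open_arc x : open (arc x).
Proof.
have -> : arc x = (fun z => (val z).1 * cos x + (val z).2 * sin x) @^-1` [set y | 0 < y] by [].
apply: open_comp; last exact: open_gt.
move=> z _; apply: (@continuous_lin2 (circle R) (fun z => (val z).1) (fun z => (val z).2)).
  exact: continuous_circle1.
exact: continuous_circle2.
Qed.

Lemma continuous_angle x z : arc x z -> {for z, continuous (angle x)}.
Proof.
move=> hz; have h1 := arc_lt1 hz.
pose f (z : circle R) := (val z).2 * cos x + (val z).1 * - sin x.
have cf : {for z, continuous f}.
  apply: (@continuous_lin2 (circle R) (fun z => (val z).2) (fun z => (val z).1)).
    exact: continuous_circle2.
  exact: continuous_circle1.
have ca : {for f z, continuous (fun y => x + asin y)}.
  apply: cvgD; first exact: cvg_cst.
  by apply: continuous_asin; rewrite /f mulrN.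
have -> : angle x = (fun y => x + asin y) \o f.
  by apply/funext => w; rewrite /angle /f /= mulrN.
exact: continuous_comp cf ca.
Qed.

Lemma compact_circle : compact [set: circle R].
Proof.
have -> : [set: circle R] = @circle_exp R @` `[- pi, pi].
  apply/seteqP; split=> z // _; have [x xpi <-] := circle_exp_surj z.
  by exists x => //=; rewrite in_itv /= -ler_norml.
apply: continuous_compact; last exact: segment_compact.
by apply: continuous_subspaceT; exact: continuous_circle_exp.
Qed.

Lemma hausdorff_circle : hausdorff_space (circle R).
Proof.
rewrite open_hausdorff => z w zw.
have oc (C : set (R * R)) : open C -> open ((fun z : circle R => val z : R * R) @^-1` C).
  move=> oC; apply: open_comp => // v _; exact: continuous_circle_val.
have : (val z : R * R) != val w by apply: contra zw => /eqP /val_inj ->.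
have h2 : hausdorff_space (R * R)%type by exact: norm_hausdorff.
rewrite open_hausdorff in h2 => /h2 [[A B] /= [zA wB] [oA oB AB]].
exists ((fun z : circle R => val z : R * R) @^-1` A, (fun z : circle R => val z : R * R) @^-1` B) => /=.
  by split; rewrite inE; apply: set_mem.
split.
- exact: oc.
- exact: oc.
- by rewrite /= -preimage_setI (eqP AB) preimage_set0.
Qed.

End torus_theory.

(** * Topology, periods and logarithms of the torus *)

Section torus_topology.
Context {R : realType}.

Lemma continuous_scalel (T : topologicalType) (V : normedModType R) (f : T -> R) (v : V)
    (t : T) : {for t, continuous f} -> {for t, continuous (fun x => f x *: v)}.
Proof.
move=> cf; apply: (@continuous_comp _ _ _ f (fun r : R => r *: v)) => //.
exact: scalel_continuous.
Qed.

Lemma continuous_pair (T X Y : topologicalType) (f : T -> X) (g : T -> Y) (t : T) :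
  {for t, continuous f} -> {for t, continuous g} ->
  {for t, continuous (fun x => (f x, g x))}.
Proof. by move=> cf cg; exact: cvg_pair cf cg. Qed.

Lemma hausdorff_prod (X Y : topologicalType) :
  hausdorff_space X -> hausdorff_space Y -> hausdorff_space (X * Y)%type.
Proof.
move=> hX hY [x1 y1] [x2 y2] cl.
have n1 (x : X) (y : Y) A : nbhs x A -> nbhs (x, y) (A `*` [set: Y]).
  by move=> nA; exists (A, setT) => //=; split => //; exact: filterT.
have n2 (x : X) (y : Y) A : nbhs y A -> nbhs (x, y) ([set: X] `*` A).
  by move=> nA; exists (setT, A) => //=; split => //; exact: filterT.
congr pair.
  apply: hX => A B nA nB.
  by have [[a b] /= [[Aa _] [Ba _]]] := cl _ _ (n1 _ _ _ nA) (n1 _ _ _ nB); exists a.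
apply: hY => A B nA nB.
by have [[a b] /= [[_ Ab] [_ Bb]]] := cl _ _ (n2 _ _ _ nA) (n2 _ _ _ nB); exists b.
Qed.

Lemma hausdorff_torus : hausdorff_space (torus R).
Proof. exact: hausdorff_prod hausdorff_circle hausdorff_circle. Qed.

Lemma compact_torus : compact [set: torus R].
Proof.
by rewrite -setXTT; apply: compact_setX; exact: compact_circle.
Qed.

Lemma second_countable_torus : @second_countable (torus R).
Proof.
have h (T : pseudoMetricType R) (x : T) : compact [set: T] -> @second_countable T.
  (* The criterion is stated for pointed spaces; the unit of the torus will serve as base point. *)
  pose T' : pseudoPMetricType R := HB.pack (PseudoMetric.sort T) (isPointed.Build (PseudoMetric.sort T) x).
  exact: (@compact_second_countable R T').
exact: (h (circle R * circle R)%type (torus_one R) compact_torus).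
Qed.

Lemma torus_expD (s t : 'rV[R]_2) :
  torus_exp (s + t) = torus_mul (torus_exp s) (torus_exp t).
Proof. by rewrite /torus_exp !mxE !circle_expD. Qed.

Lemma torus_exp0 : torus_exp 0 = torus_one R.
Proof. by rewrite /torus_exp !mxE !circle_exp0. Qed.

(** The lattice [2 pi Z^2], which is the kernel of [torus_exp]. *)
Definition period (k : 'rV[int]_2) : 'rV[R]_2 := \row_i ((k 0 i)%:~R * (pi *+ 2)).

Lemma torus_exp_period (s : 'rV[R]_2) k : torus_exp (s + period k) = torus_exp s.
Proof. by rewrite /torus_exp !mxE !circle_exp_periodz. Qed.

Lemma rV2P (s t : 'rV[R]_2) : s 0 0 = t 0 0 -> s 0 1 = t 0 1 -> s = t.
Proof.
move=> e0 e1; apply/rowP => i; case: (unliftP 0 i) => [j|] ->; last exact: e0.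
have -> : lift 0 j = 1 by rewrite [j]ord1; apply/val_inj.
exact: e1.
Qed.

Lemma torus_exp_eq (s t : 'rV[R]_2) : torus_exp s = torus_exp t ->
  exists k, s = t + period k.
Proof.
move=> e; have /circle_exp_eq [k0 e0] := congr1 fst e.
have /circle_exp_eq [k1 e1] := congr1 snd e.
exists (\row_i if i == 0 then k0 else k1).
by apply: rV2P; rewrite !mxE /=.
Qed.

Lemma torus_exp_surj (g : torus R) : exists2 s : 'rV[R]_2, `|s| <= pi & torus_exp s = g.
Proof.
have [x x1 ex] := circle_exp_surj g.1; have [y y1 ey] := circle_exp_surj g.2.
exists (\row_i if i == 0 then x else y).
  apply: mx_norm_le => [|i j]; first exact: pi_ge0.
  by rewrite !mxE; case: ifP.
by rewrite /torus_exp !mxE /= ex ey -surjective_pairing.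
Qed.

Lemma continuous_torus_exp : continuous (@torus_exp R).
Proof.
move=> s.
have c0 : {for s, continuous (fun s : 'rV[R]_2 => circle_exp (s 0 0))}.
  apply: (@continuous_comp _ _ _ (fun s : 'rV[R]_2 => s 0 0) (@circle_exp R)).
    exact: coord_continuous.
  exact: continuous_circle_exp.
have c1 : {for s, continuous (fun s : 'rV[R]_2 => circle_exp (s 0 1))}.
  apply: (@continuous_comp _ _ _ (fun s : 'rV[R]_2 => s 0 1) (@circle_exp R)).
    exact: coord_continuous.
  exact: continuous_circle_exp.
exact: (continuous_pair c0 c1).
Qed.

(** The images of the lines through 0 are connected, share the unit and cover the torus. *)
Lemma connected_torus : connected [set: torus R].
Proof.
have -> : [set: torus R] = \bigcup_(s in [set: 'rV[R]_2])
    ((fun t : R => torus_exp (t *: s)) @` setT).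
  apply/seteqP; split => [g _|//].
  have [s _ <-] := torus_exp_surj g.
  by exists s => //; exists 1 => //; rewrite scale1r.
apply: bigcup_connected => [|s _].
  by exists (torus_one R) => s _; exists 0 => //; rewrite scale0r torus_exp0.
apply: connected_continuous_connected; first by apply/connected_intervalP.
apply: continuous_subspaceT => t.
apply: (@continuous_comp _ _ _ (fun t : R => t *: s) (@torus_exp R)).
  exact: scalel_continuous.
exact: continuous_torus_exp.
Qed.

(** [box], [box_log] and [cell] will be the domain, the chart and the image of the torus chart
    centred at [torus_exp a]. *)
Definition box (a : 'rV[R]_2) : set (torus R) := arc (a 0 0) `*` arc (a 0 1).

Definition box_log (a : 'rV[R]_2) (g : torus R) : 'rV[R]_2 :=
  \row_i (if i == 0 then angle (a 0 0) g.1 else angle (a 0 1) g.2).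

Definition cell (a : 'rV[R]_2) : set 'rV[R]_2 :=
  [set s | `|s 0 0 - a 0 0| < pi / 2 /\ `|s 0 1 - a 0 1| < pi / 2].

Lemma open_box a : open (box a).
Proof.
have -> : box a = (fst @^-1` (arc (a 0 0))) `&` (snd @^-1` (arc (a 0 1))) by [].
apply: openI; apply: open_comp; try exact: open_arc.
  by move=> ? _; exact: cvg_fst.
by move=> ? _; exact: cvg_snd.
Qed.

Lemma box_exp a s : cell a s -> box a (torus_exp s).
Proof. by move=> [h0 h1]; split; exact: arc_exp. Qed.

Lemma box_log_exp a s : cell a s -> box_log a (torus_exp s) = s.
Proof. by move=> [h0 h1]; apply: rV2P; rewrite mxE /= angle_exp. Qed.

Lemma exp_box_log a g : box a g -> torus_exp (box_log a g) = g.
Proof.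
by move=> [h0 h1]; rewrite /torus_exp !mxE /= !exp_angle // -surjective_pairing.
Qed.

Lemma cell_box_log a g : box a g -> cell a (box_log a g).
Proof. by move=> [h0 h1]; split; rewrite mxE /=; exact: angle_bound. Qed.

Lemma cell_center a : cell a a.
Proof. by rewrite /cell /= !subrr !normr0 divr_gt0 // pi_gt0. Qed.

Lemma cell_image a : box_log a @` box a = cell a.
Proof.
apply/seteqP; split => [_ [g hg <-]|s hs]; first exact: cell_box_log.
by exists (torus_exp s); [exact: box_exp|exact: box_log_exp].
Qed.

Lemma open_cell a : open (cell a).
Proof.
have op i (c : R) : open [set s : 'rV[R]_2 | `|s 0 i - c| < pi / 2].
  apply: (@open_comp _ _ (fun s : 'rV[R]_2 => `|s 0 i - c|) [set x | x < pi / 2]); last exact: open_lt.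
  move=> s _.
  apply: (@continuous_comp _ _ _ (fun s : 'rV[R]_2 => s 0 i) (fun x => `|x - c|)).
    exact: coord_continuous.
  by apply: cvg_norm; apply: cvgB; [exact: cvg_id|exact: cvg_cst].
exact: openI (op 0 _) (op 1 _).
Qed.

Lemma continuous_box_log a g : box a g -> {for g, continuous (box_log a)}.
Proof.
move=> [h0 h1].
have c0 : {for g, continuous (fun g : torus R => angle (a 0 0) g.1)}.
  apply: (@continuous_comp _ _ _ fst (angle (a 0 0))); first exact: cvg_fst.
  exact: continuous_angle.
have c1 : {for g, continuous (fun g : torus R => angle (a 0 1) g.2)}.
  apply: (@continuous_comp _ _ _ snd (angle (a 0 1))); first exact: cvg_snd.
  exact: continuous_angle.
have -> : box_log a = (fun g => angle (a 0 0) g.1 *: delta_mx 0 0 + angle (a 0 1) g.2 *: delta_mx 0 1).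
  by apply/funext => g'; apply: rV2P; rewrite !mxE /= ?mulr1 ?mulr0 ?addr0 ?add0r.
exact: (@continuousD _ _ _ (fun g => _ *: _) (fun g => _ *: _) g
  (@continuous_scalel (torus R) _ _ _ _ c0) (@continuous_scalel (torus R) _ _ _ _ c1)).
Qed.

End torus_topology.

(** * The action in charts *)

(** A directional derivative sees only the restriction to a line. This identifies partial
    derivatives of a function of point and time with derivatives along curves, on different spaces
    and without a differentiability hypothesis. *)
Lemma derive_eq_line {R : realType} (V V' W : normedModType R) (f : V -> W)
    (g : V' -> W) (x v : V) (y w : V') :
  (forall h : R, f (h *: v + x) = g (h *: w + y)) -> 'D_v f x = 'D_w g y.
Proof.
move=> fg; have fg0 : f x = g y by have := fg 0; rewrite !scale0r !add0r.
rewrite /derive; suff -> : (fun h : R => h^-1 *: ((f \o shift x) (h *: v) - f x)) =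
  (fun h : R => h^-1 *: ((g \o shift y) (h *: w) - g y)) by [].
by apply/funext => h; rewrite /= fg fg0.
Qed.

Section manifold_theory.
Context {R : realType} {m : nat} {M : manifold R m}.

Lemma cod_chart i (x : M) : dom M i x -> cod i (chart M i x).
Proof. by move=> h; exists x. Qed.

Lemma dom_param i y : cod (M := M) i y -> dom M i (param M i y).
Proof. by move=> [x hx <-]; rewrite chartK. Qed.

Lemma paramK i y : cod (M := M) i y -> chart M i (param M i y) = y.
Proof. by move=> [x hx <-]; rewrite chartK. Qed.

Definition chart_at (x : M) : index M := sval (cid (dom_cover x)).

Lemma dom_chart_at x : dom M (chart_at x) x.
Proof. exact: svalP (cid (dom_cover x)). Qed.

End manifold_theory.

Section flow.
Context {R : realType} {m : nat} {M : manifold R m} (rho : torus_action M).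
Implicit Types (x : M) (s a : 'rV[R]_2).

(** Time is a vector of the Lie algebra R^2, so that both generators and their combinations are
    directions of one flow. *)
Definition flow s x : M := rho x (torus_exp s).

Lemma flowD s t x : flow (s + t) x = flow t (flow s x).
Proof. by rewrite /flow torus_expD act_mul. Qed.

Lemma flow0 x : flow 0 x = x.
Proof. by rewrite /flow torus_exp0 act_one. Qed.

Lemma flow_period s k x : flow (s + period k) x = flow s x.
Proof. by rewrite /flow torus_exp_period. Qed.

Lemma flowC s t x : flow s (flow t x) = flow t (flow s x).
Proof. by rewrite -!flowD addrC. Qed.

Lemma flowNK s x : flow (- s) (flow s x) = x.
Proof. by rewrite -flowD subrr flow0. Qed.

Lemma continuous_flow : continuous (fun z : M * 'rV[R]_2 => flow z.2 z.1).
Proof.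
move=> z; apply: (@continuous_comp _ _ _ (fun z : M * 'rV[R]_2 => (z.1, torus_exp z.2))
  (fun z : M * torus R => rho z.1 z.2)); last exact: act_continuous.
apply: continuous_pair; first exact: cvg_fst.
apply: (@continuous_comp _ _ _ snd (@torus_exp R)); first exact: cvg_snd.
exact: continuous_torus_exp.
Qed.

Lemma continuous_flowl x : continuous (fun s => flow s x).
Proof.
move=> s; apply: (@continuous_comp _ _ _ (fun s : 'rV[R]_2 => (x, s))
  (fun z : M * 'rV[R]_2 => flow z.2 z.1)); last exact: continuous_flow.
by apply: continuous_pair; [exact: cst_continuous|exact: cvg_id].
Qed.

Definition flow_chart i j (z : 'rV[R]_m * 'rV[R]_2) : 'rV[R]_m :=
  chart M j (flow z.2 (param M i z.1)).

Definition flow_dom i j : set ('rV[R]_m * 'rV[R]_2) :=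
  [set z | cod i z.1 /\ dom M j (flow z.2 (param M i z.1))].

Lemma flow_chart_Ck k i j : Ck_on k (flow_dom i j) (flow_chart i j).
Proof. exact: act_smooth. Qed.

Lemma flow_param_continuous i z : cod i z.1 ->
  {for z, continuous (fun z : 'rV[R]_m * 'rV[R]_2 => flow z.2 (param M i z.1))}.
Proof.
move=> cz; apply: (@continuous_comp _ _ _ (fun z : 'rV[R]_m * 'rV[R]_2 => (param M i z.1, z.2))
  (fun z : M * 'rV[R]_2 => flow z.2 z.1)); last exact: continuous_flow.
apply: continuous_pair; last exact: cvg_snd.
apply: (@continuous_comp _ _ _ fst (param M i)); first exact: cvg_fst.
exact: param_continuous.
Qed.

Lemma open_flow_dom i j : open (flow_dom i j).
Proof.
rewrite openE => z [cz dz]; rewrite /interior.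
have n1 : \near z, cod i z.1.
  have c1 : {for z, continuous (fun z : 'rV[R]_m * 'rV[R]_2 => z.1)} by exact: cvg_fst.
  by apply: c1; apply: open_nbhs_nbhs; split => //; exact: cod_open.
have n2 : \near z, dom M j (flow z.2 (param M i z.1)).
  apply: (flow_param_continuous cz); apply: open_nbhs_nbhs; split => //.
  exact: dom_open.
by apply: filterS2 n1 n2 => y ? ?; split.
Qed.

Lemma flow_domP i j x s : dom M i x -> dom M j (flow s x) -> flow_dom i j (chart M i x, s).
Proof. by move=> dx dy; split => /=; [exact: cod_chart|rewrite chartK]. Qed.

Lemma flow_domP0 i x : dom M i x -> flow_dom i i (chart M i x, 0).
Proof. by move=> dx; apply: flow_domP => //; rewrite flow0. Qed.

Lemma flow_chart_diff i j z : flow_dom i j z -> differentiable (flow_chart i j) z.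
Proof. by have [d _] := flow_chart_Ck 1 i j; exact: d. Qed.

Lemma flow_chartE i j x s : dom M i x -> flow_chart i j (chart M i x, s) = chart M j (flow s x).
Proof. by move=> dx; rewrite /flow_chart /= chartK. Qed.

(** The vector field generated by [a], taken as a partial derivative of the joint map [flow_chart]:
    linearity in [a] and regularity in the point are then inherited from the joint smoothness of the
    action. *)
Definition gen a i x : 'rV[R]_m := 'D_((0, a) : 'rV[R]_m * 'rV[R]_2) (flow_chart i i) (chart M i x, 0).

Lemma generatorE (a : 'I_2) i x : dom M i x -> generator rho a i x = gen (delta_mx 0 a) i x.
Proof.
move=> dx; rewrite /generator /gen derive1E; apply: derive_eq_line => h.
by rewrite /flow_chart /= scaler0 !add0r chartK // !addr0 [h%:A]mulr1.
Qed.

Lemma derive_flow_time i j x s a : dom M i x -> dom M j (flow s x) ->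
  'D_((0, a) : 'rV[R]_m * 'rV[R]_2) (flow_chart i j) (chart M i x, s) = gen a j (flow s x).
Proof.
move=> dx dy; apply: derive_eq_line => h; rewrite /flow_chart /=.
by rewrite !scaler0 !add0r !chartK // addr0 addrC flowD.
Qed.

Lemma genD a b i x : dom M i x -> gen (a + b) i x = gen a i x + gen b i x.
Proof.
move=> dx; have d : differentiable (flow_chart i i) (chart M i x, 0).
  by apply: flow_chart_diff; exact: flow_domP0.
rewrite /gen !deriveE // -raddfD /=; congr ('d _ _ _).
by congr pair; rewrite addr0.
Qed.

Lemma genZ (c : R) a i x : dom M i x -> gen (c *: a) i x = c *: gen a i x.
Proof.
move=> dx; have d : differentiable (flow_chart i i) (chart M i x, 0).
  by apply: flow_chart_diff; exact: flow_domP0.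
rewrite /gen !deriveE // -linearZ /=; congr ('d _ _ _).
by congr pair; rewrite scaler0.
Qed.

Lemma is_derive_flow j x s a (t : R) : dom M j (flow (s + t *: a) x) ->
  is_derive t 1 (fun t : R => chart M j (flow (s + t *: a) x)) (gen a j (flow (s + t *: a) x)).
Proof.
move=> dy; have dx := dom_chart_at x.
set i := chart_at x in dx.
rewrite -(derive_flow_time a dx dy).
have -> : (fun t : R => chart M j (flow (s + t *: a) x)) =
    (fun t : R => flow_chart i j ((chart M i x, s) + t *: (0, a))).
  by apply/funext => u; rewrite /flow_chart /= scaler0 addr0 chartK.
have e : (chart M i x, s + t *: a) = (chart M i x, s) + t *: (0, a) :> 'rV[R]_m * 'rV[R]_2.
  by congr pair; rewrite /= scaler0 addr0.
rewrite e; apply: is_derive_along_line; rewrite -e.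
by apply: flow_chart_diff; exact: flow_domP.
Qed.

Definition flow_mx s i j x : 'M[R]_m := tangent_mx (rho^~ (torus_exp s)) i j x.

Lemma flow_map_diff s i j x : dom M i x -> dom M j (flow s x) ->
  differentiable (chart M j \o flow s \o param M i) (chart M i x).
Proof.
move=> dx dy.
have -> : chart M j \o flow s \o param M i = flow_chart i j \o (fun y : 'rV[R]_m => (y, s)) by [].
apply: differentiable_comp; last by apply: flow_chart_diff; exact: flow_domP.
by apply: differentiable_pair => //.
Qed.

Lemma mul_flow_mx s i j x (v : 'rV[R]_m) : dom M i x -> dom M j (flow s x) ->
  v *m flow_mx s i j x = 'D_((v, 0) : 'rV[R]_m * 'rV[R]_2) (flow_chart i j) (chart M i x, s).
Proof.
move=> dx dy; rewrite /flow_mx /tangent_mx -deriveEjacobian; last exact: flow_map_diff.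
by apply: derive_eq_line => h; rewrite /flow_chart /= scaler0 add0r.
Qed.

Lemma flow_mx0 i j x : flow_mx 0 i j x = change_mx i j x.
Proof.
rewrite /flow_mx /change_mx; congr tangent_mx; apply/funext => y.
by rewrite torus_exp0 act_one.
Qed.

(** Generators are invariant because the torus is commutative: the same curve is differentiated as
    an orbit through [flow s x] and as the image under [flow s] of an orbit through [x]. The case
    [s = 0] is the change of charts. *)
Lemma gen_push s a i j x : dom M i x -> dom M j (flow s x) ->
  gen a j (flow s x) = gen a i x *m flow_mx s i j x.
Proof.
move=> dx dy.
have d1 : is_derive (0 : R) 1 (fun t : R => chart M j (flow (s + t *: a) x)) (gen a j (flow s x)).
  by have := @is_derive_flow j x s a 0; rewrite scale0r addr0; apply.
have d2 : is_derive (0 : R) 1 (fun t : R => chart M i (flow (0 + t *: a) x)) (gen a i x).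
  by have := @is_derive_flow i x 0 a 0; rewrite scale0r addr0 flow0; apply.
have df : differentiable (chart M j \o flow s \o param M i) (chart M i (flow (0 + 0 *: a) x)).
  by rewrite scale0r addr0 flow0; exact: flow_map_diff.
have d3 := is_derive_comp_curve df d2.
rewrite scale0r addr0 flow0 deriveEjacobian in d3; last exact: flow_map_diff.
have d4 : is_derive (0 : R) 1 (fun t : R => chart M j (flow (s + t *: a) x))
    (gen a i x *m flow_mx s i j x).
  apply: near_eq_is_derive d3.
  have nd : \forall t \near (0 : R), dom M i (flow (0 + t *: a) x).
    have : nbhs (0 : 'rV[R]_2) ((fun s => flow s x) @^-1` dom M i).
      apply: continuous_flowl; apply: open_nbhs_nbhs; split; first exact: dom_open.
      by rewrite flow0.
    exact: nbhs_line.
  apply: filterS nd => t dt /=; rewrite chartK // -flowD; congr (chart _ _ (flow _ _)).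
  by rewrite add0r addrC.
by case: d1 => _ <-; case: d4 => _ <-.
Qed.

Lemma flow_mx_change s i j k x : dom M i x -> dom M j (flow s x) -> dom M k (flow s x) ->
  flow_mx s i j x = flow_mx s i k x *m change_mx k j (flow s x).
Proof.
move=> dx dj dk.
have eJ v := mul_flow_mx v dx dj; have eT v := mul_flow_mx v dx dk.
move: (flow_mx s i k x) eT => T eT.
move: (flow_mx s i j x) eJ => J eJ.
apply/row_matrixP => l; rewrite !rowE mulmxA eT eJ.
have dz := flow_domP dx dk.
have dc : differentiable (chart M j \o id \o param M k) (flow_chart k k (chart M k (flow s x), 0)).
  have := @flow_map_diff 0 k j (flow s x) dk; rewrite flow0 => /(_ dj).
  rewrite flow_chartE // flow0.
  by congr (differentiable _ _); apply/funext => y; rewrite /= flow0.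
have e0 : flow_chart i k (chart M i x, s) = chart M k (flow s x) by exact: flow_chartE.
rewrite flow_chartE // flow0 -e0 in dc.
rewrite /change_mx /tangent_mx -e0 -(deriveEjacobian _ dc) -(derive_comp _ dc (flow_chart_diff dz)).
apply: near_eq_derive; near=> z; rewrite /= /flow_chart chartK //.
by have [] : flow_dom i k z by near: z; apply: open_nbhs_nbhs; split => //; exact: open_flow_dom.
Unshelve. all: by end_near. Qed.

End flow.

(** * Pullbacks of the primitive along the action *)

Lemma is_derive_eq_line {R : realType} (V V' W : normedModType R) (f : V -> W)
    (g : V' -> W) (x v : V) (y w : V') (p : W) :
  (forall h : R, f (h *: v + x) = g (h *: w + y)) ->
  is_derive x v f p -> is_derive y w g p.
Proof.
move=> fg [df <-]; split; last by apply: derive_eq_line => h; rewrite fg.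
have fg0 : f x = g y by have := fg 0; rewrite !scale0r !add0r.
move: df; rewrite /derivable.
suff -> : (fun h : R => h^-1 *: ((f \o shift x) (h *: v) - f x)) =
  (fun h : R => h^-1 *: ((g \o shift y) (h *: w) - g y)) by [].
by apply/funext => h; rewrite /= fg fg0.
Qed.

Section cartan.
Context {R : realType} {m : nat} {M : manifold R m} (rho : torus_action M).
Context (omega : form2 M) (alpha : form1 M).
Context (omega_exact : is_exterior_derivative alpha omega).
Context (rho_preserves_omega : forall g : torus R, preserves_form2 (rho^~ g) omega).
Implicit Types (x : M) (s a b : 'rV[R]_2).

Local Notation flow := (flow rho).
Local Notation gen := (gen rho).
Local Notation flow_mx := (flow_mx rho).

(** The function alpha(Z_a) on the whole of M; by [alphaZE] any chart around [x] gives the same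
    value. *)
Definition alphaZ a x : R := (gen a (chart_at x) x *m form1_mx alpha (chart_at x) x) 0 0.

Lemma alphaZE a i x : dom M i x -> alphaZ a x = (gen a i x *m form1_mx alpha i x) 0 0.
Proof.
move=> dx; have dc := dom_chart_at x; rewrite /alphaZ.
have := @gen_push _ _ _ rho 0 a i (chart_at x) x dx; rewrite flow0 => /(_ dc) ->.
by rewrite flow_mx0 -mulmxA -form1_change.
Qed.

(* The value at [v] of the pullback of [alpha] by the flow at time [s]. *)
Definition beta i (v : 'rV[R]_m) x s : R :=
  (v *m flow_mx s i (chart_at (flow s x)) x *m
   form1_mx alpha (chart_at (flow s x)) (flow s x)) 0 0.

Lemma betaE i v x s j : dom M i x -> dom M j (flow s x) ->
  beta i v x s = (v *m flow_mx s i j x *m form1_mx alpha j (flow s x)) 0 0.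
Proof.
move=> dx dy; have dc := dom_chart_at (flow s x); rewrite /beta.
rewrite (flow_mx_change dx dc dy) (form1_change alpha dy dc).
move: (flow_mx _ _ _ _) (change_mx _ _ _) (form1_mx _ _ _) => T C F.
by rewrite !mulmxA.
Qed.

(** Cartan's formula before any choice of direction: [pullback_exterior] is applied to the action in
    charts, with [(0, a)] as one of the two directions. A spatial [u] compares the pullbacks of
    alpha at different times; a temporal [u] compares two generators. *)
Lemma cartan i j x s a (u : 'rV[R]_m * 'rV[R]_2) : dom M i x -> dom M j (flow s x) ->
  let z := (chart M i x, s) in
  exists p q,
  [/\ is_derive z u (fun z => alphaZ a (flow z.2 (param M i z.1))) p,
      is_derive z ((0, a) : 'rV[R]_m * 'rV[R]_2)
        (fun z => ('D_u (flow_chart rho i j) z *m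
           form1_mx alpha j (flow z.2 (param M i z.1))) 0 0) q &
      p - q = ('D_u (flow_chart rho i j) z *m form2_mx omega j (flow s x) *m
        (gen a j (flow s x))^T) 0 0].
Proof.
move=> dx dy z.
pose al (y : 'rV[R]_m) := form1_mx alpha j (param M j y).
have dz : flow_dom rho i j z by exact: flow_domP.
have oD := @open_flow_dom _ _ _ rho i j.
have eG : flow_chart rho i j z = chart M j (flow s x) by exact: flow_chartE.
have dal : differentiable al (flow_chart rho i j z).
  rewrite eG; have [d _] := form1_smooth alpha j 1; apply: d.
  exact: cod_chart.
have [p [q [dp dq pq]]] :=
  pullback_exterior u (0, a) oD dz (flow_chart_Ck rho 2 i j) dal.
exists p, q.
have nD : \near z, flow_dom rho i j z by apply: open_nbhs_nbhs.
have param_G y : flow_dom rho i j y -> param M j (flow_chart rho i j y) = flow y.2 (param M i y.1).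
  by move=> [cy dy']; rewrite /flow_chart chartK.
have eqZ y : flow_dom rho i j y ->
    ('D_((0, a) : 'rV[R]_m * 'rV[R]_2) (flow_chart rho i j) y *m
      al (flow_chart rho i j y)) 0 0 = alphaZ a (flow y.2 (param M i y.1)).
  move=> Dy; have [cy dy'] := Dy; have e := derive_flow_time a (dom_param cy) dy'.
  rewrite paramK // -surjective_pairing in e; rewrite e.
  by rewrite /al (param_G y Dy) (alphaZE a dy').
have eqB y : flow_dom rho i j y ->
    ('D_u (flow_chart rho i j) y *m al (flow_chart rho i j y)) 0 0 =
    ('D_u (flow_chart rho i j) y *m form1_mx alpha j (flow y.2 (param M i y.1))) 0 0.
  by move=> Dy; rewrite /al (param_G y Dy).
split.
- apply: near_eq_is_derive dp; apply: filterS nD => y Dy; exact: eqZ.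
- apply: near_eq_is_derive dq; apply: filterS nD => y Dy; exact: eqB.
- rewrite pq; congr ((_ *m _ *m _^T) 0 0).
    apply/matrixP => k l; rewrite mxE (omega_exact dy) eG.
    by [].
  exact: derive_flow_time.
Qed.

(** Invariance of omega moves the right-hand side from [flow s x] back to [x], so that it no longer
    depends on the time [s]. *)
Lemma cartan_space i x s a v : dom M i x ->
  let z := (chart M i x, s) in
  exists p q,
  [/\ is_derive z ((v, 0) : 'rV[R]_m * 'rV[R]_2)
        (fun z => alphaZ a (flow z.2 (param M i z.1))) p,
      is_derive z ((0, a) : 'rV[R]_m * 'rV[R]_2)
        (fun z => beta i v (param M i z.1) z.2) q &
      p - q = (v *m form2_mx omega i x *m (gen a i x)^T) 0 0].
Proof.
move=> dx z; have dy := dom_chart_at (flow s x); set j := chart_at _ in dy.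
have [p [q [dp dq pq]]] := cartan a (v, 0) dx dy.
exists p, q; split; first exact: dp.
  have nD : \near z, flow_dom rho i j z.
    by apply: open_nbhs_nbhs; split; [exact: open_flow_dom|exact: flow_domP].
  apply: near_eq_is_derive dq; apply: filterS nD => y [cy dy'].
  rewrite (betaE v (dom_param cy) dy').
  by rewrite (mul_flow_mx _ (dom_param cy) dy') paramK // -surjective_pairing.
rewrite pq -(mul_flow_mx _ dx dy) (gen_push a dx dy) trmx_mul !mulmxA.
rewrite -[X in (X *m _) 0 0]mulmxA -[X in (X *m _) 0 0]mulmxA.
congr ((_ *m _) 0 0); congr (_ *m _).
by rewrite mulmxA; exact: (@rho_preserves_omega (torus_exp s) i j x dx dy).
Qed.

Definition omegaE i (v w : 'rV[R]_m) x : R := (v *m form2_mx omega i x *m w^T) 0 0.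

Lemma omegaC i v w x : dom M i x -> omegaE i v w x = - omegaE i w v x.
Proof.
move=> dx; rewrite /omegaE.
have tr11 (B : 'M[R]_1) : B 0 0 = B^T 0 0 by rewrite mxE.
by rewrite tr11 !trmx_mul trmxK form2_skew // mulNmx mulmxN mulmxA mxE.
Qed.

Lemma omegaE_ker i x w : dom M i x -> (forall v, omegaE i v w x = 0) ->
  w *m form2_mx omega i x = 0.
Proof.
move=> dx h; apply/rowP => k; have := h (delta_mx 0 k).
rewrite omegaC // /omegaE => /eqP; rewrite oppr_eq0 => /eqP; rewrite trmx_delta.
by rewrite -colE !mxE.
Qed.

Lemma cartan_line i x s a v : dom M i x ->
  exists p q,
  [/\ is_derive (0 : R) 1 (fun t => alphaZ a (flow s (param M i (chart M i x + t *: v)))) p,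
      is_derive (0 : R) 1 (fun t => beta i v x (s + t *: a)) q &
      p - q = omegaE i v (gen a i x) x].
Proof.
move=> dx; have [p [q [dp dq pq]]] := cartan_space s a v dx.
exists p, q; split; last exact: pq.
  apply: is_derive_eq_line dp => h /=.
  by rewrite scaler0 add0r addr0 [h%:A]mulr1 [h *: v + _]addrC.
apply: is_derive_eq_line dq => h /=.
by rewrite scaler0 add0r addr0 [h%:A]mulr1 [h *: a + _]addrC chartK.
Qed.

Lemma gen_flow_chart i j a y : flow_dom rho i j y ->
  'D_((0, a) : 'rV[R]_m * 'rV[R]_2) (flow_chart rho i j) y =
  gen a j (flow y.2 (param M i y.1)).
Proof.
move=> [cy dy]; have e := derive_flow_time a (dom_param cy) dy.
by rewrite paramK // -surjective_pairing in e.
Qed.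

(** The formula for d alpha(Z_b, Z_a), in which the bracket term is absent because the generators
    commute. *)
Lemma cartan_time i x a b : dom M i x ->
  exists p q,
  [/\ is_derive (0 : R) 1 (fun t => alphaZ a (flow (t *: b) x)) p,
      is_derive (0 : R) 1 (fun t => alphaZ b (flow (t *: a) x)) q &
      p - q = omegaE i (gen b i x) (gen a i x) x].
Proof.
move=> dx; have dy : dom M i (flow 0 x) by rewrite flow0.
have [p [q [dp dq pq]]] := cartan a (0, b) dx dy.
exists p, q; split; last first.
- by move: pq; rewrite (derive_flow_time b dx dy) flow0 => ->.
- have dq' : is_derive ((chart M i x, 0) : 'rV[R]_m * 'rV[R]_2) ((0, a) : 'rV[R]_m * 'rV[R]_2)
      (fun z => alphaZ b (flow z.2 (param M i z.1))) q.
    have nD : \forall y \near ((chart M i x, 0) : 'rV[R]_m * 'rV[R]_2), flow_dom rho i i y.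
      by apply: open_nbhs_nbhs; split; [exact: open_flow_dom|exact: flow_domP0].
    apply: near_eq_is_derive dq; apply: filterS nD => y Dy.
    have [cy dy'] := Dy; rewrite (alphaZE b dy').
    by rewrite (gen_flow_chart b Dy).
  apply: is_derive_eq_line dq' => h /=.
  by rewrite scaler0 add0r !addr0 [h%:A]mulr1 chartK.
apply: is_derive_eq_line dp => h /=.
by rewrite scaler0 add0r !addr0 [h%:A]mulr1 chartK.
Qed.

(* [beta] is periodic in time, with constant derivative [- omegaE]. *)
Lemma constant_kernel (k : 'rV[int]_2) a : a = period k ->
  (exists c, forall x, alphaZ a x = c) ->
  forall i x, dom M i x -> gen a i x *m form2_mx omega i x = 0.
Proof.
move=> ak [c hc] i x dx; apply: omegaE_ker => // v.
pose w := omegaE i v (gen a i x) x.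
have dB (t : R) : t \in `[0, 1] -> is_derive t 1 (fun t => beta i v x (t *: a)) (- w).
  move=> _; have [p [q [dp dq pq]]] := cartan_line (t *: a) a v dx.
  have p0 : p = 0.
    case: dp => _ <-; under eq_fun do rewrite hc.
    exact: derive_cst.
  have <- : q = - w by rewrite /w -pq p0 sub0r opprK.
  apply: is_derive_eq_line dq => h /=.
  by rewrite addr0 !scaler1 scalerDl addrC.
have [t t01] := MVT_derive ler01 dB.
have -> : beta i v x (1 *: a) = beta i v x (0 *: a).
  rewrite scale1r scale0r ak -[period k]add0r /beta flow_period.
  by rewrite {1}/flow_mx torus_exp_period.
rewrite subrr subr0 mulr1 => /eqP.
by rewrite eq_sym oppr_eq0 => /eqP.
Qed.

End cartan.

(** * Loop integrals *)

Section C1_pairing.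
Context {R : realType}.

Lemma continuous_sum_ord (T : topologicalType) n (f : 'I_n -> T -> R) (z : T) :
  (forall k, {for z, continuous (f k)}) -> {for z, continuous (fun x => \sum_k f k x)}.
Proof.
move=> cf; have -> : (fun x => \sum_k f k x) = \sum_k f k.
  by apply/funext => x; rewrite fct_sumE.
apply: (big_ind (fun g : T -> R => {for z, continuous g})) => [|g h cg ch|k _] //.
  exact: cst_continuous.
exact: continuousD.
Qed.

Lemma continuous_row_col (T : topologicalType) m (g : T -> 'rV[R]_m)
    (h : T -> 'cV[R]_m) (z : T) :
  {for z, continuous g} -> {for z, continuous h} ->
  {for z, continuous (fun y => (g y *m h y) 0 0)}.
Proof.
move=> cg ch.
have -> : (fun y => (g y *m h y) 0 0) = (fun y => \sum_k (g y 0 k * h y k 0)).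
  by apply/funext => y; rewrite mxE.
apply: continuous_sum_ord => k.
apply: (@continuousM _ _ (fun y => g y 0 k) (fun y => h y k 0)).
  apply: (@continuous_comp _ _ _ g (fun N : 'rV[R]_m => N 0 k)) => //.
  exact: coord_continuous.
apply: (@continuous_comp _ _ _ h (fun N : 'cV[R]_m => N k 0)) => //.
exact: coord_continuous.
Qed.

Lemma differentiable_row_col (V : normedModType R) m (g : V -> 'rV[R]_m)
    (h : V -> 'cV[R]_m) (z : V) :
  differentiable g z -> differentiable h z ->
  differentiable (fun y => (g y *m h y) 0 0 : R) z.
Proof.
move=> dg dh.
have -> : (fun y => (g y *m h y) 0 0 : R) = \sum_k (fun y => g y 0 k * h y k 0 : R).
  by apply/funext => y; rewrite mxE fct_sumE.
apply: differentiable_sum => k.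
apply: (@differentiableM _ _ (fun y => g y 0 k) (fun y => h y k 0)).
  apply: (@differentiable_comp _ _ _ _ g (fun N : 'rV[R]_m => N 0 k)) => //.
  exact: differentiable_coord.
apply: (@differentiable_comp _ _ _ _ h (fun N : 'cV[R]_m => N k 0)) => //.
exact: differentiable_coord.
Qed.

Lemma C1_pairing (V : normedModType R) m (g G : V -> 'rV[R]_m)
    (al : 'rV[R]_m -> 'cV[R]_m) (U : set V) (U' : set 'rV[R]_m) :
  open U -> (forall z, U z -> U' (G z)) -> Ck_on 1 U g -> Ck_on 1 U G -> Ck_on 1 U' al ->
  Ck_on 1 U (fun z => (g z *m al (G z)) 0 0 : R).
Proof.
move=> oU UU' [dg cg] [dG cG] [dal cal].
have dalG z : U z -> differentiable (al \o G) z.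
  by move=> Uz; apply: differentiable_comp; [exact: dG|exact/dal/UU'].
split=> [z Uz|u z Uz].
  by apply: (@differentiable_row_col _ _ g (al \o G)); [exact: dg|exact: dalG].
(* [Ck_on] gives continuity of derivatives in fixed directions only, whereas the direction
   ['D_u G y] moves with [y]; hence the expansion along the basis vectors. *)
pose dalu (y : V) : 'cV[R]_m :=
  \col_k \sum_l 'D_u G y 0 l * 'D_(delta_mx 0 l) al (G y) k 0.
pose D (y : V) : R := ('D_u g y *m al (G y)) 0 0 + (g y *m dalu y) 0 0.
have eD y : U y -> D y = 'D_u (fun z => (g z *m al (G z)) 0 0 : R) y.
  move=> Uy.
  have h1 : is_derive y u g ('D_u g y) by apply/derivableP/diff_derivable/dg.
  have h2 : is_derive y u (al \o G) (dalu y).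
    have -> : dalu y = 'D_('D_u G y) al (G y).
      apply/colP => k; rewrite mxE derive_rV ?summxE; last exact/dal/UU'.
      by apply: eq_bigr => l _; rewrite mxE.
    by apply: is_derive_comp_diff; [exact/dal/UU'|exact: dG].
  have [_ ->] := is_derive_row_col h1 h2.
  by rewrite /D [RHS]mxE.
have nU : \near z, U z by exact: open_nbhs_nbhs.
have cGz : {for z, continuous G} by apply: differentiable_continuous; exact: dG.
have cD : {for z, continuous D}.
  have c1 : {for z, continuous (fun y => ('D_u g y *m al (G y)) 0 0)}.
    apply: (@continuous_row_col _ _ ('D_u g) (al \o G)); first exact: cg.
    by apply: differentiable_continuous; exact: dalG.
  have c2 : {for z, continuous (fun y => (g y *m dalu y) 0 0)}.
    have -> : (fun y => (g y *m dalu y) 0 0) =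
       (fun y => \sum_k \sum_l g y 0 k * ('D_u G y 0 l * 'D_(delta_mx 0 l) al (G y) k 0)).
      by apply/funext => y; rewrite mxE; apply: eq_bigr => k _; rewrite mxE mulr_sumr.
    apply: continuous_sum_ord => k; apply: continuous_sum_ord => l.
    apply: (@continuousM _ _ (fun y => g y 0 k)
       (fun y => 'D_u G y 0 l * 'D_(delta_mx 0 l) al (G y) k 0)).
      apply: (@continuous_comp _ _ _ g (fun N : 'rV[R]_m => N 0 k)).
        by apply: differentiable_continuous; exact: dg.
      exact: coord_continuous.
    apply: (@continuousM _ _ (fun y => 'D_u G y 0 l) (fun y => 'D_(delta_mx 0 l) al (G y) k 0)).
      apply: (@continuous_comp _ _ _ ('D_u G) (fun N : 'rV[R]_m => N 0 l)).
        exact: cG.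
      exact: coord_continuous.
    apply: (@continuous_comp _ _ _ G (fun y => 'D_(delta_mx 0 l) al y k 0)) => //.
    apply: (@continuous_comp _ _ _ ('D_(delta_mx 0 l) al) (fun N : 'cV[R]_m => N k 0)).
      exact/cal/UU'.
    exact: coord_continuous.
  exact: (@continuousD _ _ _ (fun y => ('D_u g y *m al (G y)) 0 0)
    (fun y => (g y *m dalu y) 0 0) z c1 c2).
have nD : {near z, D =1 'D_u (fun z => (g z *m al (G z)) 0 0 : R)}.
  by apply: filterS nU => y; exact: eD.
rewrite /prop_for /continuous_at -(eD z Uz).
by apply: cvg_trans cD; apply: near_eq_cvg.
Qed.

End C1_pairing.

(** * Integration over the unit interval by primitives *)

Section primitives.
Context {R : realType}.

Lemma primitive_exists (g : R -> R) (a b : R) : continuous g -> 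
  exists P : R -> R, forall t : R, t \in `[a, b] -> is_derive t 1 P (g t).
Proof.
move=> cg; pose mu := @lebesgue_measure R.
(* The interval is enlarged by 1 on both sides so that [a] and [b] become interior points and the
   derivatives there are two-sided. *)
pose P x := (\int[mu]_(t in [set` `[a - 1, x]]) (g t))%R.
exists P => t; rewrite in_itv /= => /andP[at_ tb].
have int : mu.-integrable `[a - 1, b + 1] (EFin \o g).
  apply: continuous_compact_integrable; first exact: segment_compact.
  exact: continuous_subspaceT.
have tb1 : t < b + 1 by lra.
have at1 : a - 1 < t by lra.
have [dP eP] := continuous_FTC1_closed tb1 int at1 (cg t).
by split; [exact: dP|rewrite -derive1E; exact: eP].
Qed.

Lemma primitive_unique (g P Q : R -> R) (a b : R) : a <= b ->
  (forall t : R, t \in `[a, b] -> is_derive t 1 P (g t)) ->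
  (forall t : R, t \in `[a, b] -> is_derive t 1 Q (g t)) ->
  P b - P a = Q b - Q a.
Proof.
move=> ab dP dQ.
have : (P - Q) a = (P - Q) b.
  apply: derive0_cst ab _ => t tab; rewrite -(subrr (g t)).
  by apply: is_deriveB; [exact: dP|exact: dQ].
rewrite -![(_ - _ : _ -> _) _]/(_ - _) => h; lra.
Qed.

(* The integral of [g] over [0, 1]: [get] picks the common increment of its
   primitives. *)
Definition increment (g : R -> R) : R :=
  get [set d | forall P : R -> R, (forall t : R, t \in `[0, 1] -> is_derive t 1 P (g t)) -> d = P 1 - P 0].

Lemma incrementE (g P : R -> R) : continuous g ->
  (forall t : R, t \in `[0, 1] -> is_derive t 1 P (g t)) -> increment g = P 1 - P 0.
Proof.
move=> cg dP.
have h : [set d | forall P : R -> R, (forall t : R, t \in `[0, 1] -> is_derive t 1 P (g t)) ->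
    d = P 1 - P 0] (P 1 - P 0).
  by move=> Q dQ; exact: (primitive_unique ler01 dP dQ).
by have := getPex (ex_intro _ (P 1 - P 0) h); apply; exact: dP.
Qed.

Lemma increment_dist (g h : R -> R) (e : R) : continuous g -> continuous h ->
  (forall t : R, t \in `[0, 1] -> `|g t - h t| <= e) -> `|increment g - increment h| <= e.
Proof.
move=> cg ch le.
have [P dP] := primitive_exists 0 1 cg; have [Q dQ] := primitive_exists 0 1 ch.
rewrite (incrementE cg dP) (incrementE ch dQ).
have := @dist_le_derive R (fun t => P t - Q t) (fun t => g t - h t) 0 1 e ler01.
rewrite subr0 mulr1 => hh.
have -> : P 1 - P 0 - (Q 1 - Q 0) = P 1 - Q 1 - (P 0 - Q 0) by ring.
apply: hh; last exact: le.
by move=> t t01; apply: is_deriveB; [exact: dP|exact: dQ].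
Qed.

Lemma expand_is_derive (V : normedModType R) (c : R -> V) (t : R) (v : V) :
  (forall e, 0 < e -> \forall h \near 0, `|c (t + h) - c t - h *: v| <= e * `|h|) ->
  is_derive t 1 c v.
Proof.
move=> hc.
have cv : (fun h : R => h^-1 *: ((c \o shift t) (h *: 1) - c t)) @ 0^' --> v.
  apply/cvgrPdist_le => e e0; near=> h.
  have h0 : h != 0 by near: h; exact: nbhs_dnbhs_neq.
  have -> : v - h^-1 *: ((c \o shift t) (h *: 1) - c t) =
      - (h^-1 *: (c (t + h) - c t - h *: v)).
    by rewrite /= [h%:A]mulr1 [h + t]addrC [in RHS]scalerBr scalerA mulVf // scale1r opprB.
  rewrite normrN normrZ normfV mulrC ler_pdivrMr ?normr_gt0 //.
  by near: h; apply: nbhs_dnbhs; exact: hc.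
by split; [apply/cvg_ex; exists v|exact: cvg_lim cv].
Unshelve. all: by end_near. Qed.

(* The derivative of the integrand is [w] up to the derivative of [B], which
   integrates to 0. *)
Lemma increment_derive (f : R -> R -> R) (f' B : R -> R) (w : R) :
  (forall s, continuous (f s)) ->
  (forall e, 0 < e -> \forall s \near (0 : R), forall t : R, t \in `[0, 1] ->
     `|f s t - f 0 t - s * f' t| <= e * `|s|) ->
  (forall t : R, t \in `[0, 1] -> is_derive t 1 B (f' t - w)) -> B 1 = B 0 ->
  is_derive (0 : R) 1 (fun s => increment (f s)) w.
Proof.
move=> cf hf dB B10; apply: expand_is_derive => e e0.
have := hf e e0; apply: filterS => s hs; rewrite add0r.
have [P dP] := primitive_exists 0 1 (cf s).
have [Q dQ] := primitive_exists 0 1 (cf 0).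
rewrite (incrementE (cf s) dP) (incrementE (cf 0) dQ).
have := @dist_le_derive R (fun t => P t - Q t - s *: (B t + w *: t))
  (fun t => f s t - f 0 t - s *: (f' t - w + w *: 1)) 0 1 (e * `|s|) ler01.
rewrite subr0 mulr1 B10 /GRing.scale /= => hh.
have -> : P 1 - P 0 - (Q 1 - Q 0) - s * w =
  P 1 - Q 1 - s * (B 0 + w * 1) - (P 0 - Q 0 - s * (B 0 + w * 0)) by ring.
apply: hh => t t01; last first.
  by rewrite mulr1 subrK; exact: hs.
have d1 := is_deriveB (dP t t01) (dQ t t01).
have d2 := is_deriveD (dB t t01) (is_deriveZ w (is_derive_id t 1)).
exact: is_deriveB d1 (is_deriveZ s d2).
Qed.

End primitives.

Section periodic.
Context {R : realType}.

Lemma is_derive_translate (V : normedModType R) (P : R -> V) (r t : R) (p : V) :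
  is_derive (t + r) 1 P p -> is_derive t 1 (fun t => P (t + r)) p.
Proof. by apply: is_derive_eq_line => h; rewrite addrA. Qed.

Lemma derive0_cst_all (f : R -> R) (r : R) :
  (forall x : R, is_derive x 1 f 0) -> f r = f 0.
Proof.
move=> h; have [r0|r0] := leP 0 r.
  by symmetry; apply: (derive0_cst r0) => x _; exact: h.
by apply: (derive0_cst (ltW r0)) => x _; exact: h.
Qed.

Lemma increment_periodic (g : R -> R) (r : R) : continuous g ->
  (forall t, g (t + 1) = g t) -> increment (fun t => g (t + r)) = increment g.
Proof.
move=> cg per.
(* This interval contains [0, 1], [r, r + 1], and [u] and [u + 1] for all [u] between 0 and [r]. On
   these [u] the difference [P (u + 1) - P u] has derivative 0 by periodicity, hence equal values at
   [r] and 0. *)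
have [P dP] := primitive_exists (- `|r|) (`|r| + 1) cg.
have r1 := ler_norm r; have r2 := ler_normr r (- r).
have r3 : - r <= `|r| by rewrite -normrN ler_norm.
have cgr : continuous (fun t => g (t + r)).
  move=> t; apply: (@continuous_comp _ _ _ (fun t => t + r) g); last exact: cg.
  by apply: cvgD; [exact: cvg_id|exact: cvg_cst].
have dPr (t : R) : t \in `[0, 1] -> is_derive t 1 (fun t => P (t + r)) (g (t + r)).
  rewrite in_itv /= => /andP[t0 t1]; apply: is_derive_translate; apply: dP.
  by rewrite in_itv /=; apply/andP; split; lra.
have dP0 (t : R) : t \in `[0, 1] -> is_derive t 1 P (g t).
  rewrite in_itv /= => /andP[t0 t1]; apply: dP.
  by rewrite in_itv /=; apply/andP; split; lra.
rewrite (incrementE cgr dPr) (incrementE cg dP0) add0r.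
have dK (u : R) : - `|r| <= u -> u <= `|r| -> is_derive u 1 (fun u => P (u + 1) - P u) 0.
  move=> u1 u2; rewrite -(subrr (g u)).
  have h1 : is_derive u 1 (fun u => P (u + 1)) (g u).
    rewrite -(per u); apply: is_derive_translate; apply: dP.
    by rewrite in_itv /=; apply/andP; split; lra.
  apply: is_deriveB; apply: dP.
  by rewrite in_itv /=; apply/andP; split; lra.
pose K u := P (u + 1) - P u.
have e : K r = K 0.
  have [r0|r0] := leP 0 r.
    have h (u : R) : u \in `[0, r] -> is_derive u 1 K 0.
      by rewrite in_itv /= => /andP[u1 u2]; apply: dK; lra.
    by rewrite (derive0_cst r0 h).
  have h (u : R) : u \in `[r, 0] -> is_derive u 1 K 0.
    by rewrite in_itv /= => /andP[u1 u2]; apply: dK; lra.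
  by rewrite (derive0_cst (ltW r0) h).
by move: e; rewrite /K add0r [1 + r]addrC.
Qed.

Lemma derive_at_max (f : R -> R) (w : R) : is_derive (0 : R) 1 f w ->
  (forall h, f h <= f 0) -> w = 0.
Proof.
move=> df fmax; apply/eqP; rewrite -normr_eq0; apply/eqP/le_anti; rewrite normr_ge0 andbT.
apply/ler_addgt0Pr => e e0; rewrite add0r.
have [d /= d0 hd] := (@nbhs_ballP _ _ _ _).1 (is_derive_expand df e0).
have bd h : `|h| < d -> h * w <= e * `|h|.
  move=> hh; have := hd h; rewrite /ball /= sub0r normrN => /(_ hh).
  rewrite add0r ler_norml => /andP[h1 _].
  have := fmax h; move: h1; rewrite /GRing.scale /=; lra.
have d2 : `|d / 2| = d / 2 by rewrite ger0_norm // divr_ge0 // ltW.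
have h1 := bd (d / 2); have h2 := bd (- (d / 2)).
rewrite normrN d2 in h1 h2.
have dd : d / 2 < d by lra.
have {}h1 := h1 dd; have {}h2 := h2 dd.
have d20 : 0 < d / 2 by lra.
rewrite ler_norml; apply/andP; split.
  by rewrite -(ler_pM2l d20); move: h2; lra.
by rewrite -(ler_pM2l d20); move: h1; lra.
Qed.

End periodic.

(** * The loop integral: continuity, derivative and invariance *)

Section loop.
Context {R : realType} {m : nat} {M : manifold R m} (rho : torus_action M).
Context (alpha : form1 M).
Implicit Types (x : M) (s a b : 'rV[R]_2).

Local Notation flow := (flow rho).
Local Notation alphaZ := (alphaZ rho alpha).

Definition alphaZ_chart a i (z : 'rV[R]_m * 'rV[R]_2) : R := alphaZ a (flow z.2 (param M i z.1)).

Lemma alphaZ_chart_C1 a i j : Ck_on 1 (flow_dom rho i j) (alphaZ_chart a i).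
Proof.
have oD := @open_flow_dom _ _ _ rho i j.
pose al (y : 'rV[R]_m) := form1_mx alpha j (param M j y).
have [_ c2] := flow_chart_Ck rho 2 i j.
have c1 := c2 (0, a).
have := @C1_pairing R _ _ _ _ al _ (cod j) oD _ c1 (flow_chart_Ck rho 1 i j) (form1_smooth alpha j 1).
have h z : flow_dom rho i j z -> cod j (flow_chart rho i j z).
  by move=> [_ dz]; exact: cod_chart.
move=> /(_ h); apply: Ck_on_eq oD _ => y Dy.
have [cy dy] := Dy; rewrite /alphaZ_chart (alphaZE rho alpha a dy) (gen_flow_chart a Dy).
by rewrite /al /flow_chart chartK.
Qed.

Lemma continuous_alphaZ a : continuous (alphaZ a).
Proof.
move=> x; have dx := dom_chart_at x; set i := chart_at x in dx.
have cA : {for (chart M i x, 0), continuous (alphaZ_chart a i)}.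
  apply: Ck_on_continuous (alphaZ_chart_C1 a i i) _ _; exact: flow_domP0.
have cc : {for x, continuous (fun y : M => (chart M i y, 0 : 'rV[R]_2))}.
  by apply: continuous_pair; [exact: chart_continuous|exact: cst_continuous].
have c2 : {for x, continuous (alphaZ_chart a i \o (fun y : M => (chart M i y, 0 : 'rV[R]_2)))}.
  exact: continuous_comp cc cA.
have e y : dom M i y -> (alphaZ_chart a i \o (fun y : M => (chart M i y, 0 : 'rV[R]_2))) y = alphaZ a y.
  by move=> dy; rewrite /alphaZ_chart /= chartK // flow0.
have nd : \near x, dom M i x by apply: open_nbhs_nbhs; split; [exact: dom_open|].
rewrite /continuous_at -(e x dx); apply: cvg_trans c2.
by apply: near_eq_cvg; apply: filterS nd => y; exact: e.
Qed.

Lemma continuous_alphaZ_flow a : continuous (fun z : M * R => alphaZ a (flow (z.2 *: a) z.1)).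
Proof.
move=> z; apply: (@continuous_comp _ _ _ (fun z : M * R => flow (z.2 *: a) z.1) (alphaZ a)).
  apply: (@continuous_comp _ _ _ (fun z : M * R => (z.1, z.2 *: a)) (fun z : M * 'rV[R]_2 => flow z.2 z.1)).
    apply: continuous_pair; first exact: cvg_fst.
    apply: (@continuous_comp _ _ _ snd (fun t : R => t *: a)); first exact: cvg_snd.
    exact: scalel_continuous.
  exact: continuous_flow.
exact: continuous_alphaZ.
Qed.

Lemma continuous_alphaZ_time a x : continuous (fun t : R => alphaZ a (flow (t *: a) x)).
Proof.
move=> t; apply: (@continuous_comp _ _ _ (fun t : R => (x, t)) (fun z : M * R => alphaZ a (flow (z.2 *: a) z.1))).
  by apply: continuous_pair; [exact: cst_continuous|exact: cvg_id].
exact: continuous_alphaZ_flow.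
Qed.

(* The integral of [alpha] over the loop [t |-> flow (t *: a) x], for a period [a]. *)
Definition loop a x : R := increment (fun t => alphaZ a (flow (t *: a) x)).

(** The integrand is jointly continuous, and compactness of [0, 1] makes its variation with the
    point uniform in time. *)
Lemma continuous_loop a : continuous (loop a).
Proof.
move=> x; apply/cvgrPdist_le => e e0.
have cK : compact `[0 : R, 1] by exact: segment_compact.
have := (compact_near_coveringP _).1 cK M (nbhs x) (fun y t =>
  `|alphaZ a (flow (t *: a) x) - alphaZ a (flow (t *: a) y)| <= e).
move=> /(_ _) H.
have {}H : \forall y \near x, `[0 : R, 1] `<=`
   (fun t => `|alphaZ a (flow (t *: a) x) - alphaZ a (flow (t *: a) y)| <= e).
  apply: H => t _.
  have e2 : 0 < e / 2 by rewrite divr_gt0.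
  have c1 := (cvgrPdist_lt _ _).1 (@continuous_alphaZ_flow a (x, t)) _ e2.
  have c2 : nbhs t [set t' | `|alphaZ a (flow (t *: a) x) - alphaZ a (flow (t' *: a) x)| < e / 2].
    by have /cvgrPdist_lt /(_ _ e2) := @continuous_alphaZ_time a x t.
  have [[A B] /= [nA nB] AB] := c1.
  exists ([set t' | `|alphaZ a (flow (t *: a) x) - alphaZ a (flow (t' *: a) x)| < e / 2] `&` B, A).
    by split; [exact: filterI|exact: nA].
  move=> [t' y] /= [[h1 Bt'] Ay].
  have h2 := AB (y, t') (conj Ay Bt').
  rewrite /= in h2; rewrite -(subrKA (alphaZ a (flow (t *: a) x))).
  rewrite (le_trans (ler_normD _ _)) // distrC; lra.
apply: filterS H => y hy; apply: increment_dist.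
- exact: continuous_alphaZ_time.
- exact: continuous_alphaZ_time.
- by move=> t /hy.
Qed.

End loop.

Section loop_derivative.
Context {R : realType} {m : nat} {M : manifold R m} (rho : torus_action M).
Context (omega : form2 M) (alpha : form1 M).
Context (omega_exact : is_exterior_derivative alpha omega).
Context (rho_preserves_omega : forall g : torus R, preserves_form2 (rho^~ g) omega).
Implicit Types (x : M) (a b : 'rV[R]_2).

Local Notation flow := (flow rho).
Local Notation gen := (gen rho).
Local Notation alphaZ := (alphaZ rho alpha).
Local Notation loop := (loop rho alpha).

(** This permits differentiation under the integral: the first-order remainder in [s] is small
    uniformly in [t]. Compactness of [0, 1] makes the spatial derivative uniformly close to its
    value at [s = 0], and the mean value theorem on the segment from 0 to [s] turns this into a
    bound on the remainder. *)
Lemma alphaZ_uniform a i x v e : dom M i x -> 0 < e ->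
  \forall s \near (0 : R), forall t : R, t \in `[0, 1] ->
    `|alphaZ_chart rho alpha a i (chart M i x + s *: v, t *: a) -
      alphaZ_chart rho alpha a i (chart M i x, t *: a) -
      s * 'D_((v, 0) : 'rV[R]_m * 'rV[R]_2) (alphaZ_chart rho alpha a i) (chart M i x, t *: a)|
      <= e * `|s|.
Proof.
move=> dx e0; set f := alphaZ_chart rho alpha a i.
set u := (v, 0) : 'rV[R]_m * 'rV[R]_2.
pose z (s t : R) : 'rV[R]_m * 'rV[R]_2 := (chart M i x + s *: v, t *: a).
have cz st0 : {for st0, continuous (fun st : R * R => z st.1 st.2)}.
  apply: continuous_pair.
    apply: (@continuous_comp _ _ _ fst (fun s : R => chart M i x + s *: v)).
      exact: cvg_fst.
    apply: differentiable_continuous; apply/derivable1_diffP.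
    by have [] := is_derive_line (chart M i x) v st0.1.
  apply: (@continuous_comp _ _ _ snd (fun t : R => t *: a)); first exact: cvg_snd.
  exact: scalel_continuous.
have cK : compact `[0 : R, 1] by exact: segment_compact.
pose Dom st := exists j, flow_dom rho i j (z st.1 st.2).
have H : \forall d \near (0 : R)^'+, `[0 : R, 1] `<=` (fun t => forall s, `|s| < d ->
    Dom (s, t) /\ `|'D_u f (z s t) - 'D_u f (z 0 t)| <= e).
  apply: ((compact_near_coveringP _).1 cK _ (0 : R)^'+ (fun d t => forall s, `|s| < d ->
    Dom (s, t) /\ `|'D_u f (z s t) - 'D_u f (z 0 t)| <= e)) => t0 _.
  have z00 : z 0 t0 = (chart M i x, t0 *: a) by rewrite /z scale0r addr0.
  pose j := chart_at (flow (t0 *: a) x).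
  have D0 : flow_dom rho i j (z 0 t0).
    by rewrite z00; apply: flow_domP => //; exact: dom_chart_at.
  have [_ cD] := alphaZ_chart_C1 rho alpha a i j.
  have e2 : 0 < e / 2 by rewrite divr_gt0.
  have n1 : nbhs (z 0 t0) [set y | `|'D_u f (z 0 t0) - 'D_u f y| < e / 2].
    by have /cvgrPdist_lt /(_ _ e2) := cD u (z 0 t0) D0.
  have n2 : nbhs (z 0 t0) (flow_dom rho i j).
    by apply: open_nbhs_nbhs; split => //; exact: open_flow_dom.
  have n12 : nbhs (z 0 t0) ([set y | `|'D_u f (z 0 t0) - 'D_u f y| < e / 2] `&` flow_dom rho i j).
    exact: filterI.
  have n3 := cz (0, t0) _ n12.
  have [d /= d0 hd] := (@nbhs_ballP _ _ _ _).1 n3.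
  have bd s t : `|s| < d -> `|t0 - t| < d -> flow_dom rho i j (z s t) /\
      `|'D_u f (z 0 t0) - 'D_u f (z s t)| < e / 2.
    move=> hs ht; suff: ball ((0, t0) : R * R) d (s, t) by move=> /hd [].
    by split; rewrite /ball /= ?sub0r ?normrN.
  exists ([set t | `|t0 - t| < d], [set d' | d' <= d]).
    split; last exact: nbhs_right_le.
    by apply/nbhs_ballP; exists d.
  move=> [t d'] /= [ht hd'] s hs.
  have [D1 h1] := bd s t (lt_le_trans hs hd') ht.
  have d0' : `|0 : R| < d by rewrite normr0.
  have [D2 h2] := bd 0 t d0' ht.
  split; first by exists j.
  move: ('D_u f (z 0 t0)) ('D_u f (z s t)) ('D_u f (z 0 t)) h1 h2 => A B C h1 h2.
  by have := ler_distD A B C; rewrite (distrC B A); lra.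
have [d d0 hd] : exists2 d : R, 0 < d & `[0 : R, 1] `<=` (fun t => forall s, `|s| < d ->
    Dom (s, t) /\ `|'D_u f (z s t) - 'D_u f (z 0 t)| <= e).
  have [d /= d0 hd] := H; exists (d / 2); first by rewrite divr_gt0.
  apply: hd; last by rewrite divr_gt0.
  by rewrite /= sub0r normrN ger0_norm ?divr_ge0 ?(ltW d0) //; lra.
apply/nbhs_ballP; exists d => // s; rewrite /ball /= sub0r normrN => sd t t01.
have zu r : z (r * s) t = z 0 t + r *: (s *: u).
  by rewrite /z /u; congr pair; rewrite /= ?scaler0 ?addr0 // scale0r addr0 scalerA.
have hr (r : R) : r \in `[0, 1] -> Dom (r * s, t) /\ `|'D_u f (z (r * s) t) - 'D_u f (z 0 t)| <= e.
  rewrite in_itv /= => /andP[r0 r1]; apply: hd => //.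
  by rewrite normrM (ger0_norm r0) (le_lt_trans _ sd) // ler_piMl.
have := @dist_le_derive R (fun r => f (z 0 t + r *: (s *: u)) - r *: (s * 'D_u f (z 0 t)))
  (fun r => 'D_(s *: u) f (z 0 t + r *: (s *: u)) - (s * 'D_u f (z 0 t))) 0 1 (e * `|s|) ler01.
rewrite subr0 mulr1 !scale1r !scale0r addr0 subr0.
have -> : z 0 t = (chart M i x, t *: a) by rewrite /z scale0r addr0.
have -> : (chart M i x, t *: a) + s *: u = (chart M i x + s *: v, t *: a).
  by rewrite /u; congr pair; rewrite /= scaler0 addr0.
have -> : forall p q r : R, p - q - r = p - r - q by move=> p q r; ring.
apply.
  move=> r r01; have [[j Dj] _] := hr r r01.
  have df : differentiable f (z (r * s) t).
    by have [d1 _] := alphaZ_chart_C1 rho alpha a i j; exact: d1.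
  rewrite zu /z scale0r addr0 in df.
  apply: is_deriveB; first exact: is_derive_along_line.
  have := is_derive_line 0 (s * 'D_u f (chart M i x, t *: a)) r.
  by under eq_fun do rewrite add0r.
move=> r r01; have [[j Dj] h] := hr r r01.
have df : differentiable f (z (r * s) t).
  by have [d1 _] := alphaZ_chart_C1 rho alpha a i j; exact: d1.
rewrite zu /z scale0r addr0 in df h.
have -> : 'D_(s *: u) f ((chart M i x, t *: a) + r *: (s *: u)) =
    s * 'D_u f ((chart M i x, t *: a) + r *: (s *: u)).
  by rewrite !deriveE // linearZ.
by rewrite -mulrBr normrM mulrC ler_wpM2r.
Qed.

Lemma loop_derive (k : 'rV[int]_2) a i x v : a = period k -> dom M i x ->
  is_derive (0 : R) 1 (fun s => loop a (param M i (chart M i x + s *: v)))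
    (omegaE omega i v (gen a i x) x).
Proof.
move=> ak dx; pose w := omegaE omega i v (gen a i x) x.
pose f (s t : R) := alphaZ a (flow (t *: a) (param M i (chart M i x + s *: v))).
pose u := (v, 0) : 'rV[R]_m * 'rV[R]_2.
pose f' (t : R) := 'D_u (alphaZ_chart rho alpha a i) (chart M i x, t *: a).
apply: (@increment_derive R f f' (fun t => beta rho alpha i v x (t *: a)) w).
- by move=> s; exact: continuous_alphaZ_time.
- move=> e e0; have := alphaZ_uniform a v dx e0; apply: filterS => s hs t t01.
  by have := hs t t01; rewrite /f /alphaZ_chart /= scale0r addr0.
- move=> t _; have [p [q [dp dq pq]]] := cartan_line omega_exact rho_preserves_omega (t *: a) a v dx.
  have ep : f' t = p.
    case: dp => _ <-; rewrite /f' /u; apply: derive_eq_line => h.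
    by rewrite /alphaZ_chart /= scaler0 add0r addr0 [h%:A]mulr1 [h *: v + _]addrC.
  have -> : f' t - w = q by rewrite ep /w -pq; ring.
  apply: is_derive_eq_line dq => h /=.
  by rewrite addr0 !scaler1 scalerDl addrC.
- rewrite scale1r scale0r ak -[period k]add0r /beta flow_period.
  by rewrite {1}/flow_mx torus_exp_period.
Qed.

Lemma loop_flow (k : 'rV[int]_2) a x (r : R) : a = period k ->
  loop a (flow (r *: a) x) = loop a x.
Proof.
move=> ak; rewrite /loop -(@increment_periodic _ (fun t => alphaZ a (flow (t *: a) x)) r).
- by congr increment; apply/funext => t; rewrite -flowD -scalerDl addrC.
- exact: continuous_alphaZ_time.
- move=> t; congr (alphaZ a _).
  by rewrite scalerDl scale1r [X in flow (_ + X)]ak flow_period.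
Qed.

(** In [cartan_time] the derivative of alpha(Z_b) vanishes by constancy and the right-hand side
    because Z_b lies in the kernel; so alpha(Z_a) is constant along Z_b. *)
Lemma alphaZ_flow_kernel a b x (r : R) :
  (exists c, forall x, alphaZ b x = c) ->
  (forall i x, dom M i x -> gen b i x *m form2_mx omega i x = 0) ->
  alphaZ a (flow (r *: b) x) = alphaZ a x.
Proof.
move=> [c hc] kb.
have d0 (t : R) : is_derive t 1 (fun t => alphaZ a (flow (t *: b) x)) 0.
  have dx := dom_chart_at (flow (t *: b) x).
  have [p [q [dp dq pq]]] := cartan_time rho omega_exact a b dx.
  have q0 : q = 0.
    case: dq => _ <-; under eq_fun do rewrite hc.
    exact: derive_cst.
  have p0 : p = 0.
    by rewrite -[p]subr0 -q0 pq /omegaE kb // mul0mx mxE.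
  rewrite -p0; apply: is_derive_eq_line dp => h /=.
  by rewrite addr0 [h%:A]mulr1 -flowD -scalerDl addrC.
by have := derive0_cst_all r d0; rewrite scale0r flow0.
Qed.

Lemma loop_flow_kernel a b x (r : R) :
  (exists c, forall x, alphaZ b x = c) ->
  (forall i x, dom M i x -> gen b i x *m form2_mx omega i x = 0) ->
  loop a (flow (r *: b) x) = loop a x.
Proof.
move=> cb kb; rewrite /loop; congr (increment _); apply/funext => t.
by rewrite flowC (alphaZ_flow_kernel a _ r cb kb).
Qed.

End loop_derivative.

(** * Orbits and critical points of the loop integral *)

Lemma diff_expand {R : realType} (V W : normedModType R) (f : V -> W) (x : V) (e : R) :
  differentiable f x -> 0 < e ->
  \forall h \near 0, `|f (x + h) - f x - 'd f x h| <= e * `|h|.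
Proof.
move=> df e0; have /diff_locally := df.
move/eqaddoP => /(_ e e0); apply: filterS => h.
rewrite -![(_ + _ : _ -> _) _]/(_ + _) -![(- _ : _ -> _) _]/(- _) /=.
by rewrite /cst opprD addrA [h + x]addrC.
Qed.

Section orbits.
Context {R : realType} {m : nat} {M : manifold R m} (rho : torus_action M).
Context (rho_free : locally_free rho).
Implicit Types (x : M) (a b s : 'rV[R]_2).

Local Notation flow := (flow rho).
Local Notation gen := (gen rho).

Lemma period_small (k : 'rV[int]_2) : `|period k : 'rV[R]_2| < 1 -> k = 0.
Proof.
move=> h; apply/rowP => i; rewrite mxE.
have : `|(period k : 'rV[R]_2) 0 i| < 1 by exact: le_lt_trans (le_mx_norm _ _ _) h.
have pi1 : 1 <= pi *+ 2 :> R by have := @pi_ge2 R; rewrite mulr2n; lra.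
have pi0 : 0 <= pi *+ 2 :> R by lra.
rewrite mxE normrM (ger0_norm pi0).
move=> h2; have : `|(k 0 i)%:~R : R| < 1.
  by rewrite (le_lt_trans _ h2) // ler_peMr.
rewrite -intr_norm ltrz1; case: (k 0 i) => [[|n]|n] //=.
Qed.

Lemma gen0 i x : dom M i x -> gen 0 i x = 0.
Proof. by move=> dx; have := genZ rho 0 0 dx; rewrite !scale0r. Qed.

Lemma flow_stabilizer_isolated x : exists2 d : R, 0 < d &
  forall s, `|s| < d -> flow s x = x -> s = 0.
Proof.
have st1 : stabilizer rho x (torus_one R) by exact: act_one.
have [_ [V nV VS]] := rho_free st1.
have nV0 : nbhs (0 : 'rV[R]_2) ((@torus_exp R) @^-1` V).
  by apply: continuous_torus_exp; rewrite torus_exp0.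
have [d /= d0 hd] := (@nbhs_ballP _ _ _ _).1 nV0.
(* Isolation in the torus only makes [s] a period. The bound 1, smaller than 2 pi, forces that
   period to be 0. *)
exists (Num.min d 1) => [|s]; first by rewrite lt_min d0 ltr01.
rewrite lt_min => /andP[sd s1] fs.
have Vs : V (torus_exp s) by apply: hd; rewrite -ball_normE /= sub0r normrN.
have : (V `&` stabilizer rho x) (torus_exp s) by split.
rewrite VS /= -torus_exp0 => /torus_exp_eq [k]; rewrite add0r => sk.
by rewrite sk (@period_small k) -?sk //; apply/rowP => i; rewrite !mxE mul0r.
Qed.

(** A generator that vanishes at [x] vanishes along the orbit by [gen_push], so [x] is fixed by
    [t *: a] for small [t]. Taking [t] small enough to stay in the chart and below the isolation
    radius of the stabilizer forces [a = 0]. *)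
Lemma gen_inj i x a : dom M i x -> gen a i x = 0 -> a = 0.
Proof.
move=> dx g0; have [d d0 hd] := flow_stabilizer_isolated x.
have nd : \forall t \near (0 : R), dom M i (flow (0 + t *: a) x).
  have : nbhs (0 : 'rV[R]_2) ((fun s => flow s x) @^-1` dom M i).
    apply: (@continuous_flowl _ _ _ rho x); rewrite flow0.
    by apply: open_nbhs_nbhs; split; first exact: dom_open.
  exact: nbhs_line.
have [e /= e0 he] := (@nbhs_ballP _ _ _ _).1 nd.
have gz s j : dom M j (flow s x) -> gen a j (flow s x) = 0.
  by move=> dj; rewrite (gen_push a dx dj) g0 mul0mx.
have cst_flow t : 0 <= t -> t < e -> flow (t *: a) x = x.
  move=> t0 te.
  have dt u : u \in `[0, t] -> dom M i (flow (u *: a) x).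
    rewrite in_itv /= => /andP[u0 ut]; rewrite -[u *: a]add0r; apply: he.
    by rewrite /ball /= sub0r normrN ger0_norm // (le_lt_trans ut).
  have h : chart M i (flow (0 *: a) x) = chart M i (flow (t *: a) x).
    apply: (@derive0_cst_mx _ _ _ (fun t => chart M i (flow (t *: a) x)) _ _ t0) => u ut.
    have du := dt u ut.
    have := @is_derive_flow _ _ _ rho i x 0 a u.
    rewrite add0r gz // => /(_ du); under eq_fun do rewrite add0r.
    exact.
  rewrite scale0r flow0 in h.
  have dti : dom M i (flow (t *: a) x) by apply: dt; rewrite in_itv /= t0 lexx.
  by rewrite -[LHS](chartK dti) -h chartK.
pose t := Num.min (e / 2) (d / (2 * (`|a| + 1))).
have a1 : 0 < `|a| + 1 by rewrite ltr_wpDl.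
have t0 : 0 < t by rewrite lt_min !divr_gt0 // mulr_gt0.
have te : t < e.
  by rewrite /t gt_min; apply/orP; left; lra.
have td : `|t *: a| < d.
  rewrite normrZ ger0_norm ?(ltW t0) //.
  have : t * (`|a| + 1) <= d / 2.
    rewrite (le_trans (y := d / (2 * (`|a| + 1)) * (`|a| + 1))) //.
      by rewrite ler_wpM2r ?(ltW a1) // /t ge_min lexx orbT.
    by rewrite (_ : _ * _ = d / 2) //; field; rewrite gt_eqF.
  by rewrite mulrDr mulr1; lra.
have /eqP := hd _ td (cst_flow t (ltW t0) te).
by rewrite scaler_eq0 gt_eqF //= => /eqP.
Qed.

Definition gen_mx i x : 'M[R]_(2, m) := \matrix_r gen (delta_mx 0 r) i x.

Lemma genE a i x : dom M i x -> gen a i x = a *m gen_mx i x.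
Proof.
move=> dx.
have sumg (I : Type) (r : seq I) (F : I -> 'rV[R]_2) :
    gen (\sum_(j <- r) F j) i x = \sum_(j <- r) gen (F j) i x.
  elim: r => [|j r IH]; first by rewrite !big_nil gen0.
  by rewrite !big_cons genD // IH.
rewrite {1}(row_sum_delta a) sumg mulmx_sum_row; apply: eq_bigr => j _.
by rewrite genZ // rowK.
Qed.

Lemma gen_mx_free i x : dom M i x -> row_free (gen_mx i x).
Proof.
move=> dx; rewrite -kermx_eq0; apply/eqP/row_matrixP => r; rewrite row0.
by apply: (gen_inj dx); rewrite genE // -row_mul mulmx_ker row0.
Qed.

(** If a single orbit filled M, each point near [x] would be reached by a small time [a], with
    displacement [a *m Z] up to [o(a)]. Points on the line through [x] along a vector [v] transverse
    to the two rows of [Z] contradict this; such a [v] exists because [m > 2]. *)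
Lemma exists_other_orbit (hm : (2 < m)%N) x : exists y, forall s, flow s x <> y.
Proof.
apply: contrapT => none.
have all_orbit y : exists s, `|s| <= pi /\ flow s x = y.
  apply: contrapT => h; apply: none; exists y => s fs; apply: h.
  have [s' s1 e] := torus_exp_surj (torus_exp s).
  by exists s'; split => //; rewrite /flow e.
have dx := dom_chart_at x; set i := chart_at x in dx.
set Z := gen_mx i x; have fZ : row_free Z by exact: gen_mx_free.
have /row_freeP [Y ZY] := fZ.
have [l l0 Zl] : exists2 l : 'cV[R]_m, l != 0 & Z *m l = 0.
  have : cokermx Z != 0.
    rewrite -mxrank_eq0 mxrank_coker -lt0n subn_gt0.
    by move: fZ; rewrite /row_free => /eqP ->.
  move=> ck; have [j cj] : exists j, col j (cokermx Z) != 0.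
    apply: contrapT => h; move/negP: ck; apply; apply/eqP/matrixP => r j.
    have : col j (cokermx Z) = 0 by apply/eqP; apply: contrapT => /negP cj; apply: h; exists j.
    by move/colP => /(_ r); rewrite !mxE.
  by exists (col j (cokermx Z)) => //; rewrite colE mulmxA mulmx_coker mul0mx.
pose v := l^T.
have vl : 0 < (v *m l) 0 0.
  rewrite mxE; have sq k : 0 <= v 0 k * l k 0 by rewrite mxE -expr2 sqr_ge0.
  rewrite lt_neqAle sumr_ge0 // andbT eq_sym; apply/negP => /eqP s0.
  move/negP: l0; apply; apply/eqP/colP => k; rewrite mxE.
  have /psumr_eq0P := s0 => /(_ (fun k _ => sq k)) /(_ k isT).
  by rewrite mxE -expr2 => /eqP; rewrite sqrf_eq0 => /eqP.
(* The times are chosen point by point, without continuity, but in a compact ball. A cluster point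
   [s0] of the times of [c t] as [t] tends to 0 fixes [x], so [s_ (c t) - s0] also leads from [x] to
   [c t] and becomes arbitrarily small. *)
pose s_ y := sval (cid (all_orbit y)).
have sp y : `|s_ y| <= pi by have [] := svalP (cid (all_orbit y)).
have fs y : flow (s_ y) x = y by have [] := svalP (cid (all_orbit y)).
pose c (t : R) := param M i (chart M i x + t *: v).
pose K := [set s : 'rV[R]_2 | `|s| <= pi].
have cK : compact K.
  apply: bounded_closed_compact.
    by exists pi; split; [exact: num_real|move=> y py s /= Ks; exact: le_trans Ks (ltW py)].
  have -> : K = (Num.norm : 'rV[R]_2 -> R) @^-1` [set r | r <= pi] by [].
  apply: closed_comp; last exact: closed_le.
  by move=> s _; exact: norm_continuous.
pose F := (s_ \o c) @ (0 : R)^'+.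
have FF : ProperFilter F by exact: fmap_proper_filter.
have FK : F K.
  have : \forall t \near (0 : R)^'+, K (s_ (c t)) by near=> t; exact: sp.
  exact.
have [s0 [Ks0 cl]] := cK F FF FK.
have cont_c : c @ (0 : R) --> x.
  have cl0 : {for (0 : R), continuous (fun t : R => chart M i x + t *: v)}.
    apply: differentiable_continuous; apply/derivable1_diffP.
    by have [] := is_derive_line (chart M i x) v 0.
  have cp : {for chart M i x + (0 : R) *: v, continuous (param M i)}.
    by rewrite scale0r addr0; apply: param_continuous; exact: cod_chart.
  have c0 : c 0 = x by rewrite /c scale0r addr0 chartK.
  rewrite -[X in _ --> X]c0.
  exact: (@continuous_comp _ _ _ (fun t : R => chart M i x + t *: v) (param M i) 0 cl0 cp).
have s0x : flow s0 x = x.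
  apply: hausdorff => A B nA nB.
  have nA' : nbhs s0 ((fun s => flow s x) @^-1` A) by exact: continuous_flowl.
  have nB' : F ((fun s => flow s x) @^-1` B).
    have : \forall t \near (0 : R)^'+, B (c t) by apply: cvg_within; exact: cont_c.
    by apply: filterS => t /=; rewrite fs.
  have [s [As Bs]] := cl _ _ nB' nA'.
  by exists (flow s x).
have df : differentiable (flow_chart rho i i) (chart M i x, 0).
  by apply: flow_chart_diff; exact: flow_domP0.
pose C : R := m%:R * `|Y|.
have C0 : 0 <= C by rewrite mulr_ge0.
pose D : R := m%:R * (2 * m%:R * `|v| * `|Y| * `|l|).
have D0 : 0 <= D by rewrite !mulr_ge0.
(* [C * e <= 1 / 2] lets the error be absorbed in a bound of [|a|] by a multiple of [t]. Inserted in
   the pairing with [l], which kills [a *m Z], that bound gives [t * (v *m l) <= t * (D * e)],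
   contrary to the choice of [e]. *)
pose e : R := Num.min (1 / (2 * (C + 1))) ((v *m l) 0 0 / (2 * (D + 1))).
have e0 : 0 < e by rewrite lt_min !divr_gt0 // ?mulr_gt0 // ltr_wpDl.
have eC : C * e <= 1 / 2.
  rewrite (le_trans (y := (C + 1) * (1 / (2 * (C + 1))))) //.
    apply: ler_pM => //; [exact: ltW|by rewrite lerDl|by rewrite /e ge_min lexx].
  by rewrite [leLHS](_ : _ = 1 / 2) //; field; rewrite gt_eqF // ltr_wpDl.
have eD : D * e < (v *m l) 0 0.
  apply: (@le_lt_trans _ _ ((D + 1) * ((v *m l) 0 0 / (2 * (D + 1))))).
    apply: ler_pM => //; [exact: ltW|by rewrite lerDl|by rewrite /e ge_min lexx orbT].
  rewrite [ltLHS](_ : _ = (v *m l) 0 0 / 2); first by lra.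
  by field; rewrite gt_eqF // ltr_wpDl.
have [d /= d0 hd] := (@nbhs_ballP _ _ _ _).1 (diff_expand df e0).
have est a : `|a| < d -> `|chart M i (flow a x) - chart M i x - a *m Z| <= e * `|a|.
  move=> ad; have na : `|((0, a) : 'rV[R]_m * 'rV[R]_2)| = `|a|.
    by rewrite prod_normE /= normr0; apply/max_idPr.
  have := hd (0, a); rewrite -ball_normE /= sub0r normrN na => /(_ ad).
  rewrite -deriveE // -/(gen a i x) genE // -/Z /flow_chart /= add0r addr0 chartK // flow0.
  exact.
pose A' := [set s | exists t : R, [/\ 0 < t, cod i (chart M i x + t *: v) & s_ (c t) = s]].
have FA' : F A'.
  have n1 : \forall t \near (0 : R)^'+, 0 < t /\ cod i (chart M i x + t *: v).
    near=> t; split; first by near: t; exact: nbhs_right_gt.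
    near: t; apply: cvg_within; apply: nbhs_line; apply: open_nbhs_nbhs; split.
      exact: cod_open.
    exact: cod_chart.
  by move: n1; apply: filterS => t [t0 ct]; exists t.
have nB : nbhs s0 [set s | `|s - s0| < d].
  by apply/nbhs_ballP; exists d => // s; rewrite -ball_normE /= distrC.
have [s [[t [t0 ct <-]] sd]] := cl _ _ FA' nB.
set a := s_ (c t) - s0.
have fa : flow a x = c t by rewrite -[in LHS]s0x -flowD /a addrC subrK fs.
have := est a sd; rewrite fa /c paramK // [chart M i x + _]addrC addrK => h.
have hY : a = (t *: v) *m Y - (t *: v - a *m Z) *m Y.
  by rewrite mulmxBl opprB addrC subrK -mulmxA ZY mulmx1.
have ha : `|a| <= 2 * m%:R * `|v| * `|Y| * t.
  have h1 : `|(t *: v) *m Y| <= m%:R * (t * `|v| * `|Y|).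
    by rewrite (le_trans (mx_norm_mul _ _)) // normrZ (ger0_norm (ltW t0)).
  have h2 : `|(t *: v - a *m Z) *m Y| <= C * e * `|a|.
    rewrite (le_trans (mx_norm_mul _ _)) // /C -!mulrA ler_wpM2l // mulrC ler_wpM2l //.
  have h3 : C * e * `|a| <= 1 / 2 * `|a| by rewrite ler_wpM2r.
  have := ler_normB ((t *: v) *m Y) ((t *: v - a *m Z) *m Y).
  rewrite -hY => h4.
  have -> : 2 * m%:R * `|v| * `|Y| * t = 2 * (m%:R * (t * `|v| * `|Y|)) by ring.
  by lra.
have : t * (v *m l) 0 0 <= t * (D * e).
  have -> : t * (v *m l) 0 0 = ((t *: v - a *m Z) *m l) 0 0.
    by rewrite mulmxBl -mulmxA Zl mulmx0 subr0 -scalemxAl !mxE.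
  rewrite (le_trans (ler_norm _)) // (le_trans (le_mx_norm _ _ _)) //.
  rewrite (le_trans (mx_norm_mul _ _)) //.
  have -> : t * (D * e) = m%:R * ((e * (2 * m%:R * `|v| * `|Y| * t)) * `|l|).
    by rewrite /D; ring.
  by rewrite ler_wpM2l // ler_wpM2r // (le_trans h) // (ler_wpM2l (ltW e0)).
by rewrite ler_pM2l // leNgt eD.
Unshelve. all: by end_near. Qed.

End orbits.

(** * Points whose orbit is tangent to the kernel *)

Section critical.
Context {R : realType} {m : nat} {M : manifold R m} (rho : torus_action M).
Context (omega : form2 M).
Context (rho_preserves_omega : forall g : torus R, preserves_form2 (rho^~ g) omega).
Implicit Types (x : M) (a b s : 'rV[R]_2).

Local Notation flow := (flow rho).
Local Notation gen := (gen rho).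

Lemma kernel_push s a i j x : dom M i x -> dom M j (flow s x) ->
  gen a i x *m form2_mx omega i x = 0 ->
  gen a j (flow s x) *m form2_mx omega j (flow s x) = 0.
Proof.
move=> dx dy h; have dx' : dom M i (flow (- s) (flow s x)) by rewrite flowNK.
have e := @rho_preserves_omega (torus_exp (- s)) j i (flow s x) dy dx'.
have g := gen_push a dy dx'.
rewrite -/(flow (- s) (flow s x)) flowNK in e; rewrite flowNK in g.
by rewrite -e !mulmxA -g h mul0mx.
Qed.

(** Tangency of the orbit to the kernel of omega. Once Z_2 lies in the kernel, these are exactly the
    critical points of the loop integral of Z_1. *)
Definition critical x : Prop := forall i, dom M i x -> forall a,
  gen a i x *m form2_mx omega i x = 0.

Lemma critical_flow s x : critical x -> critical (flow s x).
Proof.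
move=> cx j dy a; have dx := dom_chart_at x.
exact: kernel_push dx dy (cx _ dx a).
Qed.

Lemma criticalP i x a b (p q : R) : dom M i x ->
  a = p *: delta_mx 0 0 -> b = q *: delta_mx 0 1 -> p != 0 -> q != 0 ->
  gen a i x *m form2_mx omega i x = 0 ->
  gen b i x *m form2_mx omega i x = 0 -> critical x.
Proof.
move=> dx ap bq p0 q0 ha hb j dj c.
have dj' : dom M j (flow 0 x) by rewrite flow0.
suff h : gen c i x *m form2_mx omega i x = 0.
  by have := kernel_push dx dj' h; rewrite flow0.
have -> : c = (c 0 0 / p) *: a + (c 0 1 / q) *: b.
  by apply: rV2P; rewrite ap bq !mxE /= ?mulr1 ?mulr0 ?addr0 ?add0r ?divfK.
rewrite (genD rho _ _ dx) (genZ rho _ a dx) (genZ rho _ b dx).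
move: (gen a i x) (gen b i x) ha hb => A B ha hb.
by rewrite mulmxDl -!scalemxAl ha hb !scaler0 addr0.
Qed.

Lemma gen_mx_kermx i x : dom M i x -> (\rank (form2_mx omega i x) + 2 = m)%N ->
  locally_free rho -> critical x -> (gen_mx rho i x == kermx (form2_mx omega i x))%MS.
Proof.
move=> dx rk free cx.
have sub : (gen_mx rho i x <= kermx (form2_mx omega i x))%MS.
  apply/sub_kermxP/row_matrixP => r; rewrite row_mul rowK row0.
  exact: cx.
rewrite /eqmx sub /=.
rewrite -(geq_leqif (mxrank_leqif_sup sub)) mxrank_ker.
have := gen_mx_free free dx; rewrite /row_free => /eqP ->.
by rewrite leq_subLR rk.
Qed.

Lemma critical_kernel i x (w : 'rV[R]_m) : dom M i x ->
  (\rank (form2_mx omega i x) + 2 = m)%N ->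
  locally_free rho -> critical x -> w *m form2_mx omega i x = 0 ->
  exists a, w = gen a i x.
Proof.
move=> dx rk free cx /sub_kermxP wk.
have := gen_mx_kermx dx rk free cx => /eqmxP e.
move: wk; rewrite -e => /submxP [a wa].
by exists a; rewrite genE.
Qed.

End critical.

Section two_critical.
Context {R : realType} {m : nat} {M : manifold R m} (rho : torus_action M).
Context (omega : form2 M) (alpha : form1 M).
Context (omega_exact : is_exterior_derivative alpha omega).
Context (rho_preserves_omega : forall g : torus R, preserves_form2 (rho^~ g) omega).
Implicit Types (x : M) (a b s : 'rV[R]_2).

Local Notation flow := (flow rho).
Local Notation gen := (gen rho).
Local Notation alphaZ := (alphaZ rho alpha).
Local Notation loop := (loop rho alpha).

Lemma constant_alphaZ (r : 'I_2) (p : R) : constant_on_generator alpha rho r ->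
  exists c, forall x, alphaZ (p *: delta_mx 0 r) x = c.
Proof.
move=> [c hc]; exists (p * c) => x; have dx := dom_chart_at x.
rewrite (alphaZE rho alpha _ dx) genZ // -scalemxAl mxE -(hc _ _ dx).
by rewrite generatorE.
Qed.

(** One full turn of a circle factor in unit time, so that loops are parametrized by [0, 1]. *)
Definition circle_period (r : 'I_2) : 'rV[R]_2 := (pi *+ 2) *: delta_mx 0 r.

Lemma circle_periodE r : circle_period r = period (delta_mx 0 r).
Proof.
apply/rowP => k; rewrite !mxE /=.
by case: (k == r); rewrite /= ?mulr1 ?mulr0 ?mul1r ?mul0r.
Qed.

Lemma pi2_neq0 : pi *+ 2 != 0 :> R.
Proof. by rewrite gt_eqF // pmulrn_lgt0 // pi_gt0. Qed.

Lemma constant_generator_kernel (r : 'I_2) : constant_on_generator alpha rho r ->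
  forall i x, dom M i x -> gen (circle_period r) i x *m form2_mx omega i x = 0.
Proof.
move=> hc; apply: (constant_kernel omega_exact rho_preserves_omega (circle_periodE r)).
exact: constant_alphaZ.
Qed.

Lemma constant_critical : constant_on_generator alpha rho 0 ->
  constant_on_generator alpha rho 1 -> forall x, critical rho omega x.
Proof.
move=> h0 h1 x; have dx := dom_chart_at x.
apply: (criticalP rho_preserves_omega dx erefl erefl pi2_neq0 pi2_neq0).
  exact: constant_generator_kernel h0 _ _ dx.
exact: constant_generator_kernel h1 _ _ dx.
Qed.

Lemma loop_extremum_critical x : constant_on_generator alpha rho 1 ->
  (forall y, loop (circle_period 0) y <= loop (circle_period 0) x) \/
  (forall y, loop (circle_period 0) x <= loop (circle_period 0) y) ->
  critical rho omega x.
Proof.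
move=> h1 hx; have dx := dom_chart_at x; set i := chart_at x in dx.
apply: (criticalP rho_preserves_omega dx erefl erefl pi2_neq0 pi2_neq0); last first.
  exact: constant_generator_kernel h1 _ _ dx.
apply: (omegaE_ker dx) => v.
have dl := loop_derive omega_exact rho_preserves_omega v (circle_periodE 0) dx.
have x0 : param M i (chart M i x + (0 : R) *: v) = x by rewrite scale0r addr0 chartK.
case: hx => hx.
  by apply: (derive_at_max dl) => h; rewrite x0; exact: hx.
apply/eqP; rewrite -oppr_eq0; apply/eqP.
by apply: (derive_at_max (is_deriveN dl)) => h /=; rewrite lerN2 x0; exact: hx.
Qed.

Lemma loop_invariant s x : constant_on_generator alpha rho 1 ->
  loop (circle_period 0) (flow s x) = loop (circle_period 0) x.
Proof.
move=> h1.
have -> : s = (s 0 0 / (pi *+ 2)) *: circle_period 0 + (s 0 1 / (pi *+ 2)) *: circle_period 1.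
  by apply: rV2P; rewrite !mxE /= ?mulr1 ?mulr0 ?addr0 ?add0r divfK // pi2_neq0.
rewrite flowD (loop_flow_kernel omega_exact).
- exact: loop_flow (circle_periodE 0).
- exact: constant_alphaZ.
- exact: constant_generator_kernel.
Qed.

Lemma two_critical_orbits : (2 < m)%N -> locally_free rho -> closed_manifold M ->
  [set: M] !=set0 -> constant_on_generator alpha rho 1 ->
  exists x1 x2, [/\ critical rho omega x1, critical rho omega x2 &
    forall s, flow s x1 <> x2].
Proof.
move=> hm free cM M0 h1; set l := loop (circle_period 0).
have cl : {within [set: M], continuous l}.
  by apply: continuous_subspaceT; exact: continuous_loop.
have [x1 _ hx1] := compact_EVT_max M0 cM cl.
have [x2 _ hx2] := compact_EVT_min M0 cM cl.
have max1 y : l y <= l x1 by apply: hx1; rewrite inE.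
have min2 y : l x2 <= l y by apply: hx2; rewrite inE.
have c1 : critical rho omega x1 by apply: loop_extremum_critical => //; left.
have [e|ne] := eqVneq (l x1) (l x2).
  have [y hy] := exists_other_orbit free hm x1.
  exists x1, y; split => //; apply: loop_extremum_critical => //; left => z.
  by rewrite (le_trans (max1 z)) // e.
exists x1, x2; split => //; first by apply: loop_extremum_critical => //; right.
move=> s e; move/eqP: ne; apply; rewrite -e /l loop_invariant //.
Qed.

End two_critical.

(** * Orbits and integral manifolds *)

Section compactness.
Context {R : realType}.

Lemma compact_closed_ball_rV m (y : 'rV[R]_m) (d : R) : compact [set q | `|q - y| <= d].
Proof.
have cl : closed [set q | `|q - y| <= d].
  have -> : [set q | `|q - y| <= d] = (fun q : 'rV[R]_m => `|q - y|) @^-1` [set r | r <= d] by [].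
  apply: closed_comp; last exact: closed_le.
  move=> q _; apply: (@continuous_comp _ _ _ (fun q : 'rV[R]_m => q - y) (Num.norm : 'rV[R]_m -> R)).
    by apply: (@continuousB _ _ _ id (cst y) q); [exact: cvg_id|exact: cst_continuous].
  exact: norm_continuous.
case: m y cl => [|m] y cl.
  have [d0|d0] := leP 0 d.
    have -> : [set q | `|q - y| <= d] = [set y].
      apply/seteqP; split => [q _|_ ->]; first by apply/rowP => -[].
      by rewrite /= subrr normr0.
    exact: compact_set1.
  have -> : [set q | `|q - y| <= d] = set0.
    by apply/seteqP; split => // q /=; rewrite leNgt (lt_le_trans d0).
  exact: compact0.
apply: bounded_closed_compact => //.
exists (d + `|y|); split; first exact: num_real.
move=> r hr q /= hq; have := ler_normD (q - y) y; rewrite subrK => h.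
by apply: le_trans h (le_trans _ (ltW hr)); rewrite lerD2r.
Qed.

(** Continuity is asked at the points of [K] only, because a [param] is a total function controlled
    only on the image of its chart. *)
Lemma compact_preimage_closed (X Y : topologicalType) (K : set X) (h : X -> Y) (C : set Y) :
  compact K -> (forall x, K x -> {for x, continuous h}) -> closed C ->
  compact (K `&` h @^-1` C).
Proof.
move=> cK ch cC F FF FKC.
have FK : F K by apply: filterS FKC => x [].
have [p [Kp clp]] := cK F FF FK.
exists p; split => //; split => //; apply: cC => B nB.
have nB' : nbhs p (h @^-1` B) by exact: ch Kp _ nB.
by have [q [[_ Cq] Bq]] := clp _ _ FKC nB'; exists (h q).
Qed.

Lemma curve_invariant_continuous m s (r : nat) (W : 'rV[R]_m -> 'M[R]_(m, s)) (U S : set 'rV[R]_m)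
    (y0 : 'rV[R]_m) (d0 : R) :
  open U -> U y0 -> Ck_on 1 U W -> (forall y, U y -> \rank (W y) = r) -> S y0 ->
  0 < d0 ->
  (forall d, 0 < d -> d <= d0 -> compact (S `&` [set y | `|y - y0| <= d])) ->
  (forall q, `|q - y0| <= d0 -> S q -> forall w : 'rV[R]_m, w *m W q = 0 ->
    exists gam : R -> 'rV[R]_m, [/\ gam 0 = q, is_derive (0 : R) 1 gam w &
      \forall h \near 0^'+, S (gam h)]) ->
  exists2 d : R, 0 < d & forall (c c' : R -> 'rV[R]_m), c 0 = y0 ->
    (forall t : R, t \in `[0, 1] -> [/\ is_derive t 1 c (c' t), `|c t - y0| <= d,
       c' t *m W (c t) = 0 & {for t, continuous c'}]) ->
    S (c 1).
Proof.
move=> oU Uy0 cW rW Sy0 d00 cS tanS.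
have [d dpos hd] := curve_invariant oU Uy0 cW rW Sy0 d00 cS tanS.
exists d => // c c' c0 hc.
have i1 : (1 : R) \in `[0, 1] by rewrite in_itv /= lexx ler01.
have cn : {within `[0 : R, 1], continuous (fun t => `|c' t|)}.
  apply: continuous_in_subspaceT => t /set_mem t01; have [_ _ _ ct] := hc t t01.
  by apply: (@continuous_comp _ _ _ c' (Num.norm : 'rV[R]_m -> R)) => //; exact: norm_continuous.
have [tm _ hB] := EVT_max ler01 cn.
apply: (hd c c' `|c' tm| c0) => // t t01.
by have [h1 h2 h3 _] := hc t t01; split => //; exact: hB.
Qed.

End compactness.

Section integral_curves.
Context {R : realType} {m k : nat} {M : manifold R m} (omega : form2 M).
Context (L : integral_manifold omega k).
Local Notation f := (@im_map _ _ _ _ _ L).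

Definition im_chart (i : index L) (j : index M) : 'rV[R]_k -> 'rV[R]_m :=
  chart M j \o f \o param L i.

Definition im_dom (i : index L) (j : index M) : set 'rV[R]_k :=
  chart L i @` (dom L i `&` f @^-1` dom M j).

Lemma im_continuous : continuous f.
Proof. by have [] := im_smooth L. Qed.

Lemma im_domP i j y : im_dom i j y <-> cod i y /\ dom M j (f (param L i y)).
Proof.
split=> [[p [dp fp] <-]|[cy fy]]; first by rewrite chartK //; split=> //; exact: cod_chart.
exists (param L i y); last by rewrite paramK.
by split => //; exact: dom_param.
Qed.

Lemma im_dom_chart i j p : dom L i p -> dom M j (f p) -> im_dom i j (chart L i p).
Proof. by move=> dp fp; exists p. Qed.

Lemma open_im_dom i j : open (im_dom i j).
Proof.
rewrite openE => y /im_domP [cy fy]; rewrite /interior.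
have n1 : \near y, cod i y by apply: open_nbhs_nbhs; split => //; exact: cod_open.
have n2 : \near y, dom M j (f (param L i y)).
  have cf : {for y, continuous (f \o param L i)}.
    by apply: continuous_comp; [exact: param_continuous|exact: im_continuous].
  by apply: cf; apply: open_nbhs_nbhs; split => //; exact: dom_open.
by apply: filterS2 n1 n2 => z ? ?; apply/im_domP.
Qed.

Lemma im_chart_Ck n i j : Ck_on n (im_dom i j) (im_chart i j).
Proof. by have [_ h] := im_smooth L; exact: h. Qed.

Lemma im_chart_diff i j y : im_dom i j y -> differentiable (im_chart i j) y.
Proof. by have [h _] := im_chart_Ck 1 i j; exact: h. Qed.

Lemma im_chart_derive i j y v : im_dom i j y ->
  'D_v (im_chart i j) y = v *m tangent_mx f i j (param L i y).
Proof.
move=> dy; have [cy _] := (im_domP i j y).1 dy.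
by rewrite /tangent_mx paramK // -deriveEjacobian //; exact: im_chart_diff.
Qed.

Lemma im_chart_kernel i j y v : im_dom i j y ->
  'D_v (im_chart i j) y *m form2_mx omega j (f (param L i y)) = 0.
Proof.
move=> dy; have [cy fy] := (im_domP i j y).1 dy.
rewrite (im_chart_derive v dy); have /andP[sub _] := im_tangent (dom_param cy) fy.
by apply/sub_kermxP; exact: submx_trans (submxMl _ _) sub.
Qed.

Lemma im_chart_kernel_surj i j y (w : 'rV[R]_m) : im_dom i j y ->
  w *m form2_mx omega j (f (param L i y)) = 0 ->
  exists v, w = 'D_v (im_chart i j) y.
Proof.
move=> dy /sub_kermxP wk; have [cy fy] := (im_domP i j y).1 dy.
have /andP[_ sub] := im_tangent (dom_param cy) fy.
have /submxP [v wv] := submx_trans wk sub.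
by exists v; rewrite im_chart_derive.
Qed.

End integral_curves.

Section orbit_invariance.
Context {R : realType} {m r : nat} {M : manifold R m} (rho : torus_action M).
Context (omega : form2 M).
Context (rho_preserves_omega : forall g : torus R, preserves_form2 (rho^~ g) omega).
Context (rho_free : locally_free rho).
Context (rank_omega : forall i x, dom M i x -> \rank (form2_mx omega i x) = r) (mr : (r + 2 = m)%N).
Context (L : integral_manifold omega 2).
Local Notation f := (@im_map _ _ _ _ _ L).
Local Notation flow := (flow rho).

Let W j (y : 'rV[R]_m) := form2_mx omega j (param M j y).

Lemma W_C1 j : Ck_on 1 (cod j) (W j).
Proof. exact: form2_smooth. Qed.

Lemma rank_W j y : cod j y -> \rank (W j y) = r.
Proof. by move=> cy; apply: rank_omega; exact: dom_param. Qed.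

Lemma closed_orbit x : closed [set y | exists s, y = flow s x].
Proof.
apply: compact_closed; first exact: hausdorff.
have -> : [set y | exists s, y = flow s x] = rho x @` [set: torus R].
  apply/seteqP; split => [_ [s ->]|_ [g _ <-]]; first by exists (torus_exp s).
  by have [s _ <-] := torus_exp_surj g; exists s.
apply: continuous_compact; last exact: compact_torus.
apply: continuous_subspaceT => g.
apply: (@continuous_comp _ _ _ (fun g : torus R => (x, g)) (fun z : M * torus R => rho z.1 z.2)).
  by apply: continuous_pair; [exact: cst_continuous|exact: cvg_id].
exact: act_continuous.
Qed.

Lemma cod_ball j y0 : cod (M := M) j y0 -> exists2 d : R, 0 < d &
  forall y, `|y - y0| <= d -> cod j y.
Proof.
move=> cy; have n : nbhs y0 (cod j) by apply: open_nbhs_nbhs; split => //; exact: cod_open.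
have [d /= d0 hd] := (@nbhs_ballP _ _ _ _).1 n.
exists (d / 2); first by rewrite divr_gt0.
move=> y hy; apply: hd; rewrite -ball_normE /= distrC (le_lt_trans hy) //; lra.
Qed.

(** The invariance lemma is applied to the trace [S] of the orbit in a chart, which is locally
    compact because orbits are closed. At a critical point the generators span the kernel, so every
    kernel vector is the velocity of a flow line inside [S]. The curves tested are the images of
    segments starting at [p0] in a chart of [L]. *)
Lemma integral_in_orbit p0 : critical rho omega (f p0) ->
  \forall p \near p0, exists s, f p = flow s (f p0).
Proof.
move=> cx; set x0 := f p0; have dj := dom_chart_at x0; set j := chart_at x0 in dj.
have di := dom_chart_at p0; set i := chart_at p0 in di.
set y0 := chart M j x0; have cy0 : cod j y0 by exact: cod_chart.
pose S := cod j `&` [set y | exists s, param M j y = flow s x0].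
have Sy0 : S y0 by split => //; exists 0; rewrite flow0 chartK.
have [d0 d00 hd0] := cod_ball cy0.
have cS d : 0 < d -> d <= d0 -> compact (S `&` [set y | `|y - y0| <= d]).
  move=> _ dd; have -> : S `&` [set y | `|y - y0| <= d] =
      [set y | `|y - y0| <= d] `&` param M j @^-1` [set y | exists s, y = flow s x0].
    apply/seteqP; split => [y [[_ h] hy]|y [hy h]]; first by split.
    by split => //; split => //; apply: hd0; exact: le_trans hy dd.
  apply: compact_preimage_closed; [exact: compact_closed_ball_rV| |exact: closed_orbit].
  by move=> y hy; apply: param_continuous; apply: hd0; exact: le_trans hy dd.
have tanS q : `|q - y0| <= d0 -> S q -> forall w : 'rV[R]_m, w *m W j q = 0 ->
    exists gam : R -> 'rV[R]_m, [/\ gam 0 = q, is_derive (0 : R) 1 gam w &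
      \forall h \near 0^'+, S (gam h)].
  move=> _ [cq [s qs]] w wW; set z := param M j q in qs.
  have dz : dom M j z by exact: dom_param.
  have cz : critical rho omega z by rewrite qs; exact: critical_flow.
  have rk : (\rank (form2_mx omega j z) + 2 = m)%N by rewrite (rank_omega dz).
  have [a wa] := critical_kernel dz rk rho_free cz wW.
  exists (fun h => chart M j (flow (h *: a) z)); split.
  - by rewrite scale0r flow0 paramK.
  - rewrite wa; have := @is_derive_flow _ _ _ rho j z 0 a 0.
    rewrite add0r scale0r flow0 => /(_ dz); under eq_fun do rewrite add0r.
    exact.
  have nd : \forall t \near (0 : R), dom M j (flow (0 + t *: a) z).
    have : nbhs (0 : 'rV[R]_2) ((fun s => flow s z) @^-1` dom M j).
      apply: (@continuous_flowl _ _ _ rho z); rewrite flow0.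
      by apply: open_nbhs_nbhs; split; first exact: dom_open.
    exact: nbhs_line.
  apply: cvg_within; apply: filterS nd => h; rewrite add0r => dh.
  split; first exact: cod_chart.
  by exists (s + h *: a); rewrite /= chartK // flowD -qs.
have [d dpos hd] := curve_invariant_continuous (@cod_open _ _ M j) cy0 (W_C1 j) (@rank_W j) Sy0 d00 cS tanS.
set q0 := chart L i p0.
have Dq0 : im_dom i j q0 by exact: im_dom_chart.
have near_q : \forall q \near q0, im_dom i j q /\ `|im_chart i j q - y0| <= d.
  near=> q; split.
    by near: q; apply: open_nbhs_nbhs; split => //; exact: open_im_dom.
  have e0 : im_chart i j q0 = y0 by rewrite /im_chart /= chartK.
  rewrite -e0 distrC; near: q.
  have cc : {for q0, continuous (im_chart i j)}.
    by apply: differentiable_continuous; exact: im_chart_diff.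
  by have /cvgrPdist_le := cc; apply.
have [e /= epos he] := (@nbhs_ballP _ _ _ _).1 near_q.
have main v : `|v| < e -> exists s, f (param L i (q0 + v)) = flow s x0.
  move=> ve.
  have inb (t : R) : t \in `[0, 1] -> im_dom i j (q0 + t *: v) /\
      `|im_chart i j (q0 + t *: v) - y0| <= d.
    rewrite in_itv /= => /andP[t0 t1]; apply: he.
    rewrite -ball_normE /= opprD addNKr normrN normrZ (ger0_norm t0).
    by rewrite (le_lt_trans _ ve) // ler_piMl.
  have := hd (fun t => im_chart i j (q0 + t *: v)) (fun t => 'D_v (im_chart i j) (q0 + t *: v)).
  rewrite scale0r addr0 scale1r => h.
  have [] : S (im_chart i j (q0 + v)).
    apply: h; first by rewrite /im_chart /= chartK.
    move=> t t01; have [Dt dt] := inb t t01; split; [|exact: dt| |].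
    - by apply: is_derive_along_line; exact: im_chart_diff.
    - have [ct ft] := (im_domP i j _).1 Dt.
      by rewrite /W /im_chart /= chartK //; exact: im_chart_kernel.
    - apply: (@continuous_comp _ _ _ (fun t : R => q0 + t *: v) ('D_v (im_chart i j))).
        apply: differentiable_continuous; apply/derivable1_diffP.
        by have [] := is_derive_line q0 v t.
      by have [_ h2] := im_chart_Ck 1 i j; exact: h2.
  move=> _ [s]; have i1 : (1 : R) \in `[0, 1] by rewrite in_itv /= lexx ler01.
  have [D1 _] := inb 1 i1; rewrite scale1r in D1; have [c1 f1] := (im_domP i j _).1 D1.
  by rewrite /im_chart /= chartK // => hs; exists s.
have near_p : \forall p \near p0, dom L i p /\ `|chart L i p - q0| < e.
  near=> p; split; first by near: p; apply: open_nbhs_nbhs; split => //; exact: dom_open.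
  rewrite distrC; near: p.
  by have /cvgrPdist_lt := chart_continuous di; apply.
apply: filterS near_p => p [dp hp].
by have := main _ hp; rewrite addrC subrK chartK.
Unshelve. all: by end_near. Qed.

End orbit_invariance.

Section orbit_in_integral.
Context {R : realType} {m r : nat} {M : manifold R m} (rho : torus_action M).
Context (omega : form2 M).
Context (rho_preserves_omega : forall g : torus R, preserves_form2 (rho^~ g) omega).
Context (rank_omega : forall i x, dom M i x -> \rank (form2_mx omega i x) = r).
Context {k : nat} (L : integral_manifold omega k).
Local Notation f := (@im_map _ _ _ _ _ L).
Local Notation flow := (flow rho).

Let W j (y : 'rV[R]_m) := form2_mx omega j (param M j y).

(** The roles are exchanged: [S] is the image of a small closed ball of [L] around [p0], and the
    curves tested are flow lines. The point is found in a prescribed neighbourhood for the own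
    topology of [L], which is what continuity of a map into [L] will require. *)
Lemma orbit_in_integral p0 (N : set L) : critical rho omega (f p0) -> nbhs p0 N ->
  \forall s \near (0 : 'rV[R]_2), exists2 p, N p & f p = flow s (f p0).
Proof.
move=> cx nN; set x0 := f p0; have dj := dom_chart_at x0; set j := chart_at x0 in dj.
have di := dom_chart_at p0; set i := chart_at p0 in di.
set y0 := chart M j x0; have cy0 : cod j y0 by exact: cod_chart.
set q0 := chart L i p0.
have Dq0 : im_dom i j q0 by exact: im_dom_chart.
have near_q : \forall q \near q0, im_dom i j q /\ N (param L i q).
  have n1 : \forall q \near q0, im_dom i j q.
    by apply: open_nbhs_nbhs; split => //; exact: open_im_dom.
  have n2 : \forall q \near q0, N (param L i q).
    by apply: (param_continuous (cod_chart di)); rewrite chartK.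
  by apply: filterS2 n1 n2 => q ? ?; split.
have [e /= epos he] := (@nbhs_ballP _ _ _ _).1 near_q.
pose de := e / 2; have depos : 0 < de by rewrite divr_gt0.
have inb q : `|q - q0| <= de -> im_dom i j q /\ N (param L i q).
  move=> hq; apply: he; rewrite -ball_normE /= distrC (le_lt_trans hq) // /de; lra.
have psi_cont q : im_dom i j q -> {for q, continuous (im_chart i j : 'rV[R]_k -> 'rV[R]_m)}.
  by move=> Dq; apply: differentiable_continuous; exact: im_chart_diff.
pose B := [set q : 'rV[R]_k | `|q - q0| <= de].
pose S := im_chart i j @` B.
have psi0 : im_chart i j q0 = y0 by rewrite /im_chart /= chartK.
have Bq0 : B q0 by rewrite /B /= subrr normr0 ltW.
have Sy0 : S y0 by exists q0.
have cont_on (K : set 'rV[R]_k) : (forall q, K q -> im_dom i j q) ->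
    {within K, continuous (im_chart i j : 'rV[R]_k -> 'rV[R]_m)}.
  by move=> KD; apply: continuous_in_subspaceT => q /set_mem /KD; exact: psi_cont.
have cS0 : compact S.
  apply: continuous_compact; last exact: compact_closed_ball_rV.
  by apply: cont_on => q /inb [].
have psi_inj q q' : im_dom i j q -> im_dom i j q' -> im_chart i j q = im_chart i j q' -> q = q'.
  move=> /im_domP [cq fq] /im_domP [cq' fq'] e1.
  have e2 : f (param L i q) = f (param L i q').
    by rewrite -(chartK fq) -(chartK fq'); congr (param M j _).
  by rewrite -(paramK cq) -(paramK cq') (im_injective e2).
(* The sphere is mapped away from [y0], so that points of [S] near [y0] are
   images of interior points of [B]. *)
pose Sph := [set q : 'rV[R]_k | `|q - q0| = de].
have cSph : compact (im_chart i j @` Sph).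
  have SB q : Sph q -> im_dom i j q by move=> hq; have [] := inb q ltac:(by rewrite hq).
  apply: continuous_compact; first exact: cont_on.
  have -> : Sph = B `&` (fun q => `|q - q0|) @^-1` [set x | de <= x].
    apply/seteqP; split => [q|q [h1 h2]].
      by rewrite /Sph /B /= => ->; split => /=.
    by apply/eqP; rewrite eq_le h1.
  apply: compact_preimage_closed; [exact: compact_closed_ball_rV| |exact: closed_ge].
  move=> q _; apply: (@continuous_comp _ _ _ (fun q : 'rV[R]_k => q - q0) (Num.norm : 'rV[R]_k -> R)).
    by apply: (@continuousB _ _ _ id (cst q0) q); [exact: cvg_id|exact: cst_continuous].
  exact: norm_continuous.
have ny0 : ~ (im_chart i j @` Sph) y0.
  move=> [q hq e1]; have [Dq _] := inb q ltac:(by rewrite hq).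
  have qq0 : q = q0 by apply: psi_inj => //; rewrite e1.
  by move: hq; rewrite /Sph /= qq0 subrr normr0 => h; move: depos; rewrite -h ltxx.
have oSph : open (~` (im_chart i j @` Sph)).
  apply: closed_openC; apply: compact_closed => //; exact: norm_hausdorff.
have nSph : nbhs y0 (~` (im_chart i j @` Sph)) by apply: open_nbhs_nbhs.
have [d1 /= d10 hd1] := (@nbhs_ballP _ _ _ _).1 nSph.
pose d0 := d1 / 2; have d00 : 0 < d0 by rewrite divr_gt0.
have interior_S q : `|im_chart i j q - y0| <= d0 -> B q -> `|q - q0| < de.
  move=> hq Bq; rewrite lt_neqAle Bq andbT; apply/eqP => hS.
  apply: (hd1 (im_chart i j q)); last by exists q.
  by rewrite -ball_normE /= distrC (le_lt_trans hq) // /d0; lra.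
have cS d : 0 < d -> d <= d0 -> compact (S `&` [set y | `|y - y0| <= d]).
  move=> _ _.
  have -> : [set y : 'rV[R]_m | `|y - y0| <= d] = (fun y => `|y - y0|) @^-1` [set x | x <= d] by [].
  apply: compact_preimage_closed; [exact: cS0| |exact: closed_le].
  move=> q _; apply: (@continuous_comp _ _ _ (fun q : 'rV[R]_m => q - y0) (Num.norm : 'rV[R]_m -> R)).
    by apply: (@continuousB _ _ _ id (cst y0) q); [exact: cvg_id|exact: cst_continuous].
  exact: norm_continuous.
have tanS q : `|q - y0| <= d0 -> S q -> forall w : 'rV[R]_m, w *m W j q = 0 ->
    exists gam : R -> 'rV[R]_m, [/\ gam 0 = q, is_derive (0 : R) 1 gam w &
      \forall h \near 0^'+, S (gam h)].
  move=> hq [b Bb bq] w wW; rewrite -bq in hq.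
  have [Db _] := inb b Bb; have [cb fb] := (im_domP i j b).1 Db.
  have bint := interior_S b hq Bb.
  rewrite -bq /W /im_chart /= chartK // in wW.
  have [v wv] := im_chart_kernel_surj Db wW.
  exists (fun h => im_chart i j (b + h *: v)); split.
  - by rewrite scale0r addr0.
  - have := @is_derive_along_line _ _ _ (im_chart i j) b v 0.
    by rewrite scale0r addr0 wv; apply; exact: im_chart_diff.
  have nb : \forall b' \near b, `|b' - q0| <= de.
    apply/nbhs_ballP; exists (de - `|b - q0|); first by rewrite /= subr_gt0.
    move=> b' /=; rewrite -ball_normE /= distrC => hb.
    by have := ler_normD (b' - b) (b - q0); rewrite addrA subrK; lra.
  apply: cvg_within; have := nbhs_line v nb; apply: filterS => h hb.
  by exists (b + h *: v).
have rank_W y : cod j y -> \rank (W j y) = r.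
  by move=> cy; apply: rank_omega; exact: dom_param.
have W_C1 : Ck_on 1 (cod j) (W j) by exact: form2_smooth.
have [d dpos hd] := curve_invariant_continuous (@cod_open _ _ M j) cy0 W_C1 rank_W Sy0 d00 cS tanS.
have dx := dom_chart_at x0.
have near_s : \forall s \near (0 : 'rV[R]_2), dom M j (flow s x0) /\
    `|chart M j (flow s x0) - y0| <= d.
  have n1 : \forall s \near (0 : 'rV[R]_2), dom M j (flow s x0).
    apply: (@continuous_flowl _ _ _ rho x0); rewrite flow0.
    by apply: open_nbhs_nbhs; split; first exact: dom_open.
  have n2 : \forall s \near (0 : 'rV[R]_2), `|y0 - chart M j (flow s x0)| <= d.
    have cc : {for (0 : 'rV[R]_2), continuous (chart M j \o (fun s => flow s x0))}.
      apply: continuous_comp; first exact: continuous_flowl.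
      by apply: chart_continuous; rewrite flow0.
    have /cvgrPdist_le := cc; rewrite /= flow0 -/y0; apply.
    exact: dpos.
  by apply: filterS2 n1 n2 => s h1 h2; split => //; rewrite distrC.
have [e2 /= e2pos he2] := (@nbhs_ballP _ _ _ _).1 near_s.
apply/nbhs_ballP; exists e2 => // s; rewrite -ball_normE /= sub0r normrN => se.
have ins (t : R) : t \in `[0, 1] -> dom M j (flow (0 + t *: s) x0) /\
    `|chart M j (flow (0 + t *: s) x0) - y0| <= d.
  rewrite in_itv /= => /andP[t0 t1]; apply: he2.
  rewrite -ball_normE /= sub0r normrN add0r normrZ (ger0_norm t0).
  by rewrite (le_lt_trans _ se) // ler_piMl.
(* The velocity is written as a derivative of [flow_chart] rather than as a generator because its
   continuity in [t] is then part of C^1 regularity. *)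
have := hd (fun t => chart M j (flow (0 + t *: s) x0))
  (fun t => 'D_((0, s) : 'rV[R]_m * 'rV[R]_2) (flow_chart rho j j) (y0, 0 + t *: s)).
rewrite scale0r addr0 flow0 scale1r add0r => h.
have [] : S (chart M j (flow s x0)).
  apply: h; first exact: erefl.
  move=> t t01; have [Dt dt] := ins t t01.
  have Ft : flow_dom rho j j (y0, 0 + t *: s) by exact: flow_domP.
  have gE := derive_flow_time s dj Dt.
  split; [|exact: dt| |].
  - by rewrite gE; exact: is_derive_flow.
  - have ct : critical rho omega (flow (0 + t *: s) x0) by exact: critical_flow.
    by rewrite gE /W chartK //; exact: ct.
  - apply: (@continuous_comp _ _ _ (fun t : R => (y0, 0 + t *: s))
      ('D_((0, s) : 'rV[R]_m * 'rV[R]_2) (flow_chart rho j j))).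
      apply: continuous_pair; first exact: cst_continuous.
      apply: differentiable_continuous; apply/derivable1_diffP.
      by have [] := is_derive_line 0 s t.
    by have [_ h2] := flow_chart_Ck rho 1 j j; exact: h2.
move=> b Bb eb; have [Db Nb] := inb b Bb; have [cb fb] := (im_domP i j b).1 Db.
exists (param L i b) => //.
have i1 : (1 : R) \in `[0, 1] by rewrite in_itv /= lexx ler01.
have [D1 _] := ins 1 i1; rewrite scale1r add0r in D1.
by rewrite -(chartK fb) -(chartK D1); congr (param M j _).
Qed.

End orbit_in_integral.

(** * The lattice of periods of an orbit *)

(** The infimum of the positive elements is attained, for otherwise two distinct elements would lie
    within [e] of each other. Euclidean division by this least element does the rest. *)
Lemma discrete_subgroup_cyclic {R : realType} (H : set R) (h0 e : R) :
  (forall s t, H s -> H t -> H (s - t)) -> H h0 -> 0 < h0 -> 0 < e ->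
  (forall t, 0 < t -> t < e -> ~ H t) ->
  exists2 a : R, 0 < a & H a /\ forall t, H t -> exists z : int, t = z%:~R * a.
Proof.
move=> Hsub Hh0 h00 e0 He.
pose A := [set t | 0 < t /\ H t].
have A0 : A !=set0 by exists h0.
have lA : lbound A e.
  by move=> t [t0 Ht]; rewrite leNgt; apply/negP => te; exact: He t t0 te Ht.
have iA : has_inf A by split => //; exists e.
pose a := inf A.
have ea : e <= a by exact: lb_le_inf.
have a0 : 0 < a by exact: lt_le_trans ea.
have Ha : H a.
  have [t [t0 Ht] ta] : exists2 t, A t & t < a + e by exact: inf_adherent.
  have at_ : a <= t by apply: ge_inf => //; exists e.
  have [->//|ne] := eqVneq a t.
  have lt : a < t by rewrite lt_neqAle ne.
  have [u [u0 Hu] ut] : exists2 u, A u & u < a + (t - a).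
    by apply: inf_adherent; rewrite ?subr_gt0.
  have au : a <= u by apply: ge_inf => //; exists e.
  exfalso; apply: (He (t - u)); [|lra|exact: Hsub].
  by rewrite subr_gt0; move: ut; lra.
have H0 : H 0 by rewrite -(subrr a); exact: Hsub.
have HD s t : H s -> H t -> H (s + t).
  by move=> Hs Ht; rewrite -[t]opprK -[- t]sub0r; exact: Hsub Hs (Hsub _ _ H0 Ht).
have Hnat n : H (n%:R * a).
  elim: n => [|n IH]; first by rewrite mul0r.
  by rewrite -natr1 mulrDl mul1r; exact: HD.
have Hint (z : int) : H (z%:~R * a).
  case: z => n; first exact: Hnat.
  by rewrite NegzE mulrNz mulNr -sub0r; apply: Hsub => //; exact: Hnat.
exists a => //; split => // t Ht; pose z := Num.floor (t / a); exists z.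
have u0 : 0 <= t - z%:~R * a by rewrite subr_ge0 -ler_pdivlMr // floor_le.
have ua : t - z%:~R * a < a.
  rewrite ltrBlDl [ltRHS](_ : _ = (z%:~R + 1) * a); last by ring.
  by rewrite -ltr_pdivrMr //; have := floorD1_gt (t / a); rewrite intrD.
have Hu : H (t - z%:~R * a) by exact: Hsub.
apply/eqP; rewrite -subr_eq0 eq_le u0 andbT leNgt; apply/negP => up.
have : a <= t - z%:~R * a by apply: ge_inf; [exists e|split].
by rewrite leNgt ua.
Qed.

Section lattice.
Context {R : realType} {m : nat} {M : manifold R m} (rho : torus_action M).
Context (rho_free : locally_free rho).
Local Notation flow := (flow rho).

Let e0 : 'rV[R]_2 := delta_mx 0 0.
Let e1 : 'rV[R]_2 := delta_mx 0 1.

Lemma flow_fixB x s t : flow s x = x -> flow t x = x -> flow (s - t) x = x.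
Proof. by move=> hs ht; rewrite flowD hs -[in LHS]ht flowNK. Qed.

Lemma flow_fixD x s t : flow s x = x -> flow t x = x -> flow (s + t) x = x.
Proof. by move=> hs ht; rewrite flowD hs. Qed.

Lemma flow_fixZ x s (z : int) : flow s x = x -> flow (z%:~R *: s) x = x.
Proof.
move=> hs; have hn n : flow (n%:R *: s) x = x.
  elim: n => [|n IH]; first by rewrite scale0r flow0.
  by rewrite -natr1 scalerDl scale1r flow_fixD.
case: z => n; first exact: hn.
rewrite NegzE mulrNz scaleNr -[- _]sub0r.
by apply: flow_fixB; [exact: flow0|exact: hn].
Qed.

(** A projection of a discrete subgroup of the plane need not be discrete. Here it is, because the
    stabilizer contains [2 pi] times the first basis vector: the first coordinate can be reduced to
    a compact interval. *)
Lemma stabilizer_second_discrete x : exists2 e : R, 0 < e &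
  forall s t : R, 0 < t -> t < e -> flow (s *: e0 + t *: e1) x <> x.
Proof.
have [d d0 hd] := flow_stabilizer_isolated rho_free x.
have cK : compact `[0 : R, pi *+ 2] by exact: segment_compact.
pose q (st : R * R) : 'rV[R]_2 := st.1 *: e0 + st.2 *: e1.
have cq st : {for st, continuous q}.
  apply: (@continuousD _ _ _ (fun st : R * R => st.1 *: e0) (fun st => st.2 *: e1)).
    apply: (@continuous_comp _ _ _ fst (fun s : R => s *: e0)); first exact: cvg_fst.
    exact: scalel_continuous.
  apply: (@continuous_comp _ _ _ snd (fun s : R => s *: e1)); first exact: cvg_snd.
  exact: scalel_continuous.
have H : \forall t \near (0 : R)^'+, `[0 : R, pi *+ 2] `<=` (fun s => flow (q (s, t)) x <> x).
  apply: ((compact_near_coveringP _).1 cK _ (0 : R)^'+ (fun t s => flow (q (s, t)) x <> x)) => s _.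
  (* If [(s, 0)] fixes [x], a nearby stabilizing time differs from it by a short stabilizing vector,
     which must be 0, against [0 < t]. Otherwise nearby times do not fix [x] either, as the set of
     fixing times is closed. *)
  have [fs|nfs] := pselect (flow (q (s, 0)) x = x).
    have n1 : nbhs ((s, 0) : R * R) (q @^-1` [set p | `|p - q (s, 0)| < d]).
      apply: cq; apply/nbhs_ballP; exists d => // p; rewrite -ball_normE /= distrC.
      exact.
    have [[A B] /= [nA nB] AB] := n1.
    exists (A, [set t | 0 < t /\ B t]).
      split => //=; have n2 : \forall t \near (0 : R)^'+, 0 < t by exact: nbhs_right_gt.
      by apply: filterI n2 _; apply: cvg_within.
    move=> [s' t] /= [As' [t0 Bt]] fx.
    have e := hd _ (AB (s', t) (conj As' Bt)) (flow_fixB fx fs).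
    move/rowP/(_ 1): e; rewrite !mxE /= !mulr0 !mulr1 !add0r subr0 => t00.
    by move: t0; rewrite t00 ltxx.
  have o : open (~` [set x]).
    by apply: closed_openC; apply: accessible_closed_set1; exact/hausdorff_accessible/hausdorff.
  have n1 : nbhs ((s, 0) : R * R) ((fun st => flow (q st) x) @^-1` (~` [set x])).
    have c2 : {for ((s, 0) : R * R), continuous (fun st => flow (q st) x)}.
      apply: (@continuous_comp _ _ _ q (fun s => flow s x)); first exact: cq.
      exact: continuous_flowl.
    by apply: c2; apply: open_nbhs_nbhs.
  have [[A B] /= [nA nB] AB] := n1.
  exists (A, B); first by split => //=; apply: cvg_within.
  by move=> [s' t] /= ABst; exact: AB.
have [e /= epos he] := H; exists e => // s t t0 te.
pose z := Num.floor (s / (pi *+ 2)); pose s' := s - z%:~R * (pi *+ 2).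
have pi0 : 0 < pi *+ 2 :> R by rewrite pmulrn_lgt0 // pi_gt0.
have s'0 : 0 <= s' by rewrite subr_ge0 -ler_pdivlMr // floor_le.
have s'1 : s' <= pi *+ 2.
  rewrite lerBlDl [leRHS](_ : _ = (z%:~R + 1) * (pi *+ 2)); last by ring.
  rewrite -ler_pdivrMr // ltW //.
  by have := floorD1_gt (s / (pi *+ 2)); rewrite intrD.
have -> : s *: e0 + t *: e1 = q (s', t) + period (z *: delta_mx 0 0).
  apply: rV2P; rewrite !mxE /= ?mulr1 ?mulr0 ?addr0 ?add0r /s' ?subrK //.
  by rewrite mul0r addr0.
rewrite flow_period; apply: (he t); rewrite //=.
  by rewrite sub0r normrN ger0_norm // ltW.
by rewrite in_itv /= s'0.
Qed.

(** The lattice gets the triangular basis [a *: e0], [c *: e0 + b *: e1], where [a] generates the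
    stabilizing times along the first axis and [b] the second coordinates of all stabilizing times.
    The rows of [B] are these vectors divided by 2 pi, so that the stabilizer becomes the image of
    the standard lattice [period]. *)
Lemma stabilizer_basis x : exists2 B : 'M[R]_2, B \in unitmx &
  forall s, flow (s *m B) x = x <-> exists k, s = period k.
Proof.
have pi0 : 0 < pi *+ 2 :> R by rewrite pmulrn_lgt0 // pi_gt0.
have per k : flow (period k) x = x by rewrite -[period k]add0r flow_period flow0.
have per0 : flow ((pi *+ 2) *: e0) x = x by rewrite -/(circle_period 0) circle_periodE.
have per1 : flow ((pi *+ 2) *: e1) x = x by rewrite -/(circle_period 1) circle_periodE.
have [d d0 hd] := flow_stabilizer_isolated rho_free x.
have [a a0 [Ha gena]] : exists2 a : R, 0 < a & flow (a *: e0) x = x /\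
    forall t, flow (t *: e0) x = x -> exists z : int, t = z%:~R * a.
  apply: (@discrete_subgroup_cyclic R [set t | flow (t *: e0) x = x] _ d _ per0 pi0 d0).
    by move=> s t /= hs ht; rewrite scalerBl flow_fixB.
  move=> t t0 td /= ft; have := hd (t *: e0).
  rewrite normrZ (ger0_norm (ltW t0)).
  have -> : `|e0| = 1 :> R.
    apply/le_anti/andP; split.
      by apply: mx_norm_le => // i j; rewrite mxE; case: (_ && _); rewrite ?normr1 ?normr0.
    by have := le_mx_norm e0 0 0; rewrite mxE /= normr1.
  rewrite mulr1 => /(_ td ft) /rowP /(_ 0); rewrite !mxE /= mulr1 => t00.
  by move: t0; rewrite t00 ltxx.
have [e e_0 he] := stabilizer_second_discrete x.
have [b b0 [[c Hb] genb]] : exists2 b : R, 0 < b &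
    (exists c, flow (c *: e0 + b *: e1) x = x) /\
    forall t, (exists s, flow (s *: e0 + t *: e1) x = x) -> exists z : int, t = z%:~R * b.
  apply: (@discrete_subgroup_cyclic R [set t | exists s, flow (s *: e0 + t *: e1) x = x] (pi *+ 2) e).
  - move=> s t /= [p hp] [q hq]; exists (p - q).
    by rewrite !scalerBl addrACA -opprD flow_fixB.
  - by exists 0; rewrite scale0r add0r.
  - exact: pi0.
  - exact: e_0.
  - by move=> t t0 te [s]; exact: he.
pose B : 'M[R]_2 := \matrix_(i, j) ((if i == 0 then a *: e0 else c *: e0 + b *: e1) 0 j / (pi *+ 2)).
have BE (k : 'rV[int]_2) : period k *m B =
    (k 0 0)%:~R *: (a *: e0) + (k 0 1)%:~R *: (c *: e0 + b *: e1).
  have canc (u w : R) : u * (pi *+ 2) * (w / (pi *+ 2)) = u * w.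
    by rewrite -mulrA [(pi *+ 2) * _]mulrC divfK // gt_eqF.
  have l1 : lift ord0 ord0 = 1 :> 'I_2 by apply/val_inj.
  have l0 : ord0 = 0 :> 'I_2 by [].
  apply: rV2P; rewrite !mxE !big_ord_recl big_ord0 !mxE /= l1 l0 ?mulr1 ?mulr0 ?addr0 ?add0r !canc //.
  by rewrite mulr0 add0r.
have uB : B \in unitmx.
  have trig : is_trig_mx B.
    by apply/is_trig_mxP => -[[|[|//]] hi] [[|[|//]] hj] //= _; rewrite !mxE /= mulr0 mul0r.
  rewrite unitmxE (det_trig trig) !big_ord_recl big_ord0 !mxE /= !mulr1 ?mulr0 ?add0r.
  by rewrite unitfE !mulf_neq0 ?invr_neq0 // gt_eqF.
exists B => // s; split => [fs|[k ->]]; last first.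
  by rewrite BE flow_fixD // flow_fixZ.
have [t tdef] : {t | t = s *m B} by exists (s *m B).
rewrite -tdef in fs.
have tE : t = t 0 0 *: e0 + t 0 1 *: e1.
  by apply: rV2P; rewrite !mxE /= ?mulr1 ?mulr0 ?addr0 ?add0r.
have [z2 hz2] : exists z : int, t 0 1 = z%:~R * b.
  by apply: genb; exists (t 0 0); rewrite -tE.
have [z1 hz1] : exists z : int, t 0 0 - z2%:~R * c = z%:~R * a.
  apply: gena; have -> : (t 0 0 - z2%:~R * c) *: e0 = t - z2%:~R *: (c *: e0 + b *: e1).
    apply: rV2P; rewrite !mxE /= ?mulr1 ?mulr0 ?addr0 ?add0r ?subr0 //.
    by rewrite hz2 subrr.
  by apply: flow_fixB => //; exact: flow_fixZ.
exists (\row_i (if i == 0 then z1 else z2)).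
apply: (can_inj (mulmxK uB)); rewrite -tdef BE !mxE /=.
apply: rV2P; rewrite !mxE /= ?mulr1 ?mulr0 ?addr0 ?add0r ?hz2 //.
by rewrite -hz1 subrK.
Qed.

End lattice.

(** * The orbit as an immersed torus *)

Section torus_manifold.
Context {R : realType}.

Lemma Ck_on_local (V W : normedModType R) k (U : set V) (f : V -> W) :
  (forall x, U x -> exists2 U' : set V, U' x & Ck_on k U' f) -> Ck_on k U f.
Proof.
elim: k f => [|k IH] f h /=.
  by move=> x /h [V0 Vx]; apply.
split => [x /h [V0 Vx [df _]]|v]; first exact: df.
by apply: IH => x /h [V0 Vx [_ cf]]; exists V0; [exact: Vx|exact: cf].
Qed.

Lemma Ck_on_cst (V W : normedModType R) k (U : set V) (w : W) : Ck_on k U (fun _ => w).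
Proof.
elim: k w => [|k IH] w /=; first by move=> x _; exact: cst_continuous.
split => [x _|v]; first exact: differentiable_cst.
have -> : (fun x => 'D_v (fun _ : V => w) x) = (fun _ => 0).
  by apply/funext => x; exact: derive_cst.
exact: IH.
Qed.

Lemma is_derive_shift_id (V : normedModType R) (c x v : V) : is_derive x v (fun y => y + c) v.
Proof.
have := is_deriveD (is_derive_id x v) (is_derive_cst c x v).
by rewrite addr0.
Qed.

Lemma differentiable_shift_id (V : normedModType R) (c x : V) : differentiable (fun y : V => y + c) x.
Proof. by apply: (@differentiableD _ _ _ id (cst c)). Qed.

Lemma Ck_on_shift (V : normedModType R) k (U : set V) (c : V) : Ck_on k U (fun y => y + c).
Proof.
case: k => [|k] /=.
  by move=> x _; apply: differentiable_continuous; exact: differentiable_shift_id.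
split => [x _|v]; first exact: differentiable_shift_id.
have -> : (fun x => 'D_v (fun y : V => y + c) x) = (fun _ => v).
  by apply/funext => x; have [] := is_derive_shift_id c x v.
exact: Ck_on_cst.
Qed.

(** Near each point of the overlap the transition is the translation by a period, read off at that
    point. *)
Lemma torus_transition (a b : 'rV[R]_2) :
  smooth_on (box_log a @` (box a `&` box b)) (box_log b \o @torus_exp R).
Proof.
move=> k; apply: Ck_on_local => _ [g [ga gb] <-].
set s0 := box_log a g; have e0 : torus_exp s0 = g by exact: exp_box_log.
have [z sz] : exists z, box_log b g = s0 + period z.
  by apply: torus_exp_eq; rewrite exp_box_log.
exists ((fun s => s + period z) @^-1` cell b).
  by rewrite /preimage /= -sz; exact: cell_box_log.
apply: Ck_on_eq (Ck_on_shift k _ (period z)).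
  apply: open_comp; last exact: open_cell.
  by move=> x _; apply: differentiable_continuous; exact: differentiable_shift_id.
by move=> s hs; rewrite /= -(torus_exp_period s z) box_log_exp.
Qed.

Lemma torus_dom_cover (g : torus R) : exists a, box a g.
Proof.
by have [s _ <-] := torus_exp_surj g; exists s; apply: box_exp; exact: cell_center.
Qed.

Lemma torus_cod_open (a : 'rV[R]_2) : open (box_log a @` box a).
Proof. by rewrite cell_image; exact: open_cell. Qed.

(** The underlying space is [torus R] itself, so the orbit leaf will be homeomorphic to the torus by
    the identity. *)
Definition torus_manifold : manifold R 2 :=
  @Manifold R 2 (torus R) hausdorff_torus second_countable_torus 'rV[R]_2
    box box_log (fun _ => @torus_exp R) open_box torus_dom_cover exp_box_log
    torus_cod_open continuous_box_log (fun _ s _ => @continuous_torus_exp R s)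
    torus_transition.

End torus_manifold.

Section orbit_manifold.
Context {R : realType} {m : nat} {M : manifold R m} (rho : torus_action M).
Context (omega : form2 M).
Context (rho_preserves_omega : forall g : torus R, preserves_form2 (rho^~ g) omega).
Context (rho_free : locally_free rho).
Context (rank_omega : forall i x, dom M i x -> (\rank (form2_mx omega i x) + 2 = m)%N).
Context (x : M) (x_critical : critical rho omega x).
Context (B : 'M[R]_2) (uB : B \in unitmx).
Context (B_basis : forall s, flow rho (s *m B) x = x <-> exists k, s = period k).
Local Notation flow := (flow rho).

Definition torus_log (g : torus R) : 'rV[R]_2 := s2val (cid2 (torus_exp_surj g)).

Lemma torus_logK g : torus_exp (torus_log g) = g.
Proof. exact: s2valP' (cid2 (torus_exp_surj g)). Qed.

(** [torus_log] is an arbitrary section of [torus_exp] and is not continuous. The value does not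
    depend on it, because periods times [B] fix [x]; continuity and smoothness are read through the
    local logarithms [box_log]. *)
Definition orbit_map (g : torus R) : M := flow (torus_log g *m B) x.

Lemma orbit_map_exp s : orbit_map (torus_exp s) = flow (s *m B) x.
Proof.
have [k e] := torus_exp_eq (torus_logK (torus_exp s)).
rewrite /orbit_map e mulmxDl addrC flowD; congr flow.
by apply/B_basis; exists k.
Qed.

Lemma continuous_mulmxr : continuous (mulmxr B : 'rV[R]_2 -> 'rV[R]_2).
Proof.
apply/linear_bounded_continuous/linear_boundedP.
exists (2%:R * `|B|); split => [|r hr u /=]; first exact: num_real.
rewrite (le_trans (mx_norm_mul _ _)) // mulrA mulrAC ler_wpM2r //; exact: ltW.
Qed.

Lemma differentiable_mulmxr s : differentiable (fun s : 'rV[R]_2 => s *m B) s.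
Proof. exact: (@linear_differentiable _ _ _ (mulmxr B) s continuous_mulmxr). Qed.

Lemma derive_mulmxr s v : 'D_v (fun s : 'rV[R]_2 => s *m B) s = v *m B.
Proof.
rewrite deriveE; last exact: differentiable_mulmxr.
exact: (congr1 (fun f => f v) (@diff_lin _ _ _ (mulmxr B) s continuous_mulmxr)).
Qed.

Lemma continuous_orbit_map : continuous orbit_map.
Proof.
move=> g; have [s _ gs] := torus_exp_surj g.
have bg : box s g by rewrite -gs; apply: box_exp; exact: cell_center.
have c1 : {for g, continuous ((fun s => flow (s *m B) x) \o box_log s)}.
  apply: continuous_comp; first exact: continuous_box_log.
  apply: (@continuous_comp _ _ _ (fun s : 'rV[R]_2 => s *m B) (fun s => flow s x)).
    exact: continuous_mulmxr.
  exact: continuous_flowl.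
have e g' : box s g' -> ((fun s => flow (s *m B) x) \o box_log s) g' = orbit_map g'.
  by move=> bg'; rewrite /= -orbit_map_exp exp_box_log.
have nb : \near g, box s g by apply: open_nbhs_nbhs; split => //; exact: open_box.
rewrite /continuous_at -(e g bg); apply: cvg_trans c1.
by apply: near_eq_cvg; apply: filterS nb => g'; exact: e.
Qed.

Lemma orbit_map_inj : injective orbit_map.
Proof.
move=> g g' e.
have fx : flow ((torus_log g - torus_log g') *m B) x = x.
  rewrite mulmxBl; have h : flow (torus_log g *m B) x = flow (torus_log g' *m B) x by [].
  by rewrite flowD h flowNK.
have [k kE] := (B_basis _).1 fx.
rewrite -(torus_logK g) -(torus_logK g') -(torus_exp_period (torus_log g') k) -kE.
by rewrite addrC subrK.
Qed.

Lemma orbit_map_surj s : exists g, orbit_map g = flow s x.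
Proof.
by exists (torus_exp (s *m invmx B)); rewrite orbit_map_exp mulmxKV.
Qed.

(* In the charts, the orbit map is the action composed with this affine map. *)
Let aff (i : index M) (s : 'rV[R]_2) : 'rV[R]_m * 'rV[R]_2 := (chart M i x, s *m B).

Lemma aff_diff i s : differentiable (aff i) s.
Proof. by apply: differentiable_pair => //; exact: differentiable_mulmxr. Qed.

Lemma aff_derive i s v : 'D_v (aff i) s = (0, v *m B).
Proof.
rewrite deriveE; last exact: aff_diff.
rewrite diff_pair //; last exact: differentiable_mulmxr.
rewrite /= diff_cst -(derive_mulmxr s v) deriveE //.
exact: differentiable_mulmxr.
Qed.

Lemma orbit_map_chart j : chart M j \o orbit_map \o @torus_exp R =
  flow_chart rho (chart_at x) j \o aff (chart_at x).
Proof.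
apply/funext => s; rewrite /= orbit_map_exp /flow_chart /= chartK //.
exact: dom_chart_at.
Qed.

Lemma orbit_map_smooth : @smooth_map R 2 m (@torus_manifold R) M orbit_map.
Proof.
split; first exact: continuous_orbit_map.
move=> a j k.
change (Ck_on k (box_log a @` (box a `&` orbit_map @^-1` dom M j))
  (chart M j \o orbit_map \o @torus_exp R)).
rewrite orbit_map_chart.
have h := Ck_on_affine (@open_flow_dom _ _ _ rho (chart_at x) j) (aff_diff (chart_at x))
  (aff_derive (chart_at x)) (flow_chart_Ck rho k (chart_at x) j).
apply: Ck_on_sub h => _ [g [bg dg] <-].
have dx := dom_chart_at x.
split; first exact: cod_chart.
by rewrite /= chartK // -orbit_map_exp exp_box_log.
Qed.

Lemma orbit_map_tangent (a : 'rV[R]_2) j g : box a g -> dom M j (orbit_map g) ->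
  @tangent_mx R 2 m (@torus_manifold R) M orbit_map a j g = B *m gen_mx rho j (orbit_map g).
Proof.
move=> bg dg; have dx := dom_chart_at x; set i := chart_at x in dx.
have gE : orbit_map g = flow (box_log a g *m B) x by rewrite -orbit_map_exp exp_box_log.
rewrite /tangent_mx; change (jacobian (chart M j \o orbit_map \o @torus_exp R) (box_log a g) =
  B *m gen_mx rho j (orbit_map g)).
rewrite orbit_map_chart.
have dG : differentiable (flow_chart rho i j) (aff i (box_log a g)).
  by apply: flow_chart_diff; apply: flow_domP => //; rewrite -gE.
have dc : differentiable (flow_chart rho i j \o aff i) (box_log a g).
  by apply: differentiable_comp => //; exact: aff_diff.
apply/row_matrixP => l; rewrite !rowE -deriveEjacobian //.
rewrite derive_comp //; last exact: aff_diff.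
rewrite aff_derive mulmxA -genE; last exact: dg.
rewrite gE; apply: derive_flow_time; first exact: dx.
by rewrite -gE.
Qed.

Lemma row_full_B : row_full B.
Proof. by rewrite row_full_unit. Qed.

Lemma orbit_map_rank (a : 'rV[R]_2) j g : box a g -> dom M j (orbit_map g) ->
  \rank (@tangent_mx R 2 m (@torus_manifold R) M orbit_map a j g) = 2.
Proof.
move=> bg dg; rewrite orbit_map_tangent // (eqmxMfull _ row_full_B).
by have := gen_mx_free rho_free dg; rewrite /row_free => /eqP.
Qed.

Lemma orbit_map_kernel (a : 'rV[R]_2) j g : box a g -> dom M j (orbit_map g) ->
  (@tangent_mx R 2 m (@torus_manifold R) M orbit_map a j g ==
   kermx (form2_mx omega j (orbit_map g)))%MS.
Proof.
move=> bg dg; rewrite orbit_map_tangent //.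
have c : critical rho omega (orbit_map g) by exact: critical_flow.
apply/eqmxP; apply: eqmx_trans (eqmxMfull _ row_full_B) _.
by apply/eqmxP; exact: gen_mx_kermx (rank_omega dg) rho_free c.
Qed.

Definition orbit_manifold : integral_manifold omega 2 :=
  @IntegralManifold R m M omega 2 (@torus_manifold R) orbit_map
    (ex_intro _ (torus_one R) I) connected_torus orbit_map_smooth orbit_map_inj
    orbit_map_rank orbit_map_kernel.

End orbit_manifold.

(** * Leaves *)

Lemma continuous_bijection_homeomorphic (X Y : topologicalType) (g : X -> Y) (h : Y -> X) :
  compact [set: X] -> hausdorff_space Y -> continuous g -> cancel g h -> cancel h g ->
  homeomorphic Y X.
Proof.
move=> cX hY cg gK hK; exists h, g; split => //.
apply/continuous_closedP => C cC.
have -> : h @^-1` C = g @` C.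
  apply/seteqP; split => [y hy|_ [x Cx <-]]; first by exists (h y).
  by rewrite /preimage /= gK.
apply: compact_closed => //; apply: continuous_compact.
  by apply: continuous_subspaceT; exact: cg.
by apply: subclosed_compact cX _.
Qed.

Section leaves.
Context {R : realType} {m r : nat} {M : manifold R m} (rho : torus_action M).
Context (omega : form2 M).
Context (rho_preserves_omega : forall g : torus R, preserves_form2 (rho^~ g) omega).
Context (rho_free : locally_free rho).
Context (rank_omega : forall i x, dom M i x -> \rank (form2_mx omega i x) = r) (mr : (r + 2 = m)%N).
Local Notation flow := (flow rho).
Local Notation im L := (@im_map _ _ _ _ _ L).

Lemma orbitE x : orbit rho x = [set y | exists s, y = flow s x].
Proof.
apply/seteqP; split => [_ [g _ <-]|_ [s ->]]; last by exists (torus_exp s).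
by have [s _ <-] := torus_exp_surj g; exists s.
Qed.

Lemma orbit_refl x : orbit rho x x.
Proof. by exists (torus_one R) => //; exact: act_one. Qed.

Lemma orbit_eq x y : orbit rho x y -> orbit rho y = orbit rho x.
Proof.
rewrite !orbitE => -[s ->]; apply/seteqP; split => [_ [t ->]|_ [t ->]].
  by exists (s + t); rewrite flowD.
by exists (t - s); rewrite -flowD addrC subrK.
Qed.

Lemma rank_omega2 i x : dom M i x -> (\rank (form2_mx omega i x) + 2 = m)%N.
Proof. by move=> dx; rewrite rank_omega. Qed.

Lemma critical_orbit x y : critical rho omega x -> orbit rho x y -> critical rho omega y.
Proof. by rewrite orbitE => cx [s ->]; exact: critical_flow. Qed.

(** The part of [L] mapped into the orbit is open by [integral_in_orbit] and closed because the
    orbit is compact; connectedness concludes. *)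
Lemma integral_sub_orbit (L : integral_manifold omega 2) x p :
  critical rho omega x -> orbit rho x (im L p) -> im_set L `<=` orbit rho x.
Proof.
move=> cx px; pose K := im L @^-1` orbit rho x.
suff KT : K = [set: L] by move=> _ [q _ <-]; have : K q by rewrite KT.
apply: (@im_connected _ _ _ _ _ L).
- by exists p.
- exists K; last by rewrite setTI.
  rewrite openE => q Kq; rewrite /interior.
  have := integral_in_orbit rho_preserves_omega rho_free rank_omega mr (critical_orbit cx Kq).
  apply: filterS => q' [s hs]; rewrite /K /= -(orbit_eq Kq) orbitE.
  by exists s.
- exists K; last by rewrite setTI.
  apply: closed_comp; first by move=> q _; exact: im_continuous.
  rewrite orbitE; exact: closed_orbit.
Qed.

(** Maximality: an integral manifold containing the orbit meets it, and is therefore contained in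
    it. *)
Lemma critical_orbit_leaf x : critical rho omega x ->
  exists L : integral_manifold omega 2,
    [/\ is_leaf L, im_set L = orbit rho x & homeomorphic L (torus R)].
Proof.
move=> cx; have [B uB hB] := stabilizer_basis rho_free x.
pose L := orbit_manifold rho_preserves_omega rho_free rank_omega2 cx uB hB.
have LE : im_set L = orbit rho x.
  apply/seteqP; split; rewrite orbitE.
    by move=> _ [g _ <-]; exists (torus_log g *m B).
  by move=> _ [s ->]; have [g <-] := orbit_map_surj uB hB s; exists g.
exists L; split => //; last by exists id, id; split => // z; exact: cvg_id.
move=> L' sub; apply/seteqP; split => //.
have [p _ px] : im_set L' x by apply: sub; rewrite LE; exact: orbit_refl.
rewrite LE; apply: (integral_sub_orbit (p := p)) => //.
by rewrite px; exact: orbit_refl.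
Qed.

Lemma leaf_is_orbit (L : integral_manifold omega 2) p : is_leaf L ->
  critical rho omega (im L p) -> im_set L = orbit rho (im L p).
Proof.
move=> leafL cp; have [T [_ TE _]] := critical_orbit_leaf cp.
have sub : im_set L `<=` im_set T.
  by rewrite TE; apply: (integral_sub_orbit (p := p)) => //; exact: orbit_refl.
by rewrite -TE (leafL T sub).
Qed.

(** Only the image of [L] is known to be the orbit. The bijection [g] from the torus to [L] is
    continuous by [orbit_in_integral]; as the torus is compact and [L] is Hausdorff, it is a
    homeomorphism. *)
Lemma leaf_homeomorphic (L : integral_manifold omega 2) p : is_leaf L ->
  critical rho omega (im L p) -> homeomorphic L (torus R).
Proof.
move=> leafL; set x := im L p => cx.
have LE := leaf_is_orbit leafL cx; rewrite -/x in LE.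
have [B uB hB] := stabilizer_basis rho_free x.
pose om := orbit_map rho x B.
have lift_ex g : exists q, im L q = om g.
  have [q _ e] : im_set L (om g).
    by rewrite LE orbitE; exists (torus_log g *m B).
  by exists q.
pose g z := sval (cid (lift_ex z)).
have gE z : im L (g z) = om z by exact: svalP (cid (lift_ex z)).
have inv_ex q : exists z, om z = im L q.
  have : im_set L (im L q) by exists q.
  rewrite LE orbitE => -[s ->]; have [z e] := orbit_map_surj uB hB s.
  by exists z.
pose h q := sval (cid (inv_ex q)).
have hE q : om (h q) = im L q by exact: svalP (cid (inv_ex q)).
have gK : cancel g h by move=> z; apply: (orbit_map_inj hB); rewrite -/om hE gE.
have hK : cancel h g by move=> q; apply: (@im_injective _ _ _ _ _ L); rewrite gE hE.
apply: (continuous_bijection_homeomorphic compact_torus _ _ gK hK); first exact: hausdorff.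
(* The points of the orbit near [om z] come from the neighbourhood [N] of [g z], and injectivity of
   the immersion identifies them with the values of [g]. *)
move=> z N nN; have [s _ zs] := torus_exp_surj z.
have cz : critical rho omega (im L (g z)).
  by rewrite gE; exact: critical_flow.
have ns := orbit_in_integral rho_preserves_omega rank_omega cz nN.
have bz : box s z by rewrite -zs; apply: box_exp; exact: cell_center.
have c1 : {for z, continuous (fun z' => (box_log s z' - s) *m B)}.
  apply: (@continuous_comp _ _ _ (box_log s) (fun s' : 'rV[R]_2 => (s' - s) *m B)).
    exact: continuous_box_log.
  apply: differentiable_continuous.
  apply: (@differentiable_comp _ _ _ _ (fun s' : 'rV[R]_2 => s' - s) (fun s' : 'rV[R]_2 => s' *m B)).
    exact: differentiable_shift_id.
  exact: differentiable_mulmxr.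
have nz : \forall z' \near z, exists2 q, N q &
    im L q = flow ((box_log s z' - s) *m B) (im L (g z)).
  have z0 : (box_log s z - s) *m B = 0.
    by rewrite -zs box_log_exp ?subrr ?mul0mx //; exact: cell_center.
  rewrite /prop_for /continuous_at z0 in c1.
  exact: (c1 _ ns).
have nb : \forall z' \near z, box s z' by apply: open_nbhs_nbhs; split => //; exact: open_box.
apply: filterS2 nz nb => z' [q Nq qE] bz'.
rewrite /preimage /=; have -> : g z' = q => //.
have e : orbit_map rho x B z' = flow (box_log s z' *m B) x.
  by rewrite -[in LHS](exp_box_log bz') (orbit_map_exp hB).
apply: (@im_injective _ _ _ _ _ L); rewrite qE !gE /om e -zs (orbit_map_exp hB).
by rewrite -flowD -mulmxDl [s + _]addrC subrK.
Qed.

End leaves.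

Theorem theorem2 (R : realType) (n : nat) (hn : (1 <= n)%N)
    (M : manifold R (2 * n + 2)) (oM : orientation M)
    (M_nonempty : [set: M] !=set0) (M_closed : closed_manifold M)
    (omega : form2 M) (omega_presymplectic : presymplectic (2 * n) omega)
    (alpha : form1 M) (omega_exact : is_exterior_derivative alpha omega)
    (rho : torus_action M) (rho_locally_free : locally_free rho)
    (rho_preserves_omega : forall g : torus R, preserves_form2 (rho^~ g) omega)
    (alpha_Z2_constant : constant_on_generator alpha rho 1) :
  (exists L1 L2 : integral_manifold omega 2,
      [/\ is_leaf L1, is_leaf L2, im_set L1 <> im_set L2,
          homeomorphic L1 (torus R) & homeomorphic L2 (torus R)])
  /\
  (constant_on_generator alpha rho 0 ->
     (forall A : set M,
        (exists2 L : integral_manifold omega 2, is_leaf L & im_set L = A) <->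
        (exists x : M, orbit rho x = A)) /\
     (forall L : integral_manifold omega 2,
        is_leaf L -> homeomorphic L (torus R))).
Proof.
have [_ rk] := omega_presymplectic.
have leafC := critical_orbit_leaf rho_preserves_omega rho_locally_free rk erefl.
split.
  have hm : (2 < 2 * n + 2)%N by lia.
  have [x1 [x2 [c1 c2 ne]]] := two_critical_orbits omega_exact rho_preserves_omega hm
    rho_locally_free M_closed M_nonempty alpha_Z2_constant.
  have [L1 [l1 e1 h1]] := leafC x1 c1; have [L2 [l2 e2 h2]] := leafC x2 c2.
  exists L1, L2; split => //; rewrite e1 e2 => e.
  have : orbit rho x1 x2 by rewrite e; exact: orbit_refl.
  by rewrite orbitE => -[s hs]; exact: (ne s).
move=> alpha_Z1_constant.
have crit := constant_critical omega_exact rho_preserves_omega alpha_Z1_constant alpha_Z2_constant.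
split=> [A|L leafL]; last first.
  have [p _] := im_nonempty L.
  exact: (leaf_homeomorphic rho_preserves_omega rho_locally_free rk erefl leafL (crit (@im_map _ _ _ _ _ L p))).
split=> [[L leafL <-]|[x <-]].
  have [p _] := im_nonempty L; exists (@im_map _ _ _ _ _ L p).
  by rewrite (leaf_is_orbit rho_preserves_omega rho_locally_free rk erefl leafL (crit (@im_map _ _ _ _ _ L p))).
by have [L [leafL LE _]] := leafC x (crit x); exists L.
Qed.
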